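(* Let $k:(0,+\infty)\to[0,+\infty)$ be a nonincreasing lower semicontinuous function, $1\le q<p<+\infty$, $p'=p/(p-1)$, and let $\mu$ and $\sigma$ be positive locally finite Borel measures on $\mathbf R^n$. Suppose also that $\sigma$ satisfies a doubling condition and that $(k,\sigma)\in\mathrm{LBO}$. Then the following assertions are equivalent: (i) There exists $C>0$ such that for any $f\in L^p(d\sigma)$, $f\ge0$, $$\Big(\int_{\mathbf R^n}T_k[f]^q\,d\mu\Big)^{1/q}\le C\,\|f\|_{L^p(d\sigma)}.$$ (ii) $\displaystyle\sup_{z\in\mathbf R^n}\int_{\mathbf R^n}\big(\mathcal W^{\mathcal D_z}_{K,\sigma}[\mu]\big)^{\frac{q(p-1)}{p-q}}\,d\mu<+\infty$, where $K(Q)=k(r_Q)$. (iii) $\displaystyle\int_{\mathbf R^n}\big(\mathcal W_{k,\sigma}[\mu]\big)^{\frac{q(p-1)}{p-q}}\,d\mu<+\infty$.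
   Context: $B(x,r)$ is the ball of radius $r$ centered at $x$. The measure $\sigma$ satisfies a doubling condition if $\sigma\ne0$ and there is a constant $C$ with $\sigma(B(x,2r))\le C\,\sigma(B(x,r))$ for all $x\in\mathbf R^n$, $r>0$. For $x\in\mathbf R^n$, $r>0$, $$\overline k(r)(x)=\frac1{\sigma(B(x,r))}\int_0^rk(l)\,\sigma(B(x,l))\,\frac{dl}{l}.$$ $(k,\sigma)\in\mathrm{LBO}$ (logarithmic bounded oscillation) means: there exists $C>0$ such that $\frac1C\overline k(r)(x)\le\overline k(r)(z)\le C\,\overline k(r)(x)$ for all $x\in\mathbf R^n$, $r>0$, $z\in B(x,r)$. For $f\ge0$, $$T_k[f](x)=\int_{\mathbf R^n}k(|x-y|)\,f(y)\,d\sigma(y)$$ (with $k(0)=\lim_{r\to0^+}k(r)$; a doubling measure has no atoms, so this value plays no role). The continuous potential is $$\mathcal W_{k,\sigma}[\mu](x)=\int_0^{+\infty}k(r)\,\sigma(B(x,r))\Big(\int_{B(x,r)}\overline k(r)(y)\,d\mu(y)\Big)^{p'-1}\frac{dr}{r}.$$ Let $\mathcal D$ be the family of all (half-open) dyadic cubes in $\mathbf R^n$, $r_Q$ the side length of a cube $Q$, and for $z\in\mathbf R^n$ let $\mathcal D_z=\{Q+z:Q\in\mathcal D\}$ be the shifted dyadic lattice. For $Q\in\mathcal D_z$ put $$\overline K(Q)(x)=\frac1{\sigma(Q)}\sum_{Q'\in\mathcal D_z,\;Q'\subset Q}K(Q')\,\sigma(Q')\,\chi_{Q'}(x),\qquad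 K(Q)=k(r_Q),$$ $$\mathcal W^{\mathcal D_z}_{K,\sigma}[\mu](x)=\sum_{Q\in\mathcal D_z}K(Q)\,\sigma(Q)\Big(\int_Q\overline K(Q)(y)\,d\mu(y)\Big)^{p'-1}\chi_Q(x).$$ All quantities take values in $[0,+\infty]$, with the convention $0\cdot\infty=0$. *)

(* Defs.v *)
From HB Require Import structures.
From mathcomp Require Import all_boot all_order all_algebra.
From mathcomp Require Import all_classical all_reals all_analysis.

Set Implicit Arguments.
Unset Strict Implicit.
Unset Printing Implicit Defensive.
Import Order.TTheory GRing.Theory Num.Theory.
Import numFieldNormedType.Exports.

Local Open Scope classical_set_scope.
Local Open Scope ring_scope.
Local Open Scope ereal_scope.

(* Borel sigma-algebra: generated by the open sets of the library's (sup-norm)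
   topology, which is the Euclidean one. *)
HB.instance Definition _ (R : realType) (m n : nat) :=
  Measurable.copy 'M[R]_(m, n) (g_sigma_algebraType (@open 'M[R]_(m, n))).

Section Definitions.
Context {R : realType} {n : nat}.
Implicit Types (mu sigma : {measure set 'rV[R]_n -> \bar R}).
Implicit Types (x y z : 'rV[R]_n) (r l : R) (k : R -> R).

Definition enorm x : R := Num.sqrt (\sum_(i < n) (x ord0 i) ^+ 2)%R.

(* The library's [ball] on ['rV[R]_n] is a cube, hence the Euclidean version;
   balls are open. *)
Definition eball x r : set 'rV[R]_n := [set y | (enorm (y - x) < r)%R].

Definition locally_finite mu :=
  forall x, exists U : set 'rV[R]_n, [/\ open U, U x & mu U < +oo].

Definition doubling sigma :=
  sigma [set: 'rV[R]_n] != 0 /\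
  exists C : R, forall x r, (0 < r)%R ->
    sigma (eball x (2 * r)) <= C%:E * sigma (eball x r).

(* [k] is a function on ]0, +oo[; its other values are never used, except that
   the kernel is extended to 0 by its (possibly infinite) right limit. *)
Definition kernel0 k r : \bar R :=
  if r == 0%R then lim ((k l)%:E @[l --> 0^'+]) else (k r)%:E.

Definition kbar k sigma r x : \bar R :=
  (sigma (eball x r))^-1 *
  \int[lebesgue_measure]_(l in `]0%R, r[)
    ((k l)%:E * sigma (eball x l) * (l^-1)%:E).

Definition LBO k sigma :=
  exists C : R, (0 < C)%R /\
    forall x r z, (0 < r)%R -> eball x r z ->
      (C^-1)%:E * kbar k sigma r x <= kbar k sigma r z /\
      kbar k sigma r z <= C%:E * kbar k sigma r x.

Definition Tpot k sigma (f : 'rV[R]_n -> R) x : \bar R :=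
  \int[sigma]_y (kernel0 k (enorm (x - y)) * (f y)%:E).

Definition conj_exponent (p : R) : R := (p / (p - 1))%R.

Definition wolff k sigma (p : R) mu x : \bar R :=
  \int[lebesgue_measure]_(r in `]0%R, +oo[)
    ((k r)%:E * sigma (eball x r) *
     (\int[mu]_(y in eball x r) kbar k sigma r y) `^ (conj_exponent p - 1) *
     (r^-1)%:E).

(* [(j, m)] stands for the cube of the unshifted lattice with side [2 ^ j] and
   lower corner [2 ^ j *: m].  For [0 < n] distinct indices give distinct cubes,
   so sums over indices are sums over cubes. *)
Definition dyadic_index := (int * 'rV[int]_n)%type.
Implicit Types (Q : dyadic_index) (K : dyadic_index -> R).

Definition side Q : R := (2 ^ Q.1)%R.

Definition cube z Q : set 'rV[R]_n :=
  [set x | forall i, ((Q.2 ord0 i)%:~R * side Q <= x ord0 i - z ord0 i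
                       < (Q.2 ord0 i + 1)%:~R * side Q)%R].

Definition Kbar z K sigma Q x : \bar R :=
  (sigma (cube z Q))^-1 *
  \esum_(Q' in [set Q' | cube z Q' `<=` cube z Q])
    ((K Q')%:E * sigma (cube z Q') * (\1_(cube z Q') x)%:E).

Definition dyadic_wolff z K sigma (p : R) mu x : \bar R :=
  \esum_(Q in [set: dyadic_index])
    ((K Q)%:E * sigma (cube z Q) *
     (\int[mu]_(y in cube z Q) Kbar z K sigma Q y) `^ (conj_exponent p - 1) *
     (\1_(cube z Q) x)%:E).

End Definitions.

(* Main.v *)
(* On a nested family of partitions the trace inequality for
   T f = sum_i K_i int_(Q_i) f dsigma is dual to L^p'(sigma) bounds for
   A = sum_i a_i, where a_i = K_i int_(Q_i) g dmu.  With m_i the average over the cell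
   of generation i of the tail of this sum, the maximal theorem gives
   int A^p' dsigma ~ sum_i int a_i m_i^(p'-1) dsigma.  Testing with powers of (a
   truncation of) the Wolff sum itself turns the trace inequality into its
   integrability; conversely, when sums of the kernel are essentially constant on
   cells, the right-hand side is at most C int W g^p' dmu and Hoelder concludes.  LBO
   is exactly what makes these kernel sums essentially constant on cubes.

   The finitely many lattices shifted by the vectors with entries in {0, 2^N / 3}
   contain each ball of radius at most 2^N / 8 in a cube of comparable size.  Hence,
   with M the maximal function over the cubes of these lattices, bounded on
   L^p(sigma), one has T_dyadic f <= C T_k (M f) and T_k f <= C T_dyadic (M f), and
   the continuous Wolff potential is at most a sum of shifted dyadic ones.  So (i)
   implies (ii) and (iii), uniformly in the lattice; and each of (ii), (iii) controls
   the Wolff sum of the unshifted lattice and thereby gives (i) back. *)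

Require Import Defs.
From mathcomp Require Import all_boot all_order all_algebra.
From mathcomp Require Import all_classical all_reals all_analysis.
From mathcomp Require Import measurable_realfun ring lra zify.
Set Implicit Arguments.
Unset Strict Implicit.
Unset Printing Implicit Defensive.
Import Order.TTheory GRing.Theory Num.Theory.
Import numFieldNormedType.Exports.
Local Open Scope classical_set_scope.
Local Open Scope ring_scope.
Local Open Scope ereal_scope.

(** * Powers of extended reals *)

(** Two obstacles shape the argument. Nothing bounds k(r) by a multiple of k(2r), so a loss of scale
    in the argument of k cannot be paid for with a constant, whereas a loss of scale in [sigma] can,
    by doubling. The kernel is therefore sampled at 2^(j+m) for cubes of side 2^j, and the sign of
    the offset m matters: the trace inequality passes to dyadic models with m <= 0 and is recovered
    from models with m >= 0. Condition (ii) is m = 0; the continuous potential is bounded above by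
    sums with offset -4 and below by sums with offset n + 1. Absorbing a power of an unknown
    integral requires that integral to be finite, so the absorption is done for truncated
    quantities, with constants independent of the truncation. Moreover a lattice has no coarsest
    cubes: it is cut at side 2^N, and since the shifts 2^N / 3 move with N, the limit in N is a
    liminf rather than a monotone one. The continuous potentials enter only through monotonicity of
    the integral and Fatou's lemma, where measurability is asked of the approximants alone. *)

Section PowerInequalities.
Context {R : realType}.
Implicit Types (x y : \bar R) (a b u r th : R).

Lemma lee_poweR x y r : (0 <= r)%R -> 0 <= x -> x <= y -> x `^ r <= y `^ r.
Proof.
move=> r0 x0 xy; apply: gt0_ler_poweR => //; rewrite in_itv/= leey andbT //.
exact: le_trans x0 xy.
Qed.

Lemma poweRDge0 x r s : (0 <= r)%R -> (0 <= s)%R ->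
  x `^ (r + s) = x `^ r * x `^ s.
Proof.
move=> r0 s0; have [->|rn0] := eqVneq r 0%R; first by rewrite add0r poweRe0 mul1e.
by apply: poweRD; apply: add_neq0_poweRD_def; rewrite paddr_eq0// negb_and rn0.
Qed.

Lemma lee_youngR a b th : (0 < th < 1)%R -> (0 <= a)%R -> (0 <= b)%R ->
  (a `^ th * b `^ (1 - th) <= th * a + (1 - th) * b)%R.
Proof.
move=> /andP[th0 th1] a0 b0.
have th1' : (0 < 1 - th)%R by rewrite subr_gt0.
have := @conjugate_powR R (a `^ th)%R (b `^ (1 - th))%R (th^-1)%R ((1 - th)^-1)%R
  (powR_ge0 _ _) (powR_ge0 _ _).
rewrite !invr_gt0 !invrK => /(_ th0 th1').
rewrite addrC subrK -!powRrM !divff ?gt_eqF// !powRr1//.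
by move=> /(_ erefl); rewrite [(a * _)%R]mulrC [(b * _)%R]mulrC.
Qed.

Lemma lee_young x y th : (0 < th < 1)%R -> 0 <= x -> 0 <= y ->
  x `^ th * y `^ (1 - th) <= th%:E * x + (1 - th)%:E * y.
Proof.
move=> /[dup] tht /andP[th0 th1].
have th1' : (0 < 1 - th)%R by rewrite subr_gt0.
case: x y => [x| |] [y| |]// x0 y0.
- rewrite !poweR_EFin -!EFinM -EFinD lee_fin; rewrite !lee_fin in x0 y0.
  exact: lee_youngR.
- by rewrite [X in _ + X]gt0_muley ?lte_fin// addey ?leey.
- by rewrite [X in X + _]gt0_muley ?lte_fin// addye ?leey.
- by rewrite !gt0_muley ?lte_fin// leey.
Qed.

(* Scaling [x] by [eta^(-(1-th)/th)] and [y] by [eta] leaves the left-hand side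
   unchanged, so any small factor can be put in front of [y]. *)
Lemma lee_young_eta th (eta : R) : (0 < th < 1)%R -> (0 < eta)%R ->
  exists2 C : R, (0 < C)%R & forall x y, 0 <= x -> 0 <= y ->
  x `^ th * y `^ (1 - th) <= C%:E * x + eta%:E * y.
Proof.
move=> /[dup] tht /andP[th0 th1] eta0.
exists (eta `^ (- (1 - th) / th))%R; first exact: powR_gt0.
set C := (eta `^ _)%R => x y x0 y0.
have C0 : (0 < C)%R by exact: powR_gt0.
have -> : x `^ th * y `^ (1 - th) =
    (C%:E * x) `^ th * (eta%:E * y) `^ (1 - th).
  rewrite !poweRM ?lee_fin ?(ltW C0) ?(ltW eta0)// muleACA -[LHS]mul1e; congr (_ * _).
  rewrite !poweR_EFin -EFinM -powRrM divfK ?gt_eqF// -powRD ?(gt_eqF eta0) ?implybT//.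
  by rewrite addNr powRr0.
apply: le_trans (lee_young tht _ _) _; rewrite ?mule_ge0 ?lee_fin ?(ltW C0) ?(ltW eta0)//.
apply: leeD; rewrite muleA; apply: lee_wpmul2r => //;
  rewrite lee_fin ler_piMl ?ltW//.
by rewrite ltrBlDr ltrDl.
Qed.

(** Convexity: the graph of t^(1+b) lies above its tangent at u. The terms are arranged so that no
    subtraction occurs. *)
Lemma young_tangentR a u b : (0 <= a)%R -> (0 <= u)%R -> (0 <= b)%R ->
  ((1 + b) * (a * u `^ b) <= a `^ (1 + b) + b * u `^ (1 + b))%R.
Proof.
move=> a0 u0; rewrite le_eqVlt => /predU1P[<-|b0].
  by rewrite addr0 powRr0 powRr1// mulr1 mul1r mul0r addr0.
have b1 : (0 < 1 + b)%R by rewrite addr_gt0.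
have tht : (0 < (1 + b)^-1 < 1)%R by rewrite invr_gt0 b1 invf_lt1// ltrDl.
have := lee_youngR tht (powR_ge0 a (1 + b)) (powR_ge0 u (1 + b)).
rewrite -!powRrM divff ?gt_eqF// powRr1//.
have e : ((1 + b) * (1 - (1 + b)^-1) = b)%R.
  by rewrite mulrBr mulr1 divff ?gt_eqF// addrAC subrr add0r.
rewrite e -(@ler_pM2l _ (1 + b))// => /le_trans; apply.
by rewrite mulrDr !mulrA e divff ?gt_eqF// mul1r.
Qed.

(** The tangent to t^(1+b) at x + y, evaluated at x. Iterated along partial sums it gives the
    summation by parts below. *)
Lemma poweR_incr x y b : (0 <= b)%R -> 0 <= x -> 0 <= y ->
  (x + y) `^ (1 + b) <= x `^ (1 + b) + (1 + b)%:E * (y * (x + y) `^ b).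
Proof.
move=> b0; have b1 : (0 < 1 + b)%R by rewrite ltr_pwDl.
have ooD (z : \bar R) : 0 <= z -> +oo + z = +oo.
  by move=> z0; rewrite addye// -ltNye (lt_le_trans _ z0).
case: x y => [x| |] [y| |]// x0 y0.
- rewrite -!EFinD !poweR_EFin lee_fin.
  rewrite !lee_fin in x0 y0.
  have := young_tangentR x0 (addr_ge0 x0 y0) b0.
  have e : ((x + y) `^ (1 + b) = (x + y) * (x + y) `^ b)%R.
    by rewrite -(@mulr_powRB1 _ (x + y)%R (1 + b)%R) ?addr_ge0// addrAC subrr add0r.
  by rewrite e; nra.
- have h : 0 < (+oo : \bar R) `^ b by exact: poweR_gt0.
  by rewrite addey// gt0_mulye// gt0_muley ?lte_fin// addey ?leey// poweR_EFin.
- rewrite (@poweRyr _ (1 + b)) ?gt_eqF// ooD ?leey//.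
  by rewrite !mule_ge0 ?poweR_ge0// lee_fin ltW.
- rewrite (@poweRyr _ (1 + b)) ?gt_eqF// ooD ?leey//.
  by rewrite !mule_ge0 ?poweR_ge0// lee_fin ltW.
Qed.

End PowerInequalities.

Section MorePowers.
Context {R : realType}.
Implicit Types (x y : \bar R) (b r : R).

Lemma poweRK x r : (0 < r)%R -> 0 <= x -> (x `^ r^-1) `^ r = x.
Proof. by move=> r0 x0; rewrite -poweRrM mulVf ?gt_eqF// poweRe1. Qed.

Lemma poweRVK x r : (0 < r)%R -> 0 <= x -> (x `^ r) `^ r^-1 = x.
Proof. by move=> r0 x0; rewrite -poweRrM divff ?gt_eqF// poweRe1. Qed.

Lemma lte_poweRVl x y r : (0 < r)%R -> 0 <= x -> 0 <= y ->
  y < x `^ r -> y `^ r^-1 < x.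
Proof.
move=> r0 x0 y0 yx; rewrite ltNge; apply/negP => h.
have := lee_poweR (ltW r0) x0 h.
by rewrite poweRK// leNgt yx.
Qed.

(** Pathwise form of Doob's inequality: x is the running maximum and y the next average. If the
    maximum does not move, both sides agree; if it jumps to y, this is the tangent inequality at x.
    Differences are avoided because all terms may be infinite. *)
Lemma doob_step x y b : (0 < b)%R -> 0 <= x -> 0 <= y ->
  b%:E * maxe x y `^ (1 + b) + (1 + b)%:E * (y * x `^ b)
    <= b%:E * x `^ (1 + b) + (1 + b)%:E * (y * maxe x y `^ b).
Proof.
move=> b0 x0 y0; have [xy|//] := ltP x y.
case: x y x0 y0 xy => [x| |] [y| |]// x0 y0 xy.
- rewrite !poweR_EFin -!EFinM -!EFinD lee_fin; rewrite !lee_fin in x0 y0.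
  have := young_tangentR y0 x0 (ltW b0).
  have e : (y `^ (1 + b) = y * y `^ b)%R.
    by rewrite -(@mulr_powRB1 _ y (1 + b)%R) ?addr_gt0// addrAC subrr add0r.
  by rewrite e; nra.
- have h : 0 < (+oo : \bar R) `^ b by exact: poweR_gt0.
  rewrite [X in _ <= _ + X](_ : _ = +oo).
    by rewrite addey ?leey.
  by rewrite gt0_mulye// gt0_muley// lte_fin addr_gt0.
Qed.

Lemma lte_dense x y : x < y -> exists2 z, x < z & z < y.
Proof.
case: x y => [x| |] [y| |]// xy.
- exists ((x + y) / 2)%:E; rewrite lte_fin; rewrite lte_fin in xy; lra.
- by exists (x + 1)%:E; rewrite ?ltry// lte_fin ltrDl.
- by exists (y - 1)%:E; rewrite ?ltNyr// lte_fin ltrBlDr ltrDl.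
- by exists 0; rewrite ?ltNy0 ?lt0y.
Qed.

Lemma lee_sup_poweR x (u : nat -> \bar R) (r : R) : (0 < r)%R -> 0 <= x ->
  (forall n, 0 <= u n) -> x <= ereal_sup (range u) ->
  x `^ r <= ereal_sup (range (fun n => u n `^ r)).
Proof.
move=> r0 x0 u0 xu; rewrite leNgt; apply/negP => /lte_dense[y zy yf].
have y0 : 0 <= y.
  apply: le_trans (ltW zy); apply: le_trans (ereal_sup_ubound _); last by exists 0%N.
  exact: poweR_ge0.
have /ereal_sup_gt[_ [N _ <-] yg] : y `^ r^-1 < ereal_sup (range u).
  by apply: lt_le_trans xu; exact: lte_poweRVl.
have : y < y.
  apply: (le_lt_trans _ zy).
  rewrite -[leLHS](@poweRK y r)//.
  apply: le_trans (ereal_sup_ubound _); last by exists N.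
  by apply: lee_poweR; rewrite ?poweR_ge0 ?ltW.
by rewrite ltxx.
Qed.

(** Finiteness of x is essential here and in [absorb_poweR], since +oo satisfies the premise;
    securing it is the purpose of the truncations. *)
Lemma absorb_half x y : x < +oo -> x <= y + (2^-1)%:E * x -> x <= 2%:E * y.
Proof.
case: x => [x| |]// _; case: y => [y| |]//.
- rewrite -!EFinM -EFinD !lee_fin => h; lra.
- by move=> _; rewrite gt0_muley ?leey// lte_fin.
- by move=> _; rewrite leNye.
- by move=> _; rewrite leNye.
- by move=> _; rewrite leNye.
Qed.

Lemma absorb_poweR x (c b : R) : (0 <= c)%R -> (0 <= b < 1)%R -> 0 <= x ->
  x < +oo -> x <= c%:E * x `^ b -> x <= (c `^ (1 - b)^-1)%:E.
Proof.
move=> c0 /andP[b0 b1]; case: x => [x| |]// + _.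
rewrite [in X in X -> _]lee_fin le_eqVlt => /predU1P[<-|x0].
  by move=> _; rewrite lee_fin powR_ge0.
have b1' : (0 < 1 - b)%R by rewrite subr_gt0.
rewrite poweR_EFin -EFinM !lee_fin => h.
have xb : (0 < x `^ b)%R by exact: powR_gt0.
have : (x `^ (1 - b) <= c)%R.
  rewrite powRB ?(gt_eqF x0) ?implybT// powRr1 ?(ltW x0)//.
  by rewrite ler_pdivrMr.
move=> /(@ge0_ler_powR _ (1 - b)^-1)%R.
rewrite !nnegrE invr_ge0 (ltW b1') powR_ge0 => /(_ erefl erefl c0).
by rewrite -powRrM divff ?gt_eqF// powRr1 ?(ltW x0).
Qed.

(** Telescoping of [poweR_incr] over initial sums. The companion for tails below peels off the first
    term instead. Initial sums are constant on cells and serve to test the Wolff sum; tails are what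
    the energy averages. *)
Lemma le_sum_poweR (b : R) (a : nat -> \bar R) (L : nat) : (0 <= b)%R ->
  (forall i, 0 <= a i) ->
  (\sum_(i < L) a i) `^ (1 + b) <=
    (1 + b)%:E * \sum_(i < L) a i * (\sum_(l < i.+1) a l) `^ b.
Proof.
move=> b0 a0; have b1 : (0 < 1 + b)%R by rewrite ltr_pwDl.
elim: L => [|L IH]; first by rewrite !big_ord0 poweR0r ?gt_eqF// mule0.
rewrite big_ord_recr/= [in leRHS]big_ord_recr/=.
apply: le_trans (poweR_incr b0 _ (a0 L)) _; first exact: sume_ge0.
rewrite ge0_muleDr; last 2 first.
  by apply: sume_ge0 => i _; rewrite mule_ge0 ?poweR_ge0.
  by rewrite mule_ge0 ?poweR_ge0.
by rewrite leeD// big_ord_recr.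
Qed.

Lemma le_sum_tail_poweR (b : R) (a : nat -> \bar R) (L : nat) : (0 <= b)%R ->
  (forall i, 0 <= a i) ->
  (\sum_(i < L) a i) `^ (1 + b) <=
    (1 + b)%:E * \sum_(i < L) a i * (\sum_(i <= l < L) a l) `^ b.
Proof.
move=> b0 a0; have b1 : (0 < 1 + b)%R by rewrite ltr_pwDl.
elim: L a a0 => [|L IH] a a0; first by rewrite !big_ord0 poweR0r ?gt_eqF// mule0.
rewrite big_ord_recl/= [in leRHS]big_ord_recl/= addeC.
apply: le_trans (poweR_incr b0 _ (a0 0%N)) _; first exact: sume_ge0.
rewrite ge0_muleDr; last 2 first.
  by rewrite mule_ge0 ?poweR_ge0.
  by apply: sume_ge0 => i _; rewrite mule_ge0 ?poweR_ge0.
rewrite addeC leeD//.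
  by rewrite big_mkord big_ord_recl/= addeC.
apply: le_trans (IH (fun i => a i.+1) (fun i => a0 i.+1)) _.
rewrite lee_wpmul2l ?lee_fin ?(ltW b1)//; apply: lee_sum => i _.
by rewrite /bump/= !add1n big_add1/=.
Qed.

Lemma mule_poweR_le x y b : (0 <= b)%R -> 0 <= x -> 0 <= y ->
  x * y `^ b <= x `^ (1 + b) + y `^ (1 + b).
Proof.
move=> b0 x0 y0.
have h z : 0 <= z -> z * z `^ b = z `^ (1 + b).
  by move=> z0; rewrite poweRDge0// poweRe1.
have [xy|yx] := leP x y.
  rewrite (le_trans (lee_wpmul2r (poweR_ge0 _ _) xy))// h// leeDr//.
  exact: poweR_ge0.
rewrite (le_trans (lee_wpmul2l x0 (lee_poweR b0 y0 (ltW yx))))// h// leeDl//.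
exact: poweR_ge0.
Qed.

End MorePowers.

(** * Integral inequalities *)

Section Integrals.
Context d (X : measurableType d) (R : realType).
Variable mu : {measure set X -> \bar R}.
Implicit Types (f g : X -> \bar R) (D : set X).

Import HBNNSimple.

(* The integral of a nonnegative function is the supremum over the simple functions
   below it, hence monotone on arbitrary functions. *)
Lemma le_integral_ge0 D f g : (forall x, D x -> 0 <= f x) ->
  (forall x, D x -> f x <= g x) ->
  \int[mu]_(x in D) f x <= \int[mu]_(x in D) g x.
Proof.
move=> f0 fg; have g0 x : D x -> 0 <= g x.
  by move=> Dx; exact: le_trans (f0 _ Dx) (fg _ Dx).
rewrite !ge0_integralE//; apply: le_ereal_sup => _ [h hf <-]; exists h => // x.
by apply: le_trans (hf x) _; exact: lee_restrict.
Qed.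

Lemma ge0_integralTD f g : measurable_fun setT f -> measurable_fun setT g ->
  (forall x, 0 <= f x) -> (forall x, 0 <= g x) ->
  \int[mu]_x (f x + g x) = \int[mu]_x f x + \int[mu]_x g x.
Proof. by move=> mf mg f0 g0; rewrite ge0_integralD. Qed.

Lemma ge0_integralTZl (k : \bar R) f : measurable_fun setT f -> 0 <= k ->
  (forall x, 0 <= f x) -> \int[mu]_x (k * f x) = k * \int[mu]_x f x.
Proof. by move=> mf k0 f0; rewrite ge0_integralZl. Qed.

Lemma measurable_poweRf D f (r : R) : measurable_fun D f ->
  measurable_fun D (fun x => f x `^ r).
Proof. by move=> mf; apply: (measurableT_comp (measurable_poweR r)). Qed.

(** After both integrals are normalised to 1 this is the pointwise Young inequality. Integrals equal
    to 0 or +oo are split off first: a vanishing integral makes the product vanish almost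
    everywhere, and otherwise an infinite one makes the right-hand side infinite. *)
Lemma holder_integral D f g (th : R) : measurable D -> (0 < th < 1)%R ->
  measurable_fun D f -> measurable_fun D g ->
  (forall x, D x -> 0 <= f x) -> (forall x, D x -> 0 <= g x) ->
  \int[mu]_(x in D) (f x `^ th * g x `^ (1 - th)) <=
    (\int[mu]_(x in D) f x) `^ th * (\int[mu]_(x in D) g x) `^ (1 - th).
Proof.
move=> mD /[dup] tht /andP[th0 th1] mf mg f0 g0.
have th1' : (0 < 1 - th)%R by rewrite subr_gt0.
have zero h k : measurable_fun D h -> (forall x, D x -> 0 <= h x) ->
   (forall x, D x -> h x = 0 -> k x = 0) -> measurable_fun D k ->
   (forall x, D x -> 0 <= k x) ->
   \int[mu]_(x in D) h x = 0 -> \int[mu]_(x in D) k x = 0.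
  move=> mh h0 hk mk k0 inth.
  have : \int[mu]_(x in D) `|h x| = 0.
    by rewrite -[RHS]inth; apply: eq_integral => x /set_mem Dx; rewrite gee0_abs ?h0.
  move=> /(ae_eq_integral_abs mu mD mh) hae.
  rewrite (ae_eq_integral (cst 0))// ?integral0//.
  by apply: filterS hae => x /= hx Dx; apply: hk => //; exact: hx.
have mfp : measurable_fun D (fun x => f x `^ th) by exact: measurable_poweRf.
have mgp : measurable_fun D (fun x => g x `^ (1 - th)) by exact: measurable_poweRf.
have mk : measurable_fun D (fun x => f x `^ th * g x `^ (1 - th)).
  exact: emeasurable_funM.
have k0 x : D x -> 0 <= f x `^ th * g x `^ (1 - th).
  by move=> _; rewrite mule_ge0 ?poweR_ge0.
have [F0|F0] := eqVneq (\int[mu]_(x in D) f x) 0.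
  rewrite (zero f) ?mule_ge0 ?poweR_ge0// => x Dx ->.
  by rewrite poweR0r ?gt_eqF// mul0e.
have [G0|G0] := eqVneq (\int[mu]_(x in D) g x) 0.
  rewrite (zero g) ?mule_ge0 ?poweR_ge0// => x Dx ->.
  by rewrite poweR0r ?gt_eqF// mule0.
have {}F0 : 0 < \int[mu]_(x in D) f x by rewrite lt0e F0 integral_ge0.
have {}G0 : 0 < \int[mu]_(x in D) g x by rewrite lt0e G0 integral_ge0.
have [Foo|Foo] := eqVneq (\int[mu]_(x in D) f x) +oo.
  by rewrite Foo poweRyr ?gt_eqF// gt0_mulye ?leey// poweR_gt0.
have [Goo|Goo] := eqVneq (\int[mu]_(x in D) g x) +oo.
  by rewrite Goo poweRyr ?gt_eqF// gt0_muley ?leey// poweR_gt0.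
have Ffin : \int[mu]_(x in D) f x \is a fin_num.
  by rewrite ge0_fin_numE ?ltey// ltW.
have Gfin : \int[mu]_(x in D) g x \is a fin_num.
  by rewrite ge0_fin_numE ?ltey// ltW.
move: F0 G0 Ffin Gfin; move EF : (\int[mu]_(x in D) f x) => F.
move EG : (\int[mu]_(x in D) g x) => G.
case: F EF Foo => [a| |]// EF _; case: G EG Goo => [b| |]// EG _.
rewrite !lte_fin => a0 b0 _ _.
have ai : (0 <= a^-1)%R by rewrite invr_ge0 ltW.
have bi : (0 <= b^-1)%R by rewrite invr_ge0 ltW.
have ab0 : (0 < a `^ th * b `^ (1 - th))%R by rewrite mulr_gt0// powR_gt0.
have abi : (0 <= (a `^ th * b `^ (1 - th))^-1)%R by rewrite invr_ge0 ltW.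
suff : ((a `^ th * b `^ (1 - th))^-1)%:E *
   \int[mu]_(x in D) (f x `^ th * g x `^ (1 - th)) <= 1.
  rewrite !poweR_EFin -EFinM.
  move=> /(@lee_wpmul2l _ ((a `^ th * b `^ (1 - th))%R)%:E).
  rewrite lee_fin (ltW ab0) => /(_ erefl).
  by rewrite muleA -EFinM divff ?gt_eqF// mul1e mule1.
rewrite -ge0_integralZl//.
have mfa : measurable_fun D (fun x => a^-1%:E * f x) by exact: measurable_funeM.
have mgb : measurable_fun D (fun x => b^-1%:E * g x) by exact: measurable_funeM.
apply: (@le_trans _ _ (\int[mu]_(x in D)
    (th%:E * (a^-1%:E * f x) + (1 - th)%:E * (b^-1%:E * g x)))).
  apply: le_integral_ge0 => x Dx; first by rewrite mule_ge0 ?lee_fin ?k0.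
  have -> : ((a `^ th * b `^ (1 - th))^-1)%:E * (f x `^ th * g x `^ (1 - th)) =
     (a^-1%:E * f x) `^ th * (b^-1%:E * g x) `^ (1 - th).
    rewrite !poweRM ?lee_fin ?f0 ?g0// muleACA; congr (_ * _).
    have inv z r : (0 <= z)%R -> (z^-1 `^ r = (z `^ r)^-1)%R.
      by move=> z0; rewrite -[in LHS]powR_inv1// powRAC powR_inv1 ?powR_ge0.
    by rewrite !poweR_EFin -EFinM !inv ?(ltW a0) ?(ltW b0)// invfM.
  by apply: lee_young; rewrite ?mule_ge0 ?lee_fin ?f0 ?g0.
rewrite ge0_integralD//; last 4 first.
- by move=> x Dx; rewrite !mule_ge0 ?lee_fin ?f0 ?(ltW th0).
- exact: measurable_funeM.
- by move=> x Dx; rewrite !mule_ge0 ?lee_fin ?g0 ?(ltW th1').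
- exact: measurable_funeM.
rewrite ge0_integralZl//; last 2 first.
- by move=> x Dx; rewrite !mule_ge0 ?lee_fin ?f0 ?(ltW th0).
- by rewrite lee_fin ltW.
rewrite ge0_integralZl//; last 2 first.
- by move=> x Dx; rewrite !mule_ge0 ?lee_fin ?g0 ?(ltW th1').
- by rewrite lee_fin ltW.
rewrite ge0_integralZl// ge0_integralZl// EF EG -!EFinM !mulVf ?gt_eqF//.
by rewrite !mulr1 -EFinD addrC subrK.
Qed.

Lemma jensen_integral D f (b : R) : measurable D -> (0 < b)%R ->
  measurable_fun D f -> (forall x, D x -> 0 <= f x) ->
  (\int[mu]_(x in D) f x) `^ (1 + b) <=
    mu D `^ b * \int[mu]_(x in D) (f x `^ (1 + b)).
Proof.
move=> mD b0 mf f0; have b1 : (0 < 1 + b)%R by rewrite addr_gt0.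
pose th := (1 + b)^-1%R.
have tht : (0 < th < 1)%R by rewrite /th invr_gt0 b1 invf_lt1// ltrDl.
have -> : \int[mu]_(x in D) f x =
    \int[mu]_(x in D) ((f x `^ (1 + b)) `^ th * cst 1 x `^ (1 - th)).
  apply: eq_integral => x /set_mem Dx.
  by rewrite poweR1r mule1 poweRVK ?f0.
have mfb : measurable_fun D (fun x => f x `^ (1 + b)) by exact: measurable_poweRf.
apply: (@le_trans _ _ (((\int[mu]_(x in D) (f x `^ (1 + b))) `^ th *
    (\int[mu]_(x in D) cst 1 x) `^ (1 - th)) `^ (1 + b))).
  apply: lee_poweR; first exact: ltW.
    by apply: integral_ge0 => x Dx; rewrite mule_ge0 ?poweR_ge0.
  by apply: holder_integral => // x Dx; exact: poweR_ge0.
have i0 : 0 <= \int[mu]_(x in D) (f x `^ (1 + b)).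
  by apply: integral_ge0 => x Dx; exact: poweR_ge0.
rewrite integral_cst// mul1e poweRM ?poweR_ge0// poweRK// -poweRrM muleC.
by rewrite mulrBl mul1r mulVf ?gt_eqF// addrAC subrr add0r.
Qed.

(** Fatou's lemma with [f] only below the liminf of the measurable functions [g n]; [f] itself may
    be non-measurable, which suits the continuous potentials. *)
Lemma integral_le_liminf f (g : nat -> X -> \bar R) (B : \bar R) :
  (forall n, measurable_fun setT (g n)) -> (forall n x, 0 <= g n x) ->
  (forall x, 0 <= f x) -> (forall n, \int[mu]_x g n x <= B) ->
  (forall x y, y < f x -> exists N, forall n, (N <= n)%N -> y <= g n x) ->
  \int[mu]_x f x <= B.
Proof.
move=> mg g0 f0 gB fg.
apply: (@le_trans _ _ (\int[mu]_x limn_einf (g ^~ x))).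
  apply: le_integral_ge0 => // x _.
  rewrite leNgt; apply/negP => /lte_dense[y zy yf].
  have [N Ng] := fg _ _ yf.
  move: zy; rewrite ltNge => /negP; apply.
  rewrite limn_einf_lim (cvg_lim _ (@cvg_einfs_sup _ _))//.
  apply: le_trans (ereal_sup_ubound _); last by exists N.
  by apply: le_ereal_inf_tmp => _ [n /= Nn <-]; exact: Ng.
apply: le_trans (fatou _ _ _ _) _ => //.
rewrite limn_einf_lim; apply: lime_le; first exact: is_cvg_einfs.
apply: nearW => n /=; apply: ge_ereal_inf; exists (\int[mu]_x g n x) => //.
by exists n => /=.
Qed.

Lemma integral_le_sup f (g : nat -> X -> \bar R) (B : \bar R) :
  (forall n, measurable_fun setT (g n)) -> (forall n x, 0 <= g n x) ->
  (forall x, 0 <= f x) -> (forall n, \int[mu]_x g n x <= B) ->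
  (forall x, nondecreasing_seq (g ^~ x)) ->
  (forall x, f x <= ereal_sup (range (g ^~ x))) ->
  \int[mu]_x f x <= B.
Proof.
move=> mg g0 f0 gB ndg fg; apply: (integral_le_liminf mg g0 f0 gB) => x y yf.
have /ereal_sup_gt[_ [N _ <-] yg] : y < ereal_sup (range (g ^~ x)).
  exact: lt_le_trans yf (fg x).
by exists N => n Nn; rewrite (le_trans (ltW yg))// ndg.
Qed.

End Integrals.

Ltac ege0 := repeat first
  [ done | assumption
  | match goal with
    | |- is_true (Order.le _ (EFin _)) =>
        rewrite lee_fin; first [assumption | by apply: ltW | by []]
    | |- is_true (Order.le _ (poweR _ _)) => apply: poweR_ge0
    | |- is_true (Order.le _ (mule _ _)) => apply: mule_ge0
    | |- is_true (Order.le _ (adde _ _)) => apply: adde_ge0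
    | |- is_true (Order.le _ (GRing.add _ _)) => apply: adde_ge0
    | |- is_true (Order.le _ (Algebra.add _ _)) => apply: adde_ge0
    | |- is_true (Order.le _ (integral _ _ _)) => apply: integral_ge0 => ? _
    | |- is_true (Order.le _ (bigop.body _ _ _)) => apply: sume_ge0 => ? _
    | |- forall _, _ => move=> ?
    end ].

Ltac emeas := repeat first
  [ done | assumption | apply: measurable_cst
  | match goal with
    | |- measurable_fun _ (fun x => poweR _ _) => apply: measurable_poweRf
    | |- measurable_fun _ (fun x => mule _ _) => apply: emeasurable_funM
    | |- measurable_fun _ (fun x => adde _ _) => apply: emeasurable_funD
    | |- measurable_fun _ (fun x => GRing.add _ _) => apply: emeasurable_funD
    | |- measurable_fun _ (fun x => Algebra.add _ _) => apply: emeasurable_funD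
    end ].

Ltac rpos := repeat first
  [ done | assumption
  | match goal with
    | |- is_true (Order.le _ _) => apply: ltW
    | |- is_true (Order.lt _ (GRing.mul _ _)) => apply: mulr_gt0
    | |- is_true (Order.lt _ (GRing.inv _)) => rewrite invr_gt0
    | |- is_true (Order.lt _ (_ + _)%R) => apply: addr_gt0
    | |- is_true (Order.lt _ (powR _ _)) => apply: powR_gt0
    end ].

(** * Nested partitions and the maximal function *)

(* [c i x] is the label of the cell of generation [i] containing [x]; larger [i]
   means finer cells. *)
Record filtration d (X : measurableType d) (c : nat -> X -> nat) := Filtration {
  measurable_label : forall i k, measurable [set x | c i x = k];
  label_nested : forall i x y, c i.+1 x = c i.+1 y -> c i x = c i y }.

Section Filtration.
Context d (X : measurableType d) (R : realType) (c : nat -> X -> nat).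
Hypothesis fc : filtration c.
Implicit Types (f g h : X -> \bar R) (i l : nat).
Implicit Types (mu sigma nu : {measure set X -> \bar R}).

Definition cell i x : set X := [set y | c i y = c i x].

Definition adapted i h := forall x y, c i x = c i y -> h x = h y.

Definition cint nu i f x := \int[nu]_(y in cell i x) f y.

Lemma measurable_cell i x : measurable (cell i x).
Proof. exact: (measurable_label fc). Qed.

Lemma label_le i l x y : (i <= l)%N -> c l x = c l y -> c i x = c i y.
Proof.
move=> /subnK <-; elim: (l - i)%N => [|n IH]//.
by rewrite addSn => /(label_nested fc); exact: IH.
Qed.

Lemma cell_eq i x y : c i x = c i y -> cell i x = cell i y.
Proof. by rewrite /cell => ->. Qed.

Lemma adapted_cint nu i f : adapted i (cint nu i f).
Proof. by move=> x y /cell_eq; rewrite /cint => ->. Qed.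

Lemma adapted_measure nu i : adapted i (fun x => nu (cell i x)).
Proof. by move=> x y /cell_eq ->. Qed.

Lemma adaptedM i f g : adapted i f -> adapted i g ->
  adapted i (fun x => f x * g x).
Proof. by move=> af ag x y xy; rewrite (af _ _ xy) (ag _ _ xy). Qed.

Lemma measurable_adapted i h : adapted i h -> measurable_fun setT h.
Proof.
move=> ah _ Y mY; rewrite setTI.
rewrite (_ : h @^-1` Y =
    \bigcup_(k in [set c i x | x in h @^-1` Y]) [set x | c i x = k]).
  by apply: bigcup_measurable => k _; exact: (measurable_label fc).
apply/seteqP; split => [x Yx|x [_ [y Yy <-] /= xy]].
  by exists (c i x) => //; exists x.
by rewrite /preimage/= (ah _ _ xy).
Qed.

Lemma integral_cells nu i f : measurable_fun setT f -> (forall x, 0 <= f x) ->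
  \int[nu]_x f x = \sum_(k <oo) \int[nu]_(x in [set x | c i x = k]) f x.
Proof.
move=> mf f0.
have e : [set: X] = \bigcup_k [set x | c i x = k].
  by apply/seteqP; split => // x _; exists (c i x).
rewrite [in LHS]e ge0_integral_bigcup//.
- by move=> k; exact: (measurable_label fc).
- by rewrite -e.
- by move=> k l _ _ [x [/= <- <-]].
Qed.

(* Both sides equal the sum over the cells [Q] of generation [i] of
   [h(Q) * int_Q f dsigma * int_Q g dmu]. *)
Lemma cint_swap mu sigma i f g h : measurable_fun setT f -> measurable_fun setT g ->
  (forall x, 0 <= f x) -> (forall x, 0 <= g x) -> (forall x, 0 <= h x) ->
  adapted i h ->
  \int[mu]_x (h x * cint sigma i f x * g x) =
  \int[sigma]_x (h x * cint mu i g x * f x).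
Proof.
move=> mf mg f0 g0 h0 ah.
have c0 nu u x : (forall x, 0 <= u x) -> 0 <= cint nu i u x.
  by move=> u0; exact: integral_ge0.
have mh := measurable_adapted ah.
have mci nu u := measurable_adapted (@adapted_cint nu i u).
rewrite (integral_cells _ i); last 2 first.
- by apply: emeasurable_funM => //; exact: emeasurable_funM.
- by move=> x; rewrite !mule_ge0 ?c0.
rewrite [RHS](integral_cells _ i); last 2 first.
- by apply: emeasurable_funM => //; exact: emeasurable_funM.
- by move=> x; rewrite !mule_ge0 ?c0.
apply: eq_eseriesr => k _.
have [->|/set0P[x0 /= kx0]] := eqVneq [set x | c i x = k] set0.
  by rewrite !integral_set0.
have <- : cell i x0 = [set x | c i x = k] by rewrite /cell kx0.
have mD := measurable_cell i x0.
have e nu u (K : \bar R) F : 0 <= K -> measurable_fun setT u ->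
    (forall x, 0 <= u x) -> (forall x, c i x = c i x0 -> F x = K * u x) ->
    \int[nu]_(x in cell i x0) F x = K * cint nu i u x0.
  move=> K0 mu' u0 Fu.
  rewrite (eq_integral (fun x => K * u x)); last by move=> x /set_mem/= /Fu.
  by rewrite ge0_integralZl//; exact: measurable_funTS.
rewrite (e _ g (h x0 * cint sigma i f x0)) ?mule_ge0 ?c0//; last first.
  by move=> x xx0; rewrite (ah _ _ xx0) (adapted_cint _ _ xx0).
rewrite (e _ f (h x0 * cint mu i g x0)) ?mule_ge0 ?c0//; last first.
  by move=> x xx0; rewrite (ah _ _ xx0) (adapted_cint _ _ xx0).
by rewrite muleAC.
Qed.

Section Average.
Variable sigma : {measure set X -> \bar R}.
Hypothesis s0 : forall i x, 0 < sigma (cell i x).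
Hypothesis soo : forall i x, sigma (cell i x) < +oo.

Definition avg i f x := (sigma (cell i x))^-1 * cint sigma i f x.

Lemma cint_ge0 nu i f x : (forall x, 0 <= f x) -> 0 <= cint nu i f x.
Proof. by move=> f0; exact: integral_ge0. Qed.

Lemma mesVK i x : (sigma (cell i x))^-1 * sigma (cell i x) = 1.
Proof.
have := s0 i x; have := soo i x; case: (sigma _) => [r| |]// _.
rewrite lte_fin => r0; rewrite /inve ?(gt_eqF r0).
by rewrite -EFinM mulVf ?gt_eqF.
Qed.

Lemma mesV_ge0 i x : 0 <= (sigma (cell i x))^-1.
Proof. by rewrite inve_ge0 ltW. Qed.

Lemma avg_ge0 i f x : (forall x, 0 <= f x) -> 0 <= avg i f x.
Proof. by move=> f0; rewrite mule_ge0 ?mesV_ge0 ?cint_ge0. Qed.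

Lemma adapted_avg i f : adapted i (avg i f).
Proof.
apply: adaptedM; last exact: adapted_cint.
by move=> x y /cell_eq ->.
Qed.

Lemma measurable_avg i f : measurable_fun setT (avg i f).
Proof. by apply: (measurable_adapted (i := i)); exact: adapted_avg. Qed.

Lemma le_avg i f g x : (forall x, 0 <= f x) -> (forall x, f x <= g x) ->
  avg i f x <= avg i g x.
Proof.
move=> f0 fg; rewrite lee_wpmul2l ?mesV_ge0//.
by apply: le_integral_ge0.
Qed.

Lemma cint_cst nu i x : cint nu i (cst 1) x = nu (cell i x).
Proof. by rewrite /cint integral_cst ?mul1e//; exact: measurable_cell. Qed.

(** The defining property of a conditional expectation; it is [cint_swap] with both measures equal
    to [sigma] and the second function equal to 1. *)
Lemma integral_avg i f h : measurable_fun setT f ->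
  (forall x, 0 <= f x) -> (forall x, 0 <= h x) -> adapted i h ->
  \int[sigma]_x (h x * avg i f x) = \int[sigma]_x (h x * f x).
Proof.
move=> mf f0 h0 ah.
have := @cint_swap sigma sigma i f (cst 1) (fun x => h x * (sigma (cell i x))^-1)
  mf (measurable_cst _) f0.
move=> /(_ (fun=> lee01)) H.
transitivity (\int[sigma]_x (h x * (sigma (cell i x))^-1 * cint sigma i f x * cst 1 x)).
  by apply: eq_integral => x _; rewrite /= mule1 -muleA.
rewrite {}H; first last.
- by apply: adaptedM => // x y /cell_eq ->.
- by move=> x; rewrite mule_ge0 ?mesV_ge0.
by apply: eq_integral => x _; rewrite cint_cst -[h x * _ * _]muleA mesVK mule1.
Qed.

Lemma jensen_avg i f (b : R) x : (0 < b)%R -> measurable_fun setT f ->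
  (forall x, 0 <= f x) ->
  avg i f x `^ (1 + b) <= avg i (fun x => f x `^ (1 + b)) x.
Proof.
move=> b0 mf f0; rewrite /avg poweRM ?mesV_ge0 ?cint_ge0//.
have e : (sigma (cell i x))^-1 `^ (1 + b) * sigma (cell i x) `^ b =
    (sigma (cell i x))^-1.
  rewrite poweRDge0 ?(ltW b0)// poweRe1 ?mesV_ge0// -muleA -poweRM ?mesV_ge0//.
  by rewrite mesVK poweR1r mule1.
rewrite -[X in _ <= X * _]e -muleA lee_wpmul2l ?poweR_ge0//.
apply: jensen_integral => //; first exact: measurable_cell.
exact: measurable_funTS.
Qed.

Lemma holder_avg i f g (th : R) x : (0 < th < 1)%R ->
  measurable_fun setT f -> measurable_fun setT g ->
  (forall x, 0 <= f x) -> (forall x, 0 <= g x) ->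
  avg i (fun x => f x `^ th * g x `^ (1 - th)) x <=
    avg i f x `^ th * avg i g x `^ (1 - th).
Proof.
move=> tht mf mg f0 g0; have /andP[th0 th1] := tht.
rewrite /avg !poweRM ?mesV_ge0 ?cint_ge0// muleACA.
have e : (sigma (cell i x))^-1 `^ th * (sigma (cell i x))^-1 `^ (1 - th) =
    (sigma (cell i x))^-1.
  rewrite -poweRDge0 ?subr_ge0 ?(ltW th0) ?(ltW th1)//.
  by rewrite addrC subrK poweRe1 ?mesV_ge0.
rewrite e lee_wpmul2l ?mesV_ge0//.
apply: holder_integral => //; [exact: measurable_cell| |]; exact: measurable_funTS.
Qed.

Fixpoint maxavg L f x := if L is L'.+1 then maxe (maxavg L' f x) (avg L' f x) else 0.

Lemma maxavg_ge0 L f x : (forall x, 0 <= f x) -> 0 <= maxavg L f x.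
Proof. by move=> f0; elim: L => //= L IH; rewrite le_max IH. Qed.

Lemma adapted_maxavg L f : adapted L (maxavg L f).
Proof.
elim: L => [//|L IH] x y xy /=.
by rewrite (IH x y) ?(adapted_avg f (x := x) (y := y))//; exact: (label_nested fc).
Qed.

Lemma measurable_maxavg L f : measurable_fun setT (maxavg L f).
Proof. by apply: (measurable_adapted (i := L)); exact: adapted_maxavg. Qed.

Lemma avg_le_maxavg i L f x : (i < L)%N -> avg i f x <= maxavg L f x.
Proof.
elim: L => //= L IH; rewrite ltnS leq_eqVlt => /predU1P[->|/IH h].
  by rewrite le_max lexx orbT.
by rewrite le_max h.
Qed.

Lemma integral_avg_poweR i f (b : R) : (0 < b)%R -> measurable_fun setT f ->
  (forall x, 0 <= f x) ->
  \int[sigma]_x (avg i f x `^ (1 + b)) <= \int[sigma]_x (f x `^ (1 + b)).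
Proof.
move=> b0 mf f0.
have fb0 x : 0 <= f x `^ (1 + b) by exact: poweR_ge0.
apply: (@le_trans _ _ (\int[sigma]_x (1 * avg i (fun x => f x `^ (1 + b)) x))).
  by apply: le_integral_ge0 => x _; rewrite ?poweR_ge0// mul1e jensen_avg.
rewrite (@integral_avg i (fun x => f x `^ (1 + b)) (cst 1))//; last first.
  exact: measurable_poweRf.
by under eq_integral do rewrite /= mul1e.
Qed.

Lemma integral_poweR_max f g (b : R) : (0 <= b)%R ->
  measurable_fun setT f -> measurable_fun setT g ->
  (forall x, 0 <= f x) -> (forall x, 0 <= g x) ->
  \int[sigma]_x (maxe (f x) (g x) `^ b) <=
  \int[sigma]_x (f x `^ b) + \int[sigma]_x (g x `^ b).
Proof.
move=> b0 mf mg f0 g0; rewrite -ge0_integralD//; last 4 first.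
- by move=> x _; exact: poweR_ge0.
- exact: measurable_poweRf.
- by move=> x _; exact: poweR_ge0.
- exact: measurable_poweRf.
apply: le_integral_ge0 => x _; first exact: poweR_ge0.
by case: (ltP (f x) (g x)) => _; rewrite ?leeDl ?leeDr ?poweR_ge0.
Qed.

Section Doob.
Variables (b : R) (b0 : (0 < b)%R).

Let b1 : (0 < 1 + b)%R. Proof. by rewrite addr_gt0. Qed.

Lemma integral_maxavg_lty L f : measurable_fun setT f -> (forall x, 0 <= f x) ->
  \int[sigma]_x (f x `^ (1 + b)) < +oo ->
  \int[sigma]_x (maxavg L f x `^ (1 + b)) < +oo.
Proof.
move=> mf f0 foo; elim: L => [|L IH] /=.
  rewrite (eq_integral (cst 0)) ?integral0 ?ltry// => x _.
  by rewrite /= powR0 ?gt_eqF.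
apply: le_lt_trans (integral_poweR_max _ _ _ _ _) _ => //.
- exact: ltW.
- exact: measurable_maxavg.
- exact: measurable_avg.
- by move=> x; exact: maxavg_ge0.
- by move=> x; exact: avg_ge0.
rewrite lte_add_pinfty// (le_lt_trans _ foo)//; exact: integral_avg_poweR.
Qed.

Lemma integral_mul_poweR_lty f g : measurable_fun setT f -> measurable_fun setT g ->
  (forall x, 0 <= f x) -> (forall x, 0 <= g x) ->
  \int[sigma]_x (f x `^ (1 + b)) < +oo -> \int[sigma]_x (g x `^ (1 + b)) < +oo ->
  \int[sigma]_x (f x * g x `^ b) < +oo.
Proof.
move=> mf mg f0 g0 foo goo.
apply: (@le_lt_trans _ _ (\int[sigma]_x (f x `^ (1 + b) + g x `^ (1 + b)))).
  apply: le_integral_ge0 => x _; first by rewrite mule_ge0 ?poweR_ge0.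
  by apply: mule_poweR_le => //; exact: ltW.
rewrite ge0_integralTD; [exact: lte_add_pinfty|emeas|emeas|ege0|ege0].
Qed.

(** [doob_step] is integrated generation by generation. The old and the new maximum are both
    constant on cells of generation [L], so there [avg L f] may be replaced by [f]; the terms then
    telescope, the common one being cancelled because it is finite. *)
Lemma doob_maxavg L f : measurable_fun setT f -> (forall x, 0 <= f x) ->
  \int[sigma]_x (f x `^ (1 + b)) < +oo ->
  b%:E * \int[sigma]_x (maxavg L f x `^ (1 + b)) <=
  (1 + b)%:E * \int[sigma]_x (f x * maxavg L f x `^ b).
Proof.
move=> mf f0 foo; have b00 := ltW b0; have b10 := ltW b1.
have m0 L' x : 0 <= maxavg L' f x by exact: maxavg_ge0.
have mm L' := @measurable_maxavg L' f.
have mp L' r : measurable_fun setT (fun x => maxavg L' f x `^ r).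
  exact: measurable_poweRf.
elim: L => [|L IH].
  rewrite (eq_integral (cst 0)) ?integral0 ?mule0; last first.
    by move=> x _; rewrite /= powR0 ?gt_eqF.
  by ege0.
set Z := (1 + b)%:E * \int[sigma]_x (f x * maxavg L f x `^ b) in IH.
have Zfin : Z \is a fin_num.
  rewrite /Z ge0_fin_numE; last by ege0.
  apply: lte_mul_pinfty; rewrite ?lee_fin//.
  by apply: integral_mul_poweR_lty => //; exact: integral_maxavg_lty.
have av0 x : 0 <= avg L f x by exact: avg_ge0.
have mav := @measurable_avg L f.
set M := maxavg L f; pose M' := maxavg L.+1 f.
have M0 x : 0 <= M x by exact: m0.
have M0' x : 0 <= M' x by exact: (m0 L.+1).
have mM : measurable_fun setT M by exact: mm.
have mM' : measurable_fun setT M' by exact: (mm L.+1).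
have step x : b%:E * M' x `^ (1 + b) + (1 + b)%:E * (avg L f x * M x `^ b) <=
    b%:E * M x `^ (1 + b) + (1 + b)%:E * (avg L f x * M' x `^ b).
  exact: doob_step.
have : \int[sigma]_x (b%:E * M' x `^ (1 + b) + (1 + b)%:E * (avg L f x * M x `^ b))
    <= \int[sigma]_x (b%:E * M x `^ (1 + b) + (1 + b)%:E * (avg L f x * M' x `^ b)).
  by apply: le_integral_ge0 => x _; [ege0|exact: step].
rewrite !ge0_integralTD; [|emeas..|ege0|ege0|emeas|emeas|ege0|ege0].
rewrite !ge0_integralTZl; [|emeas|ege0|ege0|emeas|ege0|ege0|emeas|ege0|ege0|emeas|ege0|ege0].
have sw h : adapted L h -> (forall x, 0 <= h x) ->
    \int[sigma]_x (avg L f x * h x `^ b) = \int[sigma]_x (f x * h x `^ b).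
  move=> ah h0; under eq_integral do rewrite muleC.
  rewrite integral_avg//; first by under eq_integral do rewrite muleC.
  - by ege0.
  - by move=> x y xy; rewrite (ah _ _ xy).
have aM : adapted L M by exact: adapted_maxavg.
have aM' : adapted L M'.
  by move=> x y xy; rewrite /M'/= -/M (aM _ _ xy) (adapted_avg f xy).
rewrite (sw M)// (sw M')// -/Z => H.
by rewrite -(@leeD2lE _ Z)// addeC; apply: (le_trans H); rewrite leeD2r.
Qed.

End Doob.

End Average.

End Filtration.

Lemma doob (R : realType) (b : R) : (0 < b)%R -> exists2 C : R, (0 < C)%R &
  forall d (X : measurableType d) (c : nat -> X -> nat),
  filtration c -> forall sigma : {measure set X -> \bar R},
  (forall i x, 0 < sigma (cell c i x)) -> (forall i x, sigma (cell c i x) < +oo) ->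
  forall L (f : X -> \bar R), measurable_fun setT f -> (forall x, 0 <= f x) ->
  \int[sigma]_x (maxavg c sigma L f x `^ (1 + b)) <=
    C%:E * \int[sigma]_x (f x `^ (1 + b)).
Proof.
move=> b0; have b1 : (0 < 1 + b)%R by rewrite addr_gt0.
have b10 := ltW b1.
pose th := (1 + b)^-1%R.
have tht : (0 < th < 1)%R by rewrite /th invr_gt0 b1 invf_lt1// ltrDl.
(* With this parameter in Young's inequality the maximal term returns with factor (1+b)/b times eta,
   that is 1/2, and can be absorbed. *)
have eta0 : (0 < b / (1 + b) / 2)%R by rewrite !divr_gt0.
have [C C0 HC] := lee_young_eta tht eta0.
have C1 : (0 < 2 * ((1 + b) / b * C))%R by rpos.
exists (2 * ((1 + b) / b * C))%R => //.
move=> d X c fc sigma s0 soo L f mf f0.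
have [foo|foo] := eqVneq (\int[sigma]_x (f x `^ (1 + b))) +oo.
  by rewrite foo gt0_muley ?leey.
have {}foo : \int[sigma]_x (f x `^ (1 + b)) < +oo by rewrite ltey.
set M := maxavg c sigma L f.
have mM : measurable_fun setT M by exact: measurable_maxavg.
have M0 x : 0 <= M x by exact: maxavg_ge0.
have Moo : \int[sigma]_x (M x `^ (1 + b)) < +oo by exact: integral_maxavg_lty.
rewrite EFinM -muleA; apply: absorb_half => //.
have := doob_maxavg fc s0 soo b0 L mf f0 foo; rewrite -/M.
have h : \int[sigma]_x (f x * M x `^ b) <= C%:E * \int[sigma]_x (f x `^ (1 + b))
    + (b / (1 + b) / 2)%:E * \int[sigma]_x (M x `^ (1 + b)).
  rewrite -!ge0_integralTZl; [|emeas|ege0|ege0|emeas|ege0|ege0].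
  rewrite -ge0_integralTD; [|emeas|emeas|ege0|ege0].
  apply: le_integral_ge0 => x _; first by ege0.
  have -> : f x * M x `^ b = (f x `^ (1 + b)) `^ th * (M x `^ (1 + b)) `^ (1 - th).
    rewrite poweRVK// -poweRrM; congr (_ * _ `^ _).
    by rewrite mulrBr mulr1 divff ?gt_eqF// addrAC subrr add0r.
  by apply: HC; ege0.
move=> /le_trans /(_ (lee_wpmul2l _ h)).
rewrite lee_fin => /(_ b10).
rewrite -(@lee_pmul2l _ (b^-1)%:E)// ?lte_fin ?invr_gt0//.
rewrite muleA -EFinM mulVf ?gt_eqF// mul1e => /le_trans; apply.
have bi : (0 <= b^-1)%R by rewrite invr_ge0 ltW.
rewrite ge0_muleDr; [|ege0|ege0].
rewrite ge0_muleDr; [|by ege0|by ege0].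
rewrite !muleA -!EFinM.
have -> : (b^-1 * (1 + b) * C = (1 + b) / b * C)%R by rewrite [(b^-1 * _)%R]mulrC.
have -> // : (b^-1 * (1 + b) * (b / (1 + b) / 2) = 2^-1)%R.
by field; rewrite !gt_eqF.
Qed.

(** * Energy of a sum of functions constant on cells *)

Section WolffEnergy.
Context {R : realType} (b : R) (b0 : (0 < b)%R).

Let b1 : (0 < 1 + b)%R. Proof. by rewrite addr_gt0. Qed.

(** Every averaged tail is at most the maximal function M of the full sum A, so the energy is at
    most int A M^b, and the maximal theorem bounds this. *)
Lemma wolff_energy_le : exists2 C : R, (0 < C)%R &
  forall d (X : measurableType d) (c : nat -> X -> nat),
  filtration c -> forall sigma : {measure set X -> \bar R},
  (forall i x, 0 < sigma (cell c i x)) -> (forall i x, sigma (cell c i x) < +oo) ->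
  forall L (a : nat -> X -> \bar R),
  (forall i, adapted c i (a i)) -> (forall i x, 0 <= a i x) ->
  \sum_(i < L) \int[sigma]_x
     (a i x * avg c sigma i (fun y => \sum_(i <= l < L) a l y) x `^ b) <=
    C%:E * \int[sigma]_x ((\sum_(i < L) a i x) `^ (1 + b)).
Proof.
have b10 := ltW b1; have b00 := ltW b0.
have [C C0 HC] := doob b0.
exists (1 + C)%R; first by rpos.
move=> d X c fc sigma s0 soo L a aa a0.
have ma i : measurable_fun setT (a i) := measurable_adapted fc (aa i).
pose A x := \sum_(i < L) a i x.
have A0 x : 0 <= A x by rewrite /A; ege0.
have mA : measurable_fun setT A by exact: emeasurable_sum.
pose S i x := \sum_(i <= l < L) a l x.
have S0 i x : 0 <= S i x by rewrite /S; ege0.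
have SA i x : S i x <= A x.
  rewrite /S /A -(big_mkord xpredT (fun l => a l x)).
  have [iL|Li] := leqP i L; last first.
    by rewrite [leLHS]big_geq ?(ltnW Li)//; exact: sume_ge0.
  by rewrite [leRHS](big_cat_nat (n := i))//= leeDr//; exact: sume_ge0.
set M := maxavg c sigma L A.
have mM : measurable_fun setT M by exact: measurable_maxavg.
have M0 x : 0 <= M x by exact: maxavg_ge0.
have mav i : measurable_fun setT (avg c sigma i (S i)) by exact: measurable_avg.
have av0 i x : 0 <= avg c sigma i (S i) x by exact: avg_ge0.
rewrite -ge0_integral_sum//; [|by move=> i; emeas|by move=> i x _; ege0].
apply: (@le_trans _ _ (\int[sigma]_x (A x `^ (1 + b) + M x `^ (1 + b)))).
  apply: le_integral_ge0 => x _; first by ege0.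
  apply: (@le_trans _ _ (A x * M x `^ b)); last exact: mule_poweR_le.
  rewrite /A ge0_sume_distrl//; apply: lee_sum => i _.
  rewrite lee_wpmul2l// lee_poweR//.
  apply: (@le_trans _ _ (avg c sigma i A x)); last exact: avg_le_maxavg.
  apply: le_avg => // y; [exact: S0|exact: SA].
rewrite ge0_integralTD; [|emeas|emeas|ege0|ege0].
rewrite EFinD ge0_muleDl ?lee_fin ?(ltW C0)// mul1e leeD2l//.
exact: HC.
Qed.

(* Let [S_i] be the tail of the sum [A = S_0] and [m_i] its average.  For [b <= 1]
   Jensen's inequality bounds the average of [S_i^b] by [m_i^b].  In general only a
   small power [S_i^e] is averaged; the rest of the exponent is put on a maximal
   function of [A^r], [r < 1 + b], and absorbed. *)
Lemma wolff_energy_ge : exists2 C : R, (0 < C)%R &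
  forall d (X : measurableType d) (c : nat -> X -> nat),
  filtration c -> forall sigma : {measure set X -> \bar R},
  (forall i x, 0 < sigma (cell c i x)) -> (forall i x, sigma (cell c i x) < +oo) ->
  forall L (a : nat -> X -> \bar R),
  (forall i, adapted c i (a i)) -> (forall i x, 0 <= a i x) ->
  \int[sigma]_x ((\sum_(i < L) a i x) `^ (1 + b)) < +oo ->
  \int[sigma]_x ((\sum_(i < L) a i x) `^ (1 + b)) <= C%:E *
  \sum_(i < L) \int[sigma]_x
     (a i x * avg c sigma i (fun y => \sum_(i <= l < L) a l y) x `^ b).
Proof.
have b10 := ltW b1; have b00 := ltW b0.
have bi0 : (0 < b^-1)%R by rewrite invr_gt0.
(* This choice gives e < 1, e < b and e b < 1 at once. *)
pose e := (Num.min b b^-1 / 2)%R.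
have me : (Num.min b b^-1 <= 1)%R.
  rewrite ge_min; have [//|/ltW b1'] := leP b 1%R.
  by rewrite orFb invf_le1.
have e0 : (0 < e)%R by rewrite /e divr_gt0// lt_min b0.
have e1 : (e < 1)%R by rewrite /e ltr_pdivrMr// mul1r (le_lt_trans me)// ltr1n.
have e1' : (0 < 1 - e)%R by rewrite subr_gt0.
have eb : (e < b)%R.
  by rewrite /e ltr_pdivrMr// gt_min (ltr_pMr 2 b0) ltr1n.
have eb' : (0 < b - e)%R by rewrite subr_gt0.
have ebi : (e * b < 1)%R.
  rewrite -ltr_pdivlMr// mul1r /e ltr_pdivrMr// gt_min (ltr_pMr 2 bi0) ltr1n//.
  by rewrite orbT.
(* The exponent r splits A^(1+b) into A^(1+e) (A^r)^(1-e). The condition e b < 1 says r < 1 + b, so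
   A^r is in L^((1+b)/r) with an exponent above 1, and Doob's inequality there returns int
   A^(1+b). *)
pose r := ((b - e) / (1 - e))%R.
have r0 : (0 < r)%R by rewrite /r divr_gt0.
have rt : (r < 1 + b)%R.
  by rewrite /r ltr_pdivrMr//; move: ebi; rewrite mulrBr mulr1 mulrDl mul1r; lra.
pose b' := ((1 + b) / r - 1)%R.
have b'0 : (0 < b')%R by rewrite /b' subr_gt0 ltr_pdivlMr// mul1r.
have b'1 : (1 + b' = (1 + b) / r)%R by rewrite /b' addrC subrK.
pose th := (e / b)%R.
have th0 : (0 < th)%R by rewrite /th divr_gt0.
have th1 : (th < 1)%R by rewrite /th ltr_pdivrMr// mul1r.
have tht : (0 < th < 1)%R by rewrite th0 th1.
have tht' : (0 < e < 1)%R by rewrite e0 e1.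
have [Cd Cd0 HCd] := doob b'0.
have Cd1 : (0 < 1 + Cd)%R by rpos.
have e11 : (0 < 1 + e)%R by rpos.
(* The integral of A^(1+b) returns with coefficient (1 + e) eta (1 + Cd), which this value makes
   1/2. *)
pose eta := (((1 + e) * (1 + Cd))^-1 / 2)%R.
have eta0 : (0 < eta)%R by rewrite /eta; rpos.
have [C C0 HC] := lee_young_eta tht eta0.
exists (2 * ((1 + e) * C))%R; first by rpos.
move=> d X c fc sigma s0 soo L a aa a0.
have ma i : measurable_fun setT (a i) := measurable_adapted fc (aa i).
pose A x := \sum_(i < L) a i x.
have A0 x : 0 <= A x by rewrite /A; ege0.
have mA : measurable_fun setT A by exact: emeasurable_sum.
pose S i x := \sum_(i <= l < L) a l x.
have S0 i x : 0 <= S i x by rewrite /S; ege0.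
have mS i : measurable_fun setT (S i) by exact: emeasurable_sum.
pose Ar x := A x `^ r.
have mAr : measurable_fun setT Ar by rewrite /Ar; emeas.
have Ar0 x : 0 <= Ar x by exact: poweR_ge0.
pose N := maxavg c sigma L Ar.
have mN : measurable_fun setT N by exact: measurable_maxavg.
have N0 x : 0 <= N x by exact: maxavg_ge0.
pose m i := avg c sigma i (S i).
have mm i : measurable_fun setT (m i) by exact: measurable_avg.
have m0 i x : 0 <= m i x by exact: avg_ge0.
rewrite -/(A _) => Aoo.
have HN : \int[sigma]_x (N x `^ ((1 + b) / r)) <= Cd%:E * \int[sigma]_x (A x `^ (1 + b)).
  have := HCd _ _ _ fc _ s0 soo L Ar mAr Ar0; rewrite -/N b'1.
  under [in X in _ <= X -> _]eq_integral do
    rewrite /Ar -poweRrM mulrC divfK ?gt_eqF//.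
  exact.
rewrite EFinM -muleA; apply: absorb_half => //.
have step1 : \int[sigma]_x (A x `^ (1 + b)) <=
    (1 + e)%:E * \sum_(i < L) \int[sigma]_x (a i x * (S i x `^ e * Ar x `^ (1 - e))).
  rewrite -ge0_integral_sum//; [|by move=> i; emeas|by move=> i x _; ege0].
  rewrite -ge0_integralTZl; [|by apply: emeasurable_sum => i; emeas|by ege0|by ege0].
  apply: le_integral_ge0 => x _; first by ege0.
  have -> : A x `^ (1 + b) = A x `^ (1 + e) * Ar x `^ (1 - e).
    rewrite /Ar -poweRrM /r divfK ?gt_eqF// -poweRDge0 ?(ltW e11) ?(ltW eb')//.
    by congr (_ `^ _); lra.
  have h := le_sum_tail_poweR L (ltW e0) (fun i => a0 i x).
  apply: le_trans (lee_wpmul2r (poweR_ge0 _ _) h) _.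
  rewrite -muleA lee_wpmul2l ?lee_fin ?(ltW e11)//.
  rewrite ge0_sume_distrl; last by move=> i _; ege0.
  by apply: lee_sum => i _; rewrite muleA.
have step2 (i : 'I_L) : \int[sigma]_x (a i x * (S i x `^ e * Ar x `^ (1 - e))) <=
    \int[sigma]_x (C%:E * (a i x * m i x `^ b) + eta%:E * (a i x * N x `^ (b / r))).
  rewrite -(@integral_avg _ X R c fc sigma s0 soo i); [|by emeas|by ege0|by ege0|exact: aa].
  apply: le_integral_ge0 => x _.
    by rewrite mule_ge0//; apply: avg_ge0 => // y; ege0.
  have -> : C%:E * (a i x * m i x `^ b) + eta%:E * (a i x * N x `^ (b / r)) =
     a i x * (C%:E * m i x `^ b + eta%:E * N x `^ (b / r)).
    by rewrite ge0_muleDr; [rewrite !muleA ![a i x * _]muleC|ege0|ege0].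
  rewrite lee_wpmul2l//.
  apply: le_trans (holder_avg fc s0 i x tht' _ _ _ _) _ => //.
  apply: (@le_trans _ _ (m i x `^ e * N x `^ (1 - e))).
    rewrite lee_wpmul2l ?poweR_ge0// lee_poweR ?(ltW e1')//; first exact: avg_ge0.
    exact: avg_le_maxavg.
  have -> : m i x `^ e * N x `^ (1 - e) =
      (m i x `^ b) `^ th * (N x `^ (b / r)) `^ (1 - th).
    rewrite -!poweRrM; congr (_ `^ _ * _ `^ _).
      by rewrite /th mulrC divfK ?gt_eqF.
    by rewrite /th /r; field; rewrite ?gt_eqF ?e1'.
  by apply: HC; ege0.
apply: (le_trans step1).
have step3 : \sum_(i < L) \int[sigma]_x (a i x * (S i x `^ e * Ar x `^ (1 - e))) <=
    C%:E * (\sum_(i < L) \int[sigma]_x (a i x * m i x `^ b)) +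
    eta%:E * ((1 + Cd)%:E * \int[sigma]_x (A x `^ (1 + b))).
  apply: (@le_trans _ _ (\sum_(i < L) (C%:E * \int[sigma]_x (a i x * m i x `^ b) +
      eta%:E * \int[sigma]_x (a i x * N x `^ (b / r))))).
    apply: lee_sum => i _; apply: (le_trans (step2 i)).
    rewrite ge0_integralTD; [|emeas|emeas|ege0|ege0].
    by rewrite !ge0_integralTZl; [|emeas|ege0|ege0|emeas|ege0|ege0].
  rewrite big_split/= -!ge0_sume_distrr; [|by ege0|by ege0].
  rewrite leeD2l// lee_wpmul2l ?lee_fin ?(ltW eta0)//.
  rewrite -ge0_integral_sum//; [|by move=> i; emeas|by move=> i x _; ege0].
  apply: (@le_trans _ _ (\int[sigma]_x (A x `^ (1 + b) + N x `^ ((1 + b) / r)))).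
    apply: le_integral_ge0 => x _; first by ege0.
    rewrite -ge0_sume_distrl; last by ege0.
    have := mule_poweR_le b00 (A0 x) (poweR_ge0 (N x) r^-1).
    by rewrite -!poweRrM ![(r^-1 * _)%R]mulrC.
  rewrite ge0_integralTD; [|emeas|emeas|ege0|ege0].
  by rewrite EFinD ge0_muleDl ?lee_fin ?(ltW Cd0)// mul1e leeD2l.
apply: (le_trans (lee_wpmul2l _ step3)); first by rewrite lee_fin ltW.
rewrite ge0_muleDr; [|by ege0|by ege0].
rewrite !muleA -!EFinM /eta.
have -> // : ((1 + e) * (((1 + e) * (1 + Cd))^-1 / 2) * (1 + Cd) = 2^-1)%R.
by field; rewrite !gt_eqF.
Qed.

End WolffEnergy.

(** * The dyadic trace inequality *)

Section Suplim.
Context {R : realType}.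
Implicit Types (u v : nat -> \bar R) (x y : \bar R).

(* Only upper bounds of truncated quantities have to survive the limit, so [x] is
   allowed to be smaller than the supremum. *)
Record suplim u x := Suplim {
  suplim_nd : nondecreasing_seq u;
  suplim_ge0 : forall n, 0 <= u n;
  suplim_le : x <= ereal_sup (range u) }.

Lemma suplim_lim u : nondecreasing_seq u -> (forall n, 0 <= u n) ->
  suplim u (limn u).
Proof.
move=> ndu u0; split => //.
by rewrite (cvg_lim _ (ereal_nondecreasing_cvgn ndu)).
Qed.

Lemma le_suplim u x y : suplim u x -> y <= x -> suplim u y.
Proof. by move=> [nd u0 h] yx; split => //; exact: le_trans h. Qed.

Lemma suplim_poweR u x (r : R) : (0 < r)%R -> 0 <= x -> suplim u x ->
  suplim (fun n => u n `^ r) (x `^ r).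
Proof.
move=> r0 x0 [nd u0 h]; split.
- by move=> m n mn; apply: lee_poweR => //; [exact: ltW|exact: nd].
- by move=> n; exact: poweR_ge0.
- exact: lee_sup_poweR.
Qed.

Lemma suplimD u v x y : suplim u x -> suplim v y ->
  suplim (fun n => u n + v n) (x + y).
Proof.
move=> [ndu u0 hu] [ndv v0 hv].
have ndD : nondecreasing_seq (fun n => u n + v n).
  by move=> m n mn; apply: leeD; [exact: ndu|exact: ndv].
split => //; first by move=> n; exact: adde_ge0.
apply: le_trans (leeD hu hv) _.
have su0 : 0 <= ereal_sup (range u) by apply: le_trans (u0 0%N) (ereal_sup_ubound _); exists 0%N.
have sv0 : 0 <= ereal_sup (range v) by apply: le_trans (v0 0%N) (ereal_sup_ubound _); exists 0%N.
have cu := ereal_nondecreasing_cvgn ndu.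
have cv := ereal_nondecreasing_cvgn ndv.
have : (fun n => u n + v n) @ \oo --> ereal_sup (range u) + ereal_sup (range v).
  by apply: cvgeD => //; exact: ge0_adde_def.
by move=> /cvg_lim <-//; rewrite (cvg_lim _ (ereal_nondecreasing_cvgn ndD)).
Qed.

Lemma suplim_cst x : 0 <= x -> suplim (fun=> x) x.
Proof.
by move=> x0; split => //; apply: ereal_sup_ubound; exists 0%N.
Qed.

Lemma suplimZ u x (r : R) : (0 <= r)%R -> suplim u x ->
  suplim (fun n => r%:E * u n) (r%:E * x).
Proof.
move=> r0 [nd u0 h]; have ndr : nondecreasing_seq (fun n => r%:E * u n).
  by move=> m n mn; rewrite lee_wpmul2l ?lee_fin//; exact: nd.
split => //; first by move=> n; rewrite mule_ge0.
apply: le_trans (lee_wpmul2l _ h) _; first by rewrite lee_fin.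
have := cvgeZl _ (ereal_nondecreasing_cvgn nd) => /(_ r%:E erefl).
by move=> /cvg_lim <-//; rewrite (cvg_lim _ (ereal_nondecreasing_cvgn ndr)).
Qed.

Lemma suplim_sum (I : Type) (s : seq I) (u : I -> nat -> \bar R) (x : I -> \bar R) :
  (forall i, suplim (u i) (x i)) ->
  suplim (fun n => \sum_(i <- s) u i n) (\sum_(i <- s) x i).
Proof.
move=> h; elim: s => [|i s IH].
  rewrite big_nil (_ : (fun=> _) = fun=> 0); first exact: suplim_cst.
  by apply/funext => n; rewrite big_nil.
rewrite big_cons (_ : (fun=> _) = fun n => u i n + \sum_(i <- s) u i n).
  exact: suplimD.
by apply/funext => n; rewrite big_cons.
Qed.

Lemma suplim_subseq u v x : suplim u x -> nondecreasing_seq v ->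
  (forall n, exists m, u n <= v m) -> (forall n, 0 <= v n) -> suplim v x.
Proof.
move=> [nd u0 h] ndv uv v0; split => //; apply: le_trans h _.
apply: ge_ereal_sup => _ [n _ <-]; have [m] := uv n.
by move=> /le_trans; apply; apply: ereal_sup_ubound; exists m.
Qed.

Lemma suplim_integral d (X : measurableType d) (mu : {measure set X -> \bar R})
  (D : set X) (u : nat -> X -> \bar R) (f : X -> \bar R) : measurable D ->
  (forall n, measurable_fun D (u n)) -> (forall t, D t -> 0 <= f t) ->
  (forall n t, D t -> 0 <= u n t) ->
  (forall t, D t -> suplim (u ^~ t) (f t)) ->
  suplim (fun n => \int[mu]_(x in D) u n x) (\int[mu]_(x in D) f x).
Proof.
move=> mD mu_ f0 u0 h.
have nd t : D t -> nondecreasing_seq (u ^~ t) by move=> /h[].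
apply: (@le_suplim _ (\int[mu]_(x in D) limn (u ^~ x))); last first.
  apply: le_integral_ge0 => // x Dx; have [ndx _ hx] := h x Dx.
  by rewrite (cvg_lim _ (ereal_nondecreasing_cvgn ndx)).
rewrite monotone_convergence//; apply: suplim_lim.
  move=> m n mn; apply: le_integral_ge0 => x Dx; first exact: u0.
  exact: nd.
by move=> n; apply: integral_ge0 => x Dx; exact: u0.
Qed.

(** Allows a single index to truncate in several places at once. *)
Lemma suplim_diag (u : nat -> nat -> \bar R) (x : nat -> \bar R) y :
  (forall n, suplim (u n) (x n)) -> (forall m, nondecreasing_seq (u ^~ m)) ->
  suplim x y -> suplim (fun n => u n n) y.
Proof.
move=> ux ndu [ndx x0 h]; split.
- move=> m n mn; apply: (@le_trans _ _ (u n m)); first exact: ndu.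
  by have [+ _ _] := ux n; apply.
- by move=> n; have [_ + _] := ux n.
- apply: le_trans h _; apply: ge_ereal_sup => _ [n _ <-].
  have [ndn _ hn] := ux n; apply: le_trans hn _.
  apply: ge_ereal_sup => _ [m _ <-].
  apply: (@le_trans _ _ (u (maxn n m) (maxn n m))).
    apply: (@le_trans _ _ (u n (maxn n m))); first by apply: ndn; exact: leq_maxr.
    by apply: ndu; exact: leq_maxl.
  by apply: ereal_sup_ubound; exists (maxn n m).
Qed.

End Suplim.

(** * Kernel sums, Wolff sums and dyadic potentials over a filtration *)

Section TwoMeasures.
Context d (X : measurableType d) (R : realType) (c : nat -> X -> nat).
Hypothesis fc : filtration c.
Variables (mu sigma : {measure set X -> \bar R}).
Hypothesis s0 : forall i x, 0 < sigma (cell c i x).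
Hypothesis soo : forall i x, sigma (cell c i x) < +oo.
Hypothesis muoo : forall i x, mu (cell c i x) < +oo.
Variable K : nat -> R.
Hypothesis K0 : forall i, (0 <= K i)%R.
Implicit Types (f g : X -> \bar R) (i l L k : nat).

Lemma integral_indic_mul (nu : {measure set X -> \bar R}) (D : set X) f :
  \int[nu]_(x in D) f x = \int[nu]_x ((\1_D x)%:E * f x).
Proof.
rewrite integral_mkcond; apply: eq_integral => x _.
by rewrite /patch indicE; case: ifPn => _; rewrite ?mul1e ?mul0e.
Qed.

Lemma cint_swap_cell i l g x : (i <= l)%N -> measurable_fun setT g ->
  (forall y, 0 <= g y) ->
  \int[sigma]_(y in cell c i x) cint c mu l g y =
  \int[mu]_(y in cell c i x) (sigma (cell c l y) * g y).
Proof.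
move=> il mg g0; rewrite (integral_indic_mul sigma) (integral_indic_mul mu (cell c i x)).
have ah : adapted c l (fun y => (\1_(cell c i x) y)%:E : \bar R).
  move=> y z yz; congr (_%:E); rewrite !indicE; congr (_%:R); congr nat_of_bool.
  have e := label_le fc il yz.
  apply/idP/idP => /set_mem h; apply/mem_set; first exact: etrans (esym e) h.
  exact: etrans e h.
have := cint_swap fc sigma mu mg (measurable_cst 1) g0 (fun=> lee01) _ ah.
rewrite /=; under eq_integral do rewrite mule1.
move=> ->; last by move=> y; rewrite lee_fin.
by apply: eq_integral => y _; rewrite cint_cst// muleA.
Qed.

(* For cells that are dyadic cubes and [K i = k (side)], [ker_sum] is
   [sigma(Q) * Kbar(Q)] and [wolff_sum] is the dyadic Wolff potential restricted to
   the cubes of generation at least 0. *)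
Definition ker_sumcut i L y := \sum_(i <= l < L) (K l)%:E * sigma (cell c l y).

Definition ker_sum i y := \sum_(i <= l <oo) (K l)%:E * sigma (cell c l y).

Lemma Ksigma_ge0 l y : 0 <= (K l)%:E * sigma (cell c l y).
Proof. by rewrite mule_ge0 ?lee_fin. Qed.

Lemma ker_sumcut_ge0 i L y : 0 <= ker_sumcut i L y.
Proof. by apply: sume_ge0 => l _; exact: Ksigma_ge0. Qed.

Lemma nd_ker_sumcut i y : nondecreasing_seq (fun L => ker_sumcut i L y).
Proof. by move=> m n mn; apply: lee_sum_nneg_natr => // l _ _; exact: Ksigma_ge0. Qed.

Lemma ker_sumcut_ker_sum i y : suplim (fun L => ker_sumcut i L y) (ker_sum i y).
Proof.
by apply: suplim_lim; [exact: nd_ker_sumcut|move=> n; exact: ker_sumcut_ge0].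
Qed.

Lemma ker_sumcut_le_ker_sum i L y : ker_sumcut i L y <= ker_sum i y.
Proof.
rewrite /ker_sum (cvg_lim _ (ereal_nondecreasing_cvgn (@nd_ker_sumcut i y)))//.
by apply: ereal_sup_ubound; exists L.
Qed.

Lemma ker_sum_ge0 i y : 0 <= ker_sum i y.
Proof. exact: le_trans (ker_sumcut_ge0 i 0 y) (ker_sumcut_le_ker_sum _ _ _). Qed.

Lemma measurable_sigma_cell l : measurable_fun setT (fun y => sigma (cell c l y)).
Proof. by apply: (measurable_adapted fc (i := l)); exact: adapted_measure. Qed.

Lemma measurable_sigmaV_cell l : measurable_fun setT (fun y => (sigma (cell c l y))^-1).
Proof. by apply: (measurable_adapted fc (i := l)) => x y /cell_eq ->. Qed.

Lemma measurable_ker_sumcut i L : measurable_fun setT (ker_sumcut i L).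
Proof.
apply: emeasurable_sum => l; apply: emeasurable_funM => //.
exact: measurable_sigma_cell.
Qed.

(** Exchanging the two integrals turns the averaged tail of the dual sum into a [mu]-integral
    against the kernel sum. It works because for l >= i the cells of generation l are contained in
    those of generation i. With g = 1 the result is the inner integral of a Wolff term. *)
Lemma avg_cint i L g x : measurable_fun setT g -> (forall y, 0 <= g y) ->
  avg c sigma i (fun y => \sum_(i <= l < L) (K l)%:E * cint c mu l g y) x =
  cint c mu i (fun y => (sigma (cell c i y))^-1 * (ker_sumcut i L y * g y)) x.
Proof.
move=> mg g0; rewrite /avg /cint.
have mD := measurable_cell fc i x.
have mci l := measurable_adapted fc (@adapted_cint _ _ _ c mu l g).
have ci0 l y : 0 <= cint c mu l g y by exact: cint_ge0.
have ms := measurable_sigma_cell.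
have mk := measurable_ker_sumcut.
rewrite ge0_integral_sum//; last 2 first.
- by move=> l; apply: measurable_funTS; emeas; exact: mci.
- by move=> l y _; rewrite mule_ge0 ?lee_fin ?ci0.
transitivity ((sigma (cell c i x))^-1 *
    \int[mu]_(y in cell c i x) (ker_sumcut i L y * g y)); last first.
  rewrite -ge0_integralZl//; last 3 first.
  - by apply: measurable_funTS; emeas; exact: mk.
  - by move=> y _; rewrite mule_ge0 ?ker_sumcut_ge0.
  - exact: mesV_ge0.
  by apply: eq_integral => y /set_mem/= /cell_eq ->.
congr (_ * _).
transitivity (\int[mu]_(y in cell c i x)
    \sum_(i <= l < L) ((K l)%:E * (sigma (cell c l y) * g y))).
  rewrite ge0_integral_sum//; last 2 first.
  - by move=> l; apply: measurable_funTS; emeas; exact: ms.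
  - by move=> l y _; rewrite !mule_ge0 ?lee_fin.
  rewrite !big_nat; apply: eq_bigr => l /andP[il _].
  rewrite ge0_integralZl ?lee_fin//; last 2 first.
  - by apply: measurable_funTS; exact: mci.
  - by move=> y _; exact: ci0.
  rewrite ge0_integralZl ?lee_fin//; last 2 first.
  - by apply: measurable_funTS; emeas; exact: ms.
  - by move=> y _; rewrite mule_ge0.
  by rewrite -cint_swap_cell.
apply: eq_integral => y _; rewrite /ker_sumcut ge0_sume_distrl.
  by apply: eq_bigr => l _; rewrite muleA.
by move=> l _; exact: Ksigma_ge0.
Qed.

(* Truncation to the first [k] cells of generation [0], a set of finite measure. *)
Definition cut0 k x : \bar R := if (c 0%N x < k)%N then 1 else 0.

Lemma cut0_ge0 k x : 0 <= cut0 k x.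
Proof. by rewrite /cut0; case: ifP. Qed.

Lemma cut0_le1 k x : cut0 k x <= 1.
Proof. by rewrite /cut0; case: ifP. Qed.

Lemma adapted_cut0 k i : adapted c i (cut0 k).
Proof. by move=> x y xy; rewrite /cut0 (label_le fc (leq0n i) xy). Qed.

Lemma measurable_cut0 k : measurable_fun setT (cut0 k).
Proof. by apply: (measurable_adapted fc (i := 0%N)); exact: adapted_cut0. Qed.

Lemma cut0_poweR k x (r : R) : r != 0%R -> cut0 k x `^ r = cut0 k x.
Proof. by move=> r0; rewrite /cut0; case: ifP => _; rewrite ?poweR1r// poweR0r. Qed.

Lemma integral_cut0_lty (nu : {measure set X -> \bar R}) k :
  (forall x, nu (cell c 0 x) < +oo) -> \int[nu]_x cut0 k x < +oo.
Proof.
move=> nuoo.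
pose F j := if (j < k)%N then nu [set x | c 0%N x = j] else 0.
rewrite (integral_cells fc nu 0%N (measurable_cut0 k) (cut0_ge0 k)).
rewrite (eq_eseriesr (g := F)); last first.
  move=> j _; rewrite /F; transitivity
    (\int[nu]_(x in [set x | c 0%N x = j]) (if (j < k)%N then 1 else 0) : \bar R).
    by apply: eq_integral => x /set_mem/= <-.
  case: ifP => _; last by rewrite integral0.
  by rewrite integral_cst ?mul1e//; exact: (measurable_label fc).
rewrite (nneseries_split 0 k)//; last first.
  by move=> j _; rewrite /F; case: ifP.
rewrite add0n eseries0 ?adde0; last first.
  by move=> j kj _; rewrite /F ltnNge kj.
apply: lte_sum_pinfty => j _; rewrite /F; case: ifP => // _.
have [->|/set0P[x0 /= <-]] := eqVneq [set x | c 0%N x = j] set0.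
  by rewrite measure0.
exact: nuoo.
Qed.

Lemma measurable_ker_sum i : measurable_fun setT (ker_sum i).
Proof.
apply: (emeasurable_fun_cvg (ker_sumcut i)); first exact: measurable_ker_sumcut.
move=> y _; apply: ereal_nondecreasing_is_cvgn; exact: nd_ker_sumcut.
Qed.

Definition kbar_int i x := cint c mu i (fun y => (sigma (cell c i y))^-1 * ker_sum i y) x.

Definition wolff_term (b : R) i x := (K i)%:E * sigma (cell c i x) * kbar_int i x `^ b.

Definition wolff_sum (b : R) x := \sum_(i <oo) wolff_term b i x.

Definition dyadic_pot L f x := \sum_(i < L) (K i)%:E * cint c sigma i f x.

Definition kbar_intcut i L x :=
  cint c mu i (fun y => (sigma (cell c i y))^-1 * ker_sumcut i L y) x.

Definition wolff_termcut (b : R) i L x := (K i)%:E * sigma (cell c i x) * kbar_intcut i L x `^ b.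

Lemma kbar_int_ge0 i x : 0 <= kbar_int i x.
Proof.
by apply: cint_ge0 => y; rewrite mule_ge0 ?ker_sum_ge0//; exact: mesV_ge0.
Qed.

Lemma kbar_intcut_ge0 i L x : 0 <= kbar_intcut i L x.
Proof.
by apply: cint_ge0 => y; rewrite mule_ge0 ?ker_sumcut_ge0//; exact: mesV_ge0.
Qed.

Lemma wolff_term_ge0 b i x : 0 <= wolff_term b i x.
Proof. by rewrite !mule_ge0 ?poweR_ge0 ?lee_fin. Qed.

Lemma wolff_termcut_ge0 b i L x : 0 <= wolff_termcut b i L x.
Proof. by rewrite !mule_ge0 ?poweR_ge0 ?lee_fin. Qed.

Lemma wolff_sum_ge0 b x : 0 <= wolff_sum b x.
Proof. by apply: nneseries_ge0 => i _ _; exact: wolff_term_ge0. Qed.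

Lemma adapted_wolff_term b i : adapted c i (wolff_term b i).
Proof.
by move=> x y xy; rewrite /wolff_term (cell_eq xy) /kbar_int (adapted_cint _ _ xy).
Qed.

Lemma measurable_wolff_term b i : measurable_fun setT (wolff_term b i).
Proof. by apply: (measurable_adapted fc (i := i)); exact: adapted_wolff_term. Qed.

Lemma measurable_wolff_sum b : measurable_fun setT (wolff_sum b).
Proof.
apply: ge0_emeasurable_sum => [i x _ _|i _]; first exact: wolff_term_ge0.
exact: measurable_wolff_term.
Qed.

Lemma measurable_dyadic_pot L f : measurable_fun setT (dyadic_pot L f).
Proof.
apply: emeasurable_sum => i; apply: emeasurable_funM => //.
by apply: (measurable_adapted fc (i := i)); exact: adapted_cint.
Qed.

Lemma kbar_intcut_kbar_int i x : suplim (fun L => kbar_intcut i L x) (kbar_int i x).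
Proof.
have sV l y : 0 <= (sigma (cell c l y))^-1 by exact: mesV_ge0.
apply: suplim_integral.
- exact: measurable_cell.
- move=> n; apply: measurable_funTS; apply: emeasurable_funM.
    exact: measurable_sigmaV_cell.
  exact: measurable_ker_sumcut.
- by move=> y _; rewrite mule_ge0 ?ker_sum_ge0.
- by move=> n y _; rewrite mule_ge0 ?ker_sumcut_ge0.
move=> y _; have := s0 i y; have := soo i y.
case: (sigma _) => [r| |]//= _; rewrite lte_fin => r0.
rewrite inver (gt_eqF r0); apply: suplimZ; first by rewrite invr_ge0 ltW.
exact: ker_sumcut_ker_sum.
Qed.

Lemma wolff_termcut_wolff_term b i x : (0 < b)%R -> suplim (fun L => wolff_termcut b i L x) (wolff_term b i x).
Proof.
move=> b0.
have h := suplim_poweR b0 (kbar_int_ge0 i x) (kbar_intcut_kbar_int i x).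
rewrite /wolff_term /wolff_termcut; have := s0 i x; have := soo i x.
case: (sigma _) => [r| |]//= _; rewrite lte_fin => r0.
rewrite -EFinM; apply: suplimZ => //.
by rewrite mulr_ge0// ltW.
Qed.

(** One parameter cuts the sum, the kernel inside each term and the set of top cells. The outcome is
    bounded, lives on finitely many top cells and still increases to the full Wolff sum. *)
Definition wolff_sumcut (b : R) L x := (\sum_(i < L) wolff_termcut b i L x) * cut0 L x.

Lemma wolff_sumcut_wolff_sum b x : (0 < b)%R -> suplim (fun L => wolff_sumcut b L x) (wolff_sum b x).
Proof.
move=> b0.
have h L : suplim (fun n => \sum_(i < L) wolff_termcut b i n x) (\sum_(i < L) wolff_term b i x).
  by apply: suplim_sum => i; exact: wolff_termcut_wolff_term.
have nd n : nondecreasing_seq (fun L => \sum_(i < L) wolff_termcut b i n x).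
  move=> L L' LL'; rewrite -!(big_mkord xpredT (fun i => wolff_termcut b i n x)).
  by apply: lee_sum_nneg_natr => // i _ _; exact: wolff_termcut_ge0.
have hW : suplim (fun L => \sum_(i < L) wolff_term b i x) (wolff_sum b x).
  rewrite /wolff_sum; under eq_fun do rewrite -(big_mkord xpredT (fun i => wolff_term b i x)).
  apply: suplim_lim => [m n mn|n].
    by apply: lee_sum_nneg_natr => // i _ _; exact: wolff_term_ge0.
  by apply: sume_ge0 => i _; exact: wolff_term_ge0.
have hd := suplim_diag h nd hW.
have nW : nondecreasing_seq (fun L => wolff_sumcut b L x).
  move=> m n mn; rewrite /wolff_sumcut /cut0; case: ifPn => cm; last first.
    rewrite mule0 mule_ge0//; first by apply: sume_ge0 => i _; exact: wolff_termcut_ge0.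
    by case: ifP.
  by rewrite (leq_trans cm mn) !mule1; have [+ _ _] := hd; apply.
apply: (suplim_subseq hd) => //.
  move=> n; exists (maxn n (c 0%N x).+1); rewrite /wolff_sumcut /cut0 leq_maxr mule1.
  by have [+ _ _] := hd; apply; exact: leq_maxl.
move=> n; rewrite mule_ge0 ?cut0_ge0//.
by apply: sume_ge0 => i _; exact: wolff_termcut_ge0.
Qed.

Lemma measure_cell_le_cut0 (nu : {measure set X -> \bar R}) k i x :
  cut0 k x = 1 -> nu (cell c i x) <= \int[nu]_y cut0 k y.
Proof.
move=> ix; have mD := measurable_cell fc i x.
rewrite -(mul1e (nu _)) -(integral_cst _ mD) (integral_indic_mul nu (cell c i x)).
apply: le_integral_ge0 => y _; first by rewrite mule_ge0// lee_fin.
rewrite indicE; have [/set_mem/= yx|_] := boolP (y \in cell c i x).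
  by rewrite mule1 (adapted_cut0 k yx) ix.
by rewrite mul0e cut0_ge0.
Qed.

Lemma cint_cut0_le g (C : R) k : (0 <= C)%R -> measurable_fun setT g ->
  (forall x, 0 <= g x) ->
  (forall x, g x <= C%:E * cut0 k x) ->
  exists2 G : R, (0 <= G)%R & forall i x, cint c mu i g x <= G%:E * cut0 k x.
Proof.
move=> C0 mg g0 gC.
have mi := measurable_cut0 k.
have i0 := cut0_ge0 k.
have goo : \int[mu]_x g x < +oo.
  apply: (@le_lt_trans _ _ (\int[mu]_x (C%:E * cut0 k x))).
    exact: le_integral_ge0.
  rewrite ge0_integralTZl ?lee_fin// lte_mul_pinfty ?lee_fin//.
  exact: integral_cut0_lty.
have gg0 : 0 <= \int[mu]_x g x by apply: integral_ge0.
exists (fine (\int[mu]_x g x)); first by rewrite fine_ge0.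
move=> i x; rewrite fineK ?ge0_fin_numE//.
have [ix|ix] := boolP (c 0%N x < k)%N.
  rewrite [X in _ <= _ * X]/cut0 ix mule1 /cint integral_indic_mul.
  apply: le_integral_ge0 => y _; first by rewrite mule_ge0// lee_fin.
  by rewrite indicE; case: (_ \in _); rewrite ?mul1e// mul0e.
rewrite [X in _ <= _ * X]/cut0 (negPf ix) mule0 /cint integral0_eq// => y /= yx.
apply/eqP; rewrite eq_le g0 andbT (le_trans (gC y))// (adapted_cut0 k yx).
by rewrite /cut0 (negPf ix) mule0.
Qed.

Lemma dual_sum_le_cut0 g (C : R) k L : (0 <= C)%R -> measurable_fun setT g ->
  (forall x, 0 <= g x) -> (forall x, g x <= C%:E * cut0 k x) ->
  exists2 G : R, (0 <= G)%R &
    forall x, \sum_(i < L) (K i)%:E * cint c mu i g x <= G%:E * cut0 k x.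
Proof.
move=> C0 mg g0 gC; have [G G0 HG] := cint_cut0_le C0 mg g0 gC.
exists (\sum_(i < L) K i * G)%R; first by apply: sumr_ge0 => i _; rewrite mulr_ge0.
move=> x; rewrite -sumEFin ge0_sume_distrl; last first.
  by move=> i _; rewrite lee_fin mulr_ge0.
apply: lee_sum => i _; rewrite EFinM -muleA lee_wpmul2l ?lee_fin//.
Qed.

(** In both trace theorems below, the finiteness required for absorption comes from here. *)
Lemma poweR_le_cut0_lty (A : X -> \bar R) (G : R) k (r : R) : (0 < r)%R ->
  (0 <= G)%R -> (forall x, 0 <= A x) -> (forall x, A x <= G%:E * cut0 k x) ->
  forall nu : {measure set X -> \bar R}, (forall x, nu (cell c 0%N x) < +oo) ->
  \int[nu]_x (A x `^ r) < +oo.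
Proof.
move=> r0 G0 A0 AG nu nuoo.
apply: (@le_lt_trans _ _ (\int[nu]_x ((G `^ r)%:E * cut0 k x))).
  apply: le_integral_ge0 => x _; first exact: poweR_ge0.
  rewrite -(@cut0_poweR k x r) ?gt_eqF// -poweR_EFin -poweRM ?lee_fin ?cut0_ge0//.
  by apply: lee_poweR => //; exact: ltW.
rewrite ge0_integralTZl ?lee_fin ?powR_ge0//.
- by rewrite lte_mul_pinfty ?lee_fin ?powR_ge0//; exact: integral_cut0_lty.
- exact: measurable_cut0.
- exact: cut0_ge0.
Qed.

Lemma adapted_kbar_intcut i L : adapted c i (kbar_intcut i L).
Proof. exact: adapted_cint. Qed.

Lemma adapted_wolff_termcut b i L : adapted c i (wolff_termcut b i L).
Proof. by move=> x y xy; rewrite /wolff_termcut (cell_eq xy) (adapted_kbar_intcut _ xy). Qed.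

Lemma measurable_wolff_sumcut b L : measurable_fun setT (wolff_sumcut b L).
Proof.
apply: emeasurable_funM; last exact: measurable_cut0.
apply: emeasurable_sum => i.
by apply: (measurable_adapted fc (i := i)); exact: adapted_wolff_termcut.
Qed.

Lemma dyadic_pot_dual L f g : measurable_fun setT f -> measurable_fun setT g ->
  (forall x, 0 <= f x) -> (forall x, 0 <= g x) ->
  \int[mu]_x (dyadic_pot L f x * g x) =
  \int[sigma]_x (f x * \sum_(i < L) (K i)%:E * cint c mu i g x).
Proof.
move=> mf mg f0 g0.
have mci nu i h := measurable_adapted fc (@adapted_cint _ _ _ c nu i h).
have c0 nu i h x : (forall x, 0 <= h x) -> 0 <= cint c nu i h x.
  by move=> h0; exact: cint_ge0.
transitivity (\sum_(i < L) \int[mu]_x ((K i)%:E * cint c sigma i f x * g x)).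
  rewrite -ge0_integral_sum//; last 2 first.
  - by move=> i; emeas; exact: mci.
  - by move=> i x _; rewrite !mule_ge0 ?lee_fin ?c0.
  apply: eq_integral => x _; rewrite /dyadic_pot ge0_sume_distrl//.
  by move=> i _; rewrite mule_ge0 ?lee_fin ?c0.
transitivity (\sum_(i < L) \int[sigma]_x ((K i)%:E * cint c mu i g x * f x)).
  apply: eq_bigr => i _.
  by apply: (@cint_swap _ X R c fc mu sigma i f g (fun=> (K i)%:E)) => // x;
    rewrite lee_fin.
rewrite -ge0_integral_sum//; last 2 first.
- by move=> i; emeas; exact: mci.
- by move=> i x _; rewrite !mule_ge0 ?lee_fin ?c0.
apply: eq_integral => x _; rewrite muleC ge0_sume_distrl//.
by move=> i _; rewrite mule_ge0 ?lee_fin ?c0.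
Qed.

Lemma wolff_sumcut_le_cut0 b n : (0 < b)%R ->
  exists2 C : R, (0 <= C)%R & forall x, wolff_sumcut b n x <= C%:E * cut0 n x.
Proof.
move=> b0.
have h (nu : {measure set X -> \bar R}) : (forall x, nu (cell c 0%N x) < +oo) ->
  exists2 B : R, (0 <= B)%R & forall i x, cut0 n x = 1 -> nu (cell c i x) <= B%:E.
  move=> nuoo; have i0 : 0 <= \int[nu]_x cut0 n x.
    by apply: integral_ge0 => x _; exact: cut0_ge0.
  exists (fine (\int[nu]_x cut0 n x)); first by rewrite fine_ge0.
  move=> i x ix; rewrite fineK ?ge0_fin_numE//; last exact: integral_cut0_lty.
  exact: measure_cell_le_cut0.
have [S S0 HS] := h sigma (soo 0%N).
have [M M0 HM] := h mu (muoo 0%N).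
pose kk := (\sum_(l < n) K l)%R.
have kk0 : (0 <= kk)%R by exact: sumr_ge0.
exists (\sum_(i < n) K i * S * (kk * M) `^ b)%R.
  by apply: sumr_ge0 => i _; rewrite !mulr_ge0 ?powR_ge0.
move=> x; rewrite /wolff_sumcut.
have [ix|ix] := boolP (c 0%N x < n)%N; last by rewrite /cut0 (negPf ix) !mule0.
have ix1 : cut0 n x = 1 by rewrite /cut0 ix.
rewrite ix1 !mule1 -sumEFin; apply: lee_sum => i _.
rewrite /wolff_termcut 2!EFinM -poweR_EFin EFinM.
apply: lee_pmul; rewrite ?poweR_ge0 ?mule_ge0 ?lee_fin//.
  by rewrite lee_wpmul2l ?lee_fin// HS.
apply: lee_poweR; [exact: ltW|exact: kbar_intcut_ge0|].
apply: (@le_trans _ _ (\int[mu]_(y in cell c i x) (cst kk%:E y))).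
  apply: le_integral_ge0 => y yx; first by rewrite mule_ge0 ?ker_sumcut_ge0 ?mesV_ge0.
  apply: (@le_trans _ _ ((sigma (cell c i y))^-1 * (sigma (cell c i y) * kk%:E))).
    rewrite lee_wpmul2l ?mesV_ge0//.
    rewrite -sumEFin ge0_sume_distrr; last by move=> l _; rewrite lee_fin.
    apply: (@le_trans _ _ (\sum_(i <= l < n) sigma (cell c i y) * (K l)%:E)).
      rewrite /ker_sumcut !big_nat; apply: lee_sum => l /andP[il _].
      rewrite muleC lee_wpmul2r ?lee_fin//; apply: le_measure.
      - by rewrite inE; exact: measurable_cell.
      - by rewrite inE; exact: measurable_cell.
      - by move=> z /= /(label_le fc il).
    rewrite -(big_mkord xpredT (fun l => sigma (cell c i y) * (K l)%:E)).
    rewrite [leRHS](big_cat_nat (n := i))//=; last exact: ltnW.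
    by rewrite leeDr//; apply: sume_ge0 => l _; rewrite mule_ge0 ?lee_fin.
  by rewrite muleA mesVK// mul1e.
rewrite integral_cst; last exact: measurable_cell.
by rewrite lee_wpmul2l ?lee_fin// HM.
Qed.

(** Carries one generation of the energy from [sigma] to [mu]: once the average is rewritten by
    [avg_cint], it is constant on cells and [cint_swap] applies. With g = 1 the right-hand side
    integrates a truncated Wolff term. *)
Lemma integral_energy i L (b : R) g : measurable_fun setT g -> (forall x, 0 <= g x) ->
  \int[sigma]_x ((K i)%:E * cint c mu i g x *
     avg c sigma i (fun y => \sum_(i <= l < L) (K l)%:E * cint c mu l g y) x `^ b) =
  \int[mu]_x ((K i)%:E * sigma (cell c i x) *
    cint c mu i (fun y => (sigma (cell c i y))^-1 * (ker_sumcut i L y * g y)) x `^ b * g x).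
Proof.
move=> mg g0.
set M := cint c mu i (fun y => (sigma (cell c i y))^-1 * (ker_sumcut i L y * g y)).
have aM : adapted c i (fun x => (K i)%:E * M x `^ b).
  by move=> x y xy; rewrite /M (adapted_cint _ _ xy).
have := @cint_swap _ X R c fc mu sigma i (cst 1) g _ (measurable_cst _) mg
  (fun=> lee01) g0 _ aM => /(_ _)/wrap[|H].
  by move=> x; rewrite mule_ge0 ?poweR_ge0 ?lee_fin.
transitivity (\int[sigma]_x ((K i)%:E * M x `^ b * cint c mu i g x * cst 1 x)).
  by apply: eq_integral => x _; rewrite avg_cint// mule1 muleAC.
rewrite -H; apply: eq_integral => x _; rewrite cint_cst//.
by congr (_ * _); rewrite muleAC.
Qed.

(** Quasi-constancy bounds the kernel average at each point of the cell Q by C / mu(Q) times its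
    integral over Q. The inner integral is then at most C / mu(Q) times [kbar_int] times int_Q g
    dmu, and Jensen's inequality for g contributes mu(Q)^b, which cancels the negative power. *)
Lemma cell_oscillation (b : R) (C : R) i g x : (0 < b)%R -> (0 <= C)%R ->
  (forall y z, c i y = c i z -> ker_sum i y <= C%:E * ker_sum i z) ->
  measurable_fun setT g -> (forall x, 0 <= g x) ->
  cint c mu i g x *
    cint c mu i (fun y => (sigma (cell c i y))^-1 * (ker_sum i y * g y)) x `^ b <=
  (C `^ b)%:E * kbar_int i x `^ b * cint c mu i (fun y => g y `^ (1 + b)) x.
Proof.
move=> b0 C0 osc mg g0; have b1 : (0 < 1 + b)%R by rewrite addr_gt0.
have mD := measurable_cell fc i x.
have mgD := measurable_funTS (D := cell c i x) mg.
have la0 : 0 <= cint c mu i g x by exact: cint_ge0.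
have gt0 : 0 <= cint c mu i (fun y => g y `^ (1 + b)) x.
  by apply: cint_ge0 => y; exact: poweR_ge0.
have nn0 := kbar_int_ge0 i x.
have jen := jensen_integral mu mD b0 mgD (fun y _ => g0 y).
rewrite -/(cint c mu i g x) -/(cint c mu i (fun y => g y `^ (1 + b)) x) in jen.
have [m0|m0] := eqVneq (mu (cell c i x)) 0.
  have /poweR_eq0_eq0 -> // : cint c mu i g x `^ (1 + b) = 0.
    by apply/eqP; rewrite eq_le poweR_ge0 andbT (le_trans jen)// m0 poweR0r ?gt_eqF// mul0e.
  by rewrite mul0e !mule_ge0 ?poweR_ge0 ?lee_fin ?powR_ge0.
have {}m0 : 0 < mu (cell c i x) by rewrite lt0e m0 measure_ge0.
move: jen m0 (muoo i x) (integral_cst mu mD).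
case: (mu (cell c i x)) => [r| |]// jen; rewrite lte_fin => r0 _ icst.
have ri : (0 < r^-1)%R by rewrite invr_gt0.
pose V y := (sigma (cell c i y))^-1 * ker_sum i y.
have V0 y : 0 <= V y by rewrite mule_ge0 ?ker_sum_ge0 ?mesV_ge0.
have mV : measurable_fun setT V.
  by apply: emeasurable_funM; [exact: measurable_sigmaV_cell|exact: measurable_ker_sum].
have VC y z : c i y = c i z -> V y <= C%:E * V z.
  move=> yz; rewrite /V (cell_eq yz) [leRHS]muleCA lee_wpmul2l ?mesV_ge0//.
  exact: osc.
have Vn y : c i y = c i x -> V y <= (r^-1 * C)%:E * kbar_int i x.
  move=> yx; rewrite EFinM -muleA lee_pdivlMl// muleC -icst.
  rewrite /kbar_int /cint -ge0_integralZl//; [|exact: measurable_funTS|by move=> z _; exact: V0].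
  apply: le_integral_ge0 => z zx; first exact: V0.
  by apply: VC; rewrite yx zx.
have Mn : cint c mu i (fun y => (sigma (cell c i y))^-1 * (ker_sum i y * g y)) x <=
    (r^-1 * C)%:E * kbar_int i x * cint c mu i g x.
  have rC0 : 0 <= (r^-1 * C)%:E * kbar_int i x.
    by rewrite mule_ge0// lee_fin mulr_ge0// ltW.
  rewrite /cint -ge0_integralZl//.
  apply: le_integral_ge0 => y yx; rewrite muleA; first by rewrite mule_ge0 ?V0.
  by rewrite lee_wpmul2r// Vn.
have M0 : 0 <= cint c mu i (fun y => (sigma (cell c i y))^-1 * (ker_sum i y * g y)) x.
  by apply: cint_ge0 => y; rewrite muleA mule_ge0 ?V0.
apply: le_trans (lee_wpmul2l la0 (lee_poweR (ltW b0) M0 Mn)) _.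
rewrite poweRM//; last by rewrite mule_ge0// lee_fin mulr_ge0// ltW.
rewrite poweRM ?lee_fin ?mulr_ge0 ?(ltW ri)//.
rewrite muleCA -[X in _ * (X * _)](poweRe1 la0) -poweRDge0 ?(ltW b0)//.
apply: le_trans (lee_wpmul2l _ jen) _.
  by rewrite mule_ge0 ?poweR_ge0.
rewrite !poweR_EFin muleA lee_wpmul2r//.
rewrite muleAC -EFinM powRM ?(ltW ri)// lee_wpmul2r ?poweR_ge0// lee_fin.
by rewrite mulrAC -powRM ?(ltW ri) ?(ltW r0)// mulVf ?gt_eqF// powR1 mul1r.
Qed.

Lemma le_sum_wolff_sum (b : R) L x : \sum_(i < L) wolff_term b i x <= wolff_sum b x.
Proof.
have nd : nondecreasing_seq (fun L => \sum_(0 <= i < L) wolff_term b i x).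
  by move=> m n mn; apply: lee_sum_nneg_natr => // i _ _; exact: wolff_term_ge0.
rewrite /wolff_sum (cvg_lim _ (ereal_nondecreasing_cvgn nd))//.
by apply: ereal_sup_ubound; exists L => //; rewrite big_mkord.
Qed.

Lemma energy_le_wolff_sum (b C : R) L g : (0 < b)%R -> (0 <= C)%R ->
  (forall i y z, c i y = c i z -> ker_sum i y <= C%:E * ker_sum i z) ->
  measurable_fun setT g -> (forall x, 0 <= g x) ->
  \sum_(i < L) \int[sigma]_x ((K i)%:E * cint c mu i g x *
     avg c sigma i (fun y => \sum_(i <= l < L) (K l)%:E * cint c mu l g y) x `^ b) <=
  (C `^ b)%:E * \int[mu]_x (wolff_sum b x * g x `^ (1 + b)).
Proof.
move=> b0 C0 osc mg g0.
have Cb0 : 0 <= (C `^ b)%:E by rewrite lee_fin powR_ge0.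
have mW := measurable_wolff_sum b; have W0 := wolff_sum_ge0 b.
have mw i := measurable_wolff_term b i; have w0 i x := wolff_term_ge0 b i x.
have nn0 := kbar_int_ge0.
have step i : \int[sigma]_x ((K i)%:E * cint c mu i g x *
     avg c sigma i (fun y => \sum_(i <= l < L) (K l)%:E * cint c mu l g y) x `^ b) <=
   (C `^ b)%:E * \int[mu]_x (wolff_term b i x * g x `^ (1 + b)).
  have ah : adapted c i (fun x => (K i)%:E * ((C `^ b)%:E * kbar_int i x `^ b)).
    by move=> x y xy; rewrite /kbar_int (adapted_cint _ _ xy).
  have gt0 x : 0 <= g x `^ (1 + b) by ege0.
  have mgt : measurable_fun setT (fun x => g x `^ (1 + b)) by emeas.
  have H0 x : 0 <= (K i)%:E * ((C `^ b)%:E * kbar_int i x `^ b).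
    by rewrite !mule_ge0 ?poweR_ge0 ?lee_fin.
  have := @cint_swap _ X R c fc mu sigma i (cst 1) (fun x => g x `^ (1 + b)) _
    (measurable_cst _) mgt (fun=> lee01) gt0 H0 ah => H.
  apply: (@le_trans _ _ (\int[sigma]_x ((K i)%:E * ((C `^ b)%:E * kbar_int i x `^ b) *
      cint c mu i (fun x => g x `^ (1 + b)) x * cst 1 x))).
    apply: le_integral_ge0 => x _.
      rewrite mule_ge0 ?poweR_ge0// mule_ge0 ?lee_fin//.
      exact: cint_ge0.
    rewrite mule1 -!muleA lee_wpmul2l ?lee_fin// muleA.
    apply: le_trans (cell_oscillation x b0 C0 (osc i) mg g0).
    rewrite lee_wpmul2l ?cint_ge0//; apply: lee_poweR; first exact: ltW.
      by apply: avg_ge0 => // y; apply: sume_ge0 => l _; rewrite mule_ge0 ?lee_fin ?cint_ge0.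
    rewrite avg_cint//; apply: le_integral_ge0 => y _.
      by rewrite mule_ge0 ?mesV_ge0// mule_ge0 ?ker_sumcut_ge0.
    by rewrite lee_wpmul2l ?mesV_ge0// lee_wpmul2r// ker_sumcut_le_ker_sum.
  rewrite -H -ge0_integralTZl//; last 2 first.
  - by emeas.
  - by ege0.
  rewrite le_eqVlt; apply/orP; left; apply/eqP; apply: eq_integral => x _.
  rewrite cint_cst// /wolff_term -!muleA muleCA; congr (_ * _); congr (_ * _).
  by rewrite !muleA; congr (_ * _); rewrite muleC.
apply: (@le_trans _ _ (\sum_(i < L)
    (C `^ b)%:E * \int[mu]_x (wolff_term b i x * g x `^ (1 + b)))).
  by apply: lee_sum => i _; exact: step.
rewrite -ge0_sume_distrr; last by ege0.
rewrite lee_wpmul2l//.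
rewrite -ge0_integral_sum//; last 2 first.
- by move=> i; emeas.
- by move=> i x _; ege0.
apply: le_integral_ge0 => x _; first by ege0.
rewrite -ge0_sume_distrl//.
by rewrite lee_wpmul2r ?poweR_ge0// le_sum_wolff_sum.
Qed.

End TwoMeasures.

Arguments cut0 {d X R} c k x.

(** Bounding G by a power of H, instead of taking the conjugate norm of G, includes q = 1: there the
    condition reads G <= 1 and the last factor is 1. *)
Lemma holder_dominated d (X : measurableType d) (R : realType)
  (mu : {measure set X -> \bar R}) (q : R) (F G H : X -> \bar R) : (1 <= q)%R ->
  measurable_fun setT F -> measurable_fun setT G -> measurable_fun setT H ->
  (forall x, 0 <= F x) -> (forall x, 0 <= G x) -> (forall x, 0 <= H x) ->
  (forall x, G x <= H x `^ (1 - q^-1)) ->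
  \int[mu]_x (F x * G x) <=
    (\int[mu]_x (F x `^ q)) `^ q^-1 * (\int[mu]_x H x) `^ (1 - q^-1).
Proof.
rewrite le_eqVlt => /predU1P[<-|q1] mF mG mH F0 G0 H0 GH.
  rewrite invr1 subrr poweRe0 mule1 poweRe1; last by ege0.
  apply: le_integral_ge0 => x _; first by ege0.
  rewrite poweRe1// -[leRHS]mule1 lee_wpmul2l// (le_trans (GH x))//.
  by rewrite invr1 subrr poweRe0.
have q0 : (0 < q)%R by exact: lt_trans q1.
have tht : (0 < q^-1 < 1)%R by rewrite invr_gt0 q0 invf_lt1.
apply: (@le_trans _ _ (\int[mu]_x ((F x `^ q) `^ q^-1 * H x `^ (1 - q^-1)))).
  apply: le_integral_ge0 => x _; first by ege0.
  by rewrite poweRVK// lee_wpmul2l.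
by apply: holder_integral => //; [emeas|ege0].
Qed.

(** * Trace inequality and Wolff sum on one filtration *)

Section Trace.
Context {R : realType} (p q : R) (q1 : (1 <= q)%R) (qp : (q < p)%R).

(** Here b = p' - 1, so 1 + b = p' and f = A^b satisfies f^p = A^p' = f A. *)
Let b := (p - 1)^-1%R.
Let s := (q * (p - 1) / (p - q))%R.

Let p1 : (1 < p)%R. Proof. exact: le_lt_trans qp. Qed.
Let p0 : (0 < p)%R. Proof. exact: lt_trans p1. Qed.
Let q0 : (0 < q)%R. Proof. exact: lt_le_trans q1. Qed.
Let p10 : (0 < p - 1)%R. Proof. by rewrite subr_gt0. Qed.
Let pq0 : (0 < p - q)%R. Proof. by rewrite subr_gt0. Qed.
Let b0 : (0 < b)%R. Proof. by rewrite invr_gt0. Qed.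
Let b1 : (0 < 1 + b)%R. Proof. by rewrite addr_gt0. Qed.
Let bp : (b * p = 1 + b)%R.
Proof. by rewrite /b; field; rewrite !gt_eqF. Qed.
Let t1 : ((1 - p^-1)^-1 = 1 + b)%R.
Proof. by rewrite /b; field; rewrite !gt_eqF. Qed.
Let s1 : (1 <= s)%R.
Proof.
have : (0 <= (q - 1) * p)%R by rewrite mulr_ge0 ?subr_ge0 ?(ltW p0).
by rewrite /s ler_pdivlMr// mul1r; lra.
Qed.
Let s0 : (0 < s)%R. Proof. exact: lt_le_trans s1. Qed.
(** The Wolff sum W is tested with g = W^th. Hoelder's inequality requires th = s / q', while the
    energy has homogeneity p' in g and requires th p' = s - 1. Together these force s = 1 / (1 -
    p'/q'), which is the exponent q (p - 1) / (p - q) of the theorem. *)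
Let th := (s * (1 - q^-1))%R.
Let th0 : (0 <= th)%R.
Proof. by rewrite /th mulr_ge0 ?(ltW s0)// subr_ge0 invf_le1. Qed.
Let thb : (th * (1 + b) = s - 1)%R.
Proof. by rewrite /th /s /b; field; rewrite !gt_eqF. Qed.
(** This is p'/q', the power with which int W^s comes back in the testing argument; it is below 1
    exactly because q < p. *)
Let beta := ((1 - q^-1) * (1 + b))%R.
Let beta01 : (0 <= beta < 1)%R.
Proof.
rewrite /beta mulr_ge0 ?(ltW b1) ?subr_ge0 ?invf_le1//=.
by rewrite -t1 ltr_pdivrMr ?mul1r ?subr_gt0 ?invf_lt1// ltrD2l ltrN2 ltf_pV2.
Qed.

(** For the truncated Wolff sum W let A be the dual sum of g = W^th, E = int A^p' dsigma and Y = int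
    W^s dmu. Duality and the trace inequality bound E by a multiple of Y^beta, and the energy bound
    gives Y <= s Cw E; since Y is finite, it can be absorbed. *)
Lemma trace_wolff (Ctr : R) : (0 <= Ctr)%R -> exists2 B : R, (0 <= B)%R &
  forall d (X : measurableType d) (c : nat -> X -> nat), filtration c ->
  forall mu sigma : {measure set X -> \bar R},
  (forall i x, 0 < sigma (cell c i x)) -> (forall i x, sigma (cell c i x) < +oo) ->
  (forall i x, mu (cell c i x) < +oo) ->
  forall K : nat -> R, (forall i, 0 <= K i)%R ->
  (forall L (f : X -> R), measurable_fun setT f -> (forall x, 0 <= f x)%R ->
    \int[sigma]_x ((f x)%:E `^ p) < +oo ->
    \int[mu]_x (dyadic_pot c sigma K L (EFin \o f) x `^ q) <=
    Ctr%:E * (\int[sigma]_x ((f x)%:E `^ p)) `^ (q / p)) ->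
  \int[mu]_x (wolff_sum c mu sigma K b x `^ s) <= B%:E.
Proof.
move=> Ctr0; have [Cw Cw0 HCw] := wolff_energy_le b0.
exists ((s * Cw * Ctr `^ ((1 + b) / q)) `^ (1 - beta)^-1)%R; first exact: powR_ge0.
move=> d X c fc mu sigma sg0 sgoo muoo K K0 trace.
pose W n := wolff_sumcut c mu sigma K b n.
have hW x := wolff_sumcut_wolff_sum fc mu sg0 sgoo K0 x b0.
apply: (@integral_le_sup _ _ _ mu _ (fun n x => W n x `^ s)).
- by move=> n; apply: measurable_poweRf; exact: measurable_wolff_sumcut.
- by move=> n x; exact: poweR_ge0.
- by move=> x; exact: poweR_ge0.
- move=> n.
  pose w i x := wolff_termcut c mu sigma K b i n x * cut0 c n x.
  have aw i : adapted c i (w i).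
    apply: adaptedM; first exact: adapted_wolff_termcut.
    exact: adapted_cut0.
  have mw i : measurable_fun setT (w i) := measurable_adapted fc (aw i).
  have w0 i x : 0 <= w i x by rewrite mule_ge0 ?wolff_termcut_ge0 ?cut0_ge0.
  have WE x : W n x = \sum_(i < n) w i x.
    by rewrite /W /wolff_sumcut ge0_sume_distrl// => i _; exact: wolff_termcut_ge0.
  have W0 x : 0 <= W n x by rewrite WE; ege0.
  have mW : measurable_fun setT (W n) by exact: measurable_wolff_sumcut.
  have [Cb Cb0 HCb] := wolff_sumcut_le_cut0 fc sg0 sgoo muoo K0 n b0.
  pose g x := W n x `^ th * cut0 c n x.
  have mi := measurable_cut0 (R := R) fc n.
  have i0 x : 0 <= cut0 c n x :> \bar R by exact: cut0_ge0.
  have mg : measurable_fun setT g by rewrite /g; emeas.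
  have g0 x : 0 <= g x by rewrite /g; ege0.
  have gC x : g x <= (Cb `^ th)%:E * cut0 c n x.
    rewrite /g /cut0; case: ifP => [ix|_]; last by rewrite !mule0.
    rewrite !mule1 -poweR_EFin lee_poweR// (le_trans (HCb x))//.
    by rewrite /cut0 ix mule1.
  have [G G0 HG] := dual_sum_le_cut0 fc muoo K0 n (powR_ge0 _ _) mg g0 gC.
  pose A x := \sum_(i < n) (K i)%:E * cint c mu i g x.
  have mci i h := measurable_adapted fc (@adapted_cint _ _ _ c mu i h).
  have c0 i h x : (forall x, 0 <= h x) -> 0 <= cint c mu i h x.
    by move=> h0; exact: cint_ge0.
  have A0 x : 0 <= A x.
    by apply: sume_ge0 => i _; rewrite mule_ge0 ?lee_fin ?c0.
  have mA : measurable_fun setT A.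
    by apply: emeasurable_sum => i; emeas; exact: mci.
  have Afin x : A x \is a fin_num.
    rewrite ge0_fin_numE// (le_lt_trans (HG x))// /cut0; case: ifP => _.
      by rewrite mule1 ltry.
    by rewrite mule0.
  (* The extremal function for pairing with A. It must be real valued for the trace inequality to
     apply, hence the check that A is finite. *)
  pose f x := (fine (A x) `^ b)%R.
  have fA x : (f x)%:E = A x `^ b by rewrite /f -poweR_EFin fineK.
  have mf : measurable_fun setT f.
    have : measurable_fun setT (fun x => fine (A x `^ b)).
      by apply: measurableT_comp => //; emeas.
    by apply: eq_measurable_fun => x _; rewrite -fA.
  have f0 x : (0 <= f x)%R by exact: powR_ge0.
  have mfE : measurable_fun setT (EFin \o f) by exact/measurable_EFinP.
  pose E := \int[sigma]_x (A x `^ (1 + b)).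
  have E0 : 0 <= E by rewrite /E; ege0.
  have Eoo : E < +oo by exact: (poweR_le_cut0_lty fc b1 G0 A0 HG).
  have fp : \int[sigma]_x ((f x)%:E `^ p) = E.
    by apply: eq_integral => x _; rewrite fA -poweRrM bp.
  pose Y := \int[mu]_x (W n x `^ s).
  have Y0 : 0 <= Y by rewrite /Y; ege0.
  have Yoo : Y < +oo by exact: (poweR_le_cut0_lty fc s0 Cb0 W0 HCb).
  have TT0 x : 0 <= dyadic_pot c sigma K n (EFin \o f) x.
    apply: sume_ge0 => i _; rewrite mule_ge0 ?lee_fin//.
    by apply: cint_ge0 => y; rewrite lee_fin.
  have mTT : measurable_fun setT (dyadic_pot c sigma K n (EFin \o f)).
    exact: measurable_dyadic_pot.
  have E1 : E <= (Ctr `^ q^-1 * fine Y `^ (1 - q^-1))%:E * E `^ p^-1.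
    have EE : E = \int[mu]_x (dyadic_pot c sigma K n (EFin \o f) x * g x).
      rewrite (dyadic_pot_dual fc mu sigma K0)//.
      apply: eq_integral => x _.
      rewrite poweRDge0 ?(ltW b0)// poweRe1// muleC; congr (_ * _).
      by rewrite /= fA.
    rewrite [leLHS]EE.
    have H0 x : 0 <= W n x `^ s by ege0.
    have mH : measurable_fun setT (fun x => W n x `^ s) by emeas.
    apply: (le_trans (holder_dominated mu q1 mTT mg mH TT0 g0 H0 _)).
      move=> x; rewrite -poweRrM -/th /g -[leRHS]mule1 lee_wpmul2l ?poweR_ge0//.
      exact: cut0_le1.
    rewrite -/Y.
    apply: (@le_trans _ _ ((Ctr%:E * E `^ (q / p)) `^ q^-1 * Y `^ (1 - q^-1))).
      rewrite lee_wpmul2r ?poweR_ge0// lee_poweR ?invr_ge0 ?(ltW q0)//.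
        by ege0.
      by have := trace n f mf f0; rewrite fp => /(_ Eoo).
    rewrite poweRM ?poweR_ge0 ?lee_fin// -poweRrM mulrAC divff ?gt_eqF// mul1r.
    have -> : Y = (fine Y)%:E by rewrite fineK// ge0_fin_numE.
    by rewrite !poweR_EFin EFinM muleAC.
  have {}E1 : E <= (Ctr `^ ((1 + b) / q) * fine Y `^ beta)%:E.
    have pi1 : (0 <= p^-1 < 1)%R by rewrite invr_ge0 (ltW p0)/= invf_lt1.
    have := absorb_poweR _ pi1 E0 Eoo E1; rewrite t1 => /(_ _)/wrap[|].
      by rewrite mulr_ge0 ?powR_ge0.
    by rewrite powRM ?powR_ge0// -!powRrM ![(q^-1 * _)%R]mulrC.
  (* W^s is at most s times the sum of w_i D_i^(s-1), where D_i is the sum of the terms up to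
     generation i. Since D_i is constant on the cell and D_i^th <= g there, split s - 1 = th b + th:
     the first power moves under the inner [mu]-integral, the second is bounded by g outside it.
     What remains is the energy of the dual sum. *)
  have Y1 : Y <= s%:E * (Cw%:E * E).
    have := HCw _ _ _ fc _ sg0 sgoo n (fun i x => (K i)%:E * cint c mu i g x) _ _.
    move=> /(_ _ _)/wrap[||].
    - by move=> i x y xy; rewrite (adapted_cint _ _ xy).
    - by move=> i x; rewrite mule_ge0 ?lee_fin ?c0.
    rewrite -/A -/E => HE.
    apply: (@le_trans _ _ (s%:E * \sum_(i < n) \int[mu]_x
        (w i x * (\sum_(l < i.+1) w l x) `^ (s - 1)))).
      have s10 : (0 <= s - 1)%R by rewrite subr_ge0.
      have m1 (i : nat) : measurable_fun setT
          (fun x => w i x * (\sum_(l < i.+1) w l x) `^ (s - 1)).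
        by emeas; exact: emeasurable_sum.
      rewrite -ge0_integral_sum//; last by move=> i x _; ege0.
      rewrite -ge0_integralTZl//; last 3 first.
      - by apply: emeasurable_sum => i.
      - by rewrite lee_fin ltW.
      - by ege0.
      apply: le_integral_ge0 => x _; first by ege0.
      have := le_sum_poweR n s10 (fun i => w0 i x).
      by rewrite addrC subrK WE.
    rewrite lee_wpmul2l ?lee_fin ?(ltW s0)//; apply: le_trans HE.
    apply: lee_sum => i _; rewrite integral_energy//.
    apply: le_integral_ge0 => x _; first by ege0.
    set M := cint c mu i _ x.
    have M0 : 0 <= M.
      apply: c0 => y; rewrite mule_ge0 ?mesV_ge0// mule_ge0//.
      exact: ker_sumcut_ge0.
    pose D := \sum_(l < i.+1) w l x.
    have D0 : 0 <= D by rewrite /D; ege0.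
    have [ix|ix] := boolP (c 0%N x < n)%N; last first.
      rewrite /w /cut0 (negPf ix) mule0 mul0e.
      by rewrite !mule_ge0 ?poweR_ge0 ?lee_fin.
    have ind1 : cut0 c n x = 1 :> \bar R by rewrite /cut0 ix.
    have gD y : c i y = c i x -> D `^ th <= g y.
      move=> yx; rewrite /g (adapted_cut0 R fc n yx) ind1 mule1 lee_poweR//.
      have -> : D = \sum_(l < i.+1) w l y.
        apply: eq_bigr => l _; apply: aw; apply: (label_le fc) (esym yx).
        by rewrite -ltnS.
      rewrite WE -(big_mkord xpredT (fun l => w l y)) -(big_mkord xpredT (fun l => w l y)).
      by apply: lee_sum_nneg_natr => // l _ _; exact: w0.
    have MD : D `^ th * kbar_intcut c mu sigma K i n x <= M.
      have mk := measurable_ker_sumcut fc sigma K i n.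
      have ms := measurable_sigmaV_cell fc sigma i.
      have k0 y : 0 <= (sigma (cell c i y))^-1 * ker_sumcut c sigma K i n y.
        by rewrite mule_ge0 ?mesV_ge0//; exact: ker_sumcut_ge0.
      rewrite /kbar_intcut /cint -ge0_integralZl//; last 3 first.
      - exact: measurable_cell.
      - by apply: measurable_funTS; emeas.
      - exact: poweR_ge0.
      apply: le_integral_ge0 => y yx; first by rewrite mule_ge0 ?poweR_ge0.
      by rewrite [leRHS]muleA [leLHS]muleC lee_wpmul2l//; exact: gD.
    have n0 : 0 <= kbar_intcut c mu sigma K i n x by exact: kbar_intcut_ge0.
    rewrite {1}/w ind1 mule1 -/D /wolff_termcut -[leLHS]muleA -[leRHS]muleA.
    rewrite lee_wpmul2l ?mule_ge0 ?lee_fin//.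
    apply: (@le_trans _ _ ((D `^ th * kbar_intcut c mu sigma K i n x) `^ b * D `^ th)).
      have thb0 : (0 <= th * b)%R := mulr_ge0 th0 (ltW b0).
      rewrite poweRM ?poweR_ge0// -poweRrM muleAC -poweRDge0//.
      by rewrite muleC -[X in (th * b + X)%R]mulr1 -mulrDr [(b + 1)%R]addrC thb.
    apply: lee_pmul; rewrite ?poweR_ge0//; last exact: gD.
    by apply: lee_poweR; rewrite ?(ltW b0)// mule_ge0 ?poweR_ge0.
  (* The two bounds combine to Y <= C Y^beta with Y finite. *)
  apply: absorb_poweR => //.
    by apply: mulr_ge0; [apply: mulr_ge0; exact: ltW|exact: powR_ge0].
  apply: (le_trans Y1); rewrite [(s * Cw * _)%:E]EFinM [(s * Cw)%:E]EFinM -!muleA.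
  apply: lee_wpmul2l; first by rewrite lee_fin; exact: ltW s0.
  rewrite lee_wpmul2l ?lee_fin ?(ltW Cw0)//.
  apply: (le_trans E1); rewrite EFinM.
  suff -> : \int[mu]_x (W n x `^ s) = (fine Y)%:E by rewrite poweR_EFin.
  by rewrite fineK// ge0_fin_numE.
- by move=> x; have [+ _ _] := suplim_poweR s0 (wolff_sum_ge0 _ _ _ K0 _ _) (hW x); exact.
- by move=> x; have [_ _] := suplim_poweR s0 (wolff_sum_ge0 _ _ _ K0 _ _) (hW x); exact.
Qed.

Lemma suplim_trunc d (X : measurableType d) (c : nat -> X -> nat) (F : \bar R) x : 0 <= F ->
  suplim (fun k => mine F k%:R%:E * cut0 c k x) F.
Proof.
move=> F0.
have nd : nondecreasing_seq (fun k => mine F k%:R%:E).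
  move=> m n mn; rewrite le_min ge_min lexx/= ge_min lee_fin ler_nat mn.
  by rewrite orbT.
have m0 (k : nat) : 0 <= mine F k%:R%:E by rewrite le_min F0 lee_fin ler0n.
have h : suplim (fun k => mine F k%:R%:E) F.
  split => //; rewrite leNgt; apply/negP => /lte_dense[y sy yF].
  have y0 : 0 <= y.
    apply: le_trans (ltW sy); apply: le_trans (m0 0%N) (ereal_sup_ubound _).
    by exists 0%N.
  have yfin : y \is a fin_num by rewrite ge0_fin_numE// (lt_le_trans yF) ?leey.
  pose k := (Num.truncn (fine y)).+1.
  have yk : y <= mine F k%:R%:E.
    rewrite le_min (ltW yF)/= -(fineK yfin) lee_fin ltW//.
    exact: truncnS_gt.
  have : y < y.
    apply: le_lt_trans sy; apply: le_trans yk _; apply: ereal_sup_ubound.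
    by exists k.
  by rewrite ltxx.
apply: (suplim_subseq h).
- move=> m n mn; rewrite /cut0; case: ifPn => [cm|_].
    by rewrite (leq_trans cm mn) !mule1; exact: nd.
  by rewrite mule0 mule_ge0//; case: ifP.
- move=> n; exists (maxn n (c 0%N x).+1); rewrite /cut0 leq_maxr mule1.
  by apply: nd; exact: leq_maxl.
- by move=> n; rewrite mule_ge0 ?cut0_ge0.
Qed.

(** Let h be the truncated potential and A the dual sum of h^(q-1). Then int h^q dmu is at most int
    f A dsigma, hence at most the L^p norm of f times E^(1/p') with E = int A^p' dsigma. The energy
    bound and Hoelder's inequality with exponent s estimate E by the Wolff sum and a power of int
    h^q; in total the latter appears on the right to the power 1 - 1/q and is absorbed. *)
Lemma wolff_trace (C0 B : R) : (0 <= C0)%R -> (0 <= B)%R ->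
  exists2 C : R, (0 <= C)%R &
  forall d (X : measurableType d) (c : nat -> X -> nat), filtration c ->
  forall mu sigma : {measure set X -> \bar R},
  (forall i x, 0 < sigma (cell c i x)) -> (forall i x, sigma (cell c i x) < +oo) ->
  (forall i x, mu (cell c i x) < +oo) ->
  forall K : nat -> R, (forall i, 0 <= K i)%R ->
  (forall i x y, c i x = c i y ->
    ker_sum c sigma K i x <= C0%:E * ker_sum c sigma K i y) ->
  \int[mu]_x (wolff_sum c mu sigma K b x `^ s) <= B%:E ->
  forall L (f : X -> \bar R), measurable_fun setT f -> (forall x, 0 <= f x) ->
    \int[sigma]_x (f x `^ p) < +oo ->
    \int[mu]_x (dyadic_pot c sigma K L f x `^ q) <=
    C%:E * (\int[sigma]_x (f x `^ p)) `^ (q / p).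
Proof.
move=> C00 B0; have [Cw Cw0 HCw] := wolff_energy_ge b0.
pose D := (Cw * (C0 `^ b * B `^ s^-1))%R.
have D0 : (0 <= D)%R.
  by apply: mulr_ge0; [exact: ltW|apply: mulr_ge0; exact: powR_ge0].
exists (D `^ (q / (1 + b)))%R; first exact: powR_ge0.
move=> d X c fc mu sigma sg0 sgoo muoo K K0 osc WB L f mf f0 foo.
have TT0 x : 0 <= dyadic_pot c sigma K L f x.
  by apply: sume_ge0 => i _; rewrite mule_ge0 ?lee_fin ?cint_ge0.
have mTT : measurable_fun setT (dyadic_pot c sigma K L f) by exact: measurable_dyadic_pot.
pose h k x := mine (dyadic_pot c sigma K L f x) k%:R%:E * cut0 c k x.
have h0 k x : 0 <= h k x.
  by rewrite mule_ge0 ?cut0_ge0// le_min TT0 lee_fin ler0n.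
have hs x : suplim (h^~ x) (dyadic_pot c sigma K L f x) by exact: suplim_trunc.
have mi k := measurable_cut0 (R := R) fc k.
have mh k : measurable_fun setT (h k).
  by apply: emeasurable_funM => //; exact: measurable_mine.
apply: (@integral_le_sup _ _ _ mu _ (fun k x => h k x `^ q)).
- by move=> k; emeas.
- by move=> k x; exact: poweR_ge0.
- by move=> x; exact: poweR_ge0.
- move=> k.
  have i0 x : 0 <= cut0 c k x :> \bar R by exact: cut0_ge0.
  have hk x : h k x <= k%:R%:E * cut0 c k x.
    by rewrite lee_wpmul2r// ge_min lexx orbT.
  have q10 : (0 <= q - 1)%R by rewrite subr_ge0.
  pose g x := h k x `^ (q - 1) * cut0 c k x.
  have g0 x : 0 <= g x by rewrite /g; ege0.
  have mg : measurable_fun setT g by rewrite /g; emeas.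
  have gC x : g x <= (k%:R `^ (q - 1))%:E * cut0 c k x.
    rewrite /g lee_wpmul2r// -poweR_EFin lee_poweR//.
    rewrite (le_trans (hk x))// -[leRHS]mule1 lee_wpmul2l ?lee_fin ?ler0n//.
    exact: cut0_le1.
  have [G G0 HG] := dual_sum_le_cut0 fc muoo K0 L (powR_ge0 _ _) mg g0 gC.
  pose A x := \sum_(i < L) (K i)%:E * cint c mu i g x.
  have mci i u := measurable_adapted fc (@adapted_cint _ _ _ c mu i u).
  have A0 x : 0 <= A x.
    by apply: sume_ge0 => i _; rewrite mule_ge0 ?lee_fin ?cint_ge0.
  have mA : measurable_fun setT A.
    by apply: emeasurable_sum => i; emeas; exact: mci.
  pose E := \int[sigma]_x (A x `^ (1 + b)).
  have E0 : 0 <= E by rewrite /E; ege0.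
  have Eoo : E < +oo by exact: (poweR_le_cut0_lty fc b1 G0 A0 HG).
  pose Z := \int[mu]_x (h k x `^ q).
  have Z0 : 0 <= Z by rewrite /Z; ege0.
  have Zoo : Z < +oo by exact: (poweR_le_cut0_lty fc q0 (ler0n _ k) (h0 k) (hk)).
  pose F := \int[sigma]_x (f x `^ p).
  have F0 : 0 <= F by rewrite /F; ege0.
  have mW := measurable_wolff_sum fc mu sigma K0 b.
  have W0 := wolff_sum_ge0 c mu sigma K0 b.
  have Z1 : Z <= F `^ p^-1 * E `^ (1 + b)^-1.
    apply: (@le_trans _ _ (\int[mu]_x (dyadic_pot c sigma K L f x * g x))).
      apply: le_integral_ge0 => x _; first exact: poweR_ge0.
      rewrite /g /h /cut0; case: ifP => _; last by rewrite !mule0 poweR0r ?gt_eqF.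
      rewrite !mule1; set m := mine _ _.
      have m0 : 0 <= m by rewrite le_min TT0 lee_fin ler0n.
      have -> : m `^ q = m * m `^ (q - 1).
        by rewrite -[X in X * _](poweRe1 m0) -poweRDge0// addrC subrK.
      by rewrite lee_wpmul2r ?poweR_ge0// ge_min lexx.
    rewrite (dyadic_pot_dual fc mu sigma K0)//.
    have pi1 : (0 < p^-1 < 1)%R by rewrite invr_gt0 p0/= invf_lt1.
    have fp0 x : 0 <= f x `^ p by ege0.
    have mfp : measurable_fun setT (fun x => f x `^ p) by emeas.
    have At0 x : 0 <= A x `^ (1 + b) by ege0.
    have mAt : measurable_fun setT (fun x => A x `^ (1 + b)) by emeas.
    have := holder_integral sigma measurableT pi1 mfp mAt (fun x _ => fp0 x) (fun x _ => At0 x).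
    have ti : ((1 + b)^-1 = 1 - p^-1)%R by rewrite -t1 invrK.
    rewrite -/F -/E ti => /(le_trans _); apply.
    apply: le_integral_ge0 => x _; first by rewrite mule_ge0 ?A0.
    by rewrite poweRVK// -ti poweRVK.
  have E1 : E <= D%:E * Z `^ (1 - s^-1).
    apply: le_trans (HCw _ _ _ fc _ sg0 sgoo L (fun i x => (K i)%:E * cint c mu i g x) _ _ Eoo) _.
    - by move=> i x y xy; rewrite (adapted_cint _ _ xy).
    - by move=> i x; rewrite mule_ge0 ?lee_fin ?cint_ge0.
    rewrite [D%:E]EFinM -muleA lee_wpmul2l ?lee_fin ?(ltW Cw0)//.
    have en := energy_le_wolff_sum fc sg0 muoo K0 L b0 C00 osc mg g0.
    apply: (le_trans en).
    rewrite EFinM -muleA lee_wpmul2l ?lee_fin ?powR_ge0//.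
    have mgt : measurable_fun setT (fun x => g x `^ (1 + b)) by emeas.
    have mhq : measurable_fun setT (fun x => h k x `^ q) by emeas.
    have gt0 x : 0 <= g x `^ (1 + b) by ege0.
    have hq0 x : 0 <= h k x `^ q by ege0.
    apply: le_trans (holder_dominated mu s1 mW mgt mhq W0 gt0 hq0 _) _.
      move=> x; rewrite -poweRrM.
      (* This identity, (q - 1) p' s' = q for s > 1, lets Hoelder's inequality return the very
         integral of h^q that is being estimated. *)
      have <- : ((q - 1) * (1 + b) = q * (1 - s^-1))%R.
        by rewrite /s /b; field; rewrite !gt_eqF.
      rewrite poweRrM; apply: lee_poweR => //; first exact: ltW.
      by rewrite /g -[leRHS]mule1 lee_wpmul2l ?poweR_ge0 ?cut0_le1.
    rewrite -/Z lee_wpmul2r ?poweR_ge0// -poweR_EFin lee_poweR//.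
      by rewrite invr_ge0 ltW.
    by ege0.
  have {}Z1 : Z <= (fine F `^ p^-1 * D `^ (1 + b)^-1)%:E * Z `^ (1 - q^-1).
    apply: (le_trans Z1).
    have -> : F = (fine F)%:E by rewrite fineK// ge0_fin_numE.
    rewrite poweR_EFin EFinM -muleA lee_wpmul2l ?lee_fin ?powR_ge0//.
    have bi0 : (0 <= (1 + b)^-1)%R by rewrite invr_ge0 ltW.
    apply: le_trans (lee_poweR bi0 E0 E1) _.
    rewrite poweRM ?poweR_ge0 ?lee_fin// poweR_EFin -poweRrM.
    have -> // : ((1 - s^-1) / (1 + b) = 1 - q^-1)%R.
    by rewrite /s /b; field; rewrite !gt_eqF//= subrK.
  have qi1 : (0 <= 1 - q^-1 < 1)%R.
    by rewrite subr_ge0 invf_le1// q1/= ltrBlDr ltrDl invr_gt0.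
  have := absorb_poweR _ qi1 Z0 Zoo Z1; rewrite subKr invrK => /(_ _)/wrap[|].
    by rewrite mulr_ge0 ?powR_ge0.
  move=> /le_trans; apply.
  rewrite powRM ?powR_ge0// -!powRrM mulrC EFinM.
  have -> : \int[sigma]_x (f x `^ p) = (fine F)%:E by rewrite fineK// ge0_fin_numE.
  by rewrite poweR_EFin ![(q / _)%R]mulrC.
- by move=> x; have [+ _ _] := suplim_poweR q0 (TT0 x) (hs x); exact.
- by move=> x; have [_ _] := suplim_poweR q0 (TT0 x) (hs x); exact.
Qed.

End Trace.

(** * Balls, cubes and doubling *)

Section Euclidean.
Context {R : realType} {n : nat}.
Implicit Types (x y z : 'rV[R]_n) (r : R).

(** Balls of the sup norm are described coordinate by coordinate and fit the cubes; they differ from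
    Euclidean balls by a factor of at most n in the radius. *)
Definition cball x r : set 'rV[R]_n :=
  [set y | forall i, (`|y ord0 i - x ord0 i| < r)%R].

Lemma measurable_open (U : set 'rV[R]_n) : open U -> measurable U.
Proof. by move=> oU; exact: sub_sigma_algebra. Qed.

Lemma measurable_coord (i : 'I_n) :
  measurable_fun setT (fun x : 'rV[R]_n => x ord0 i).
Proof.
apply: (measurability _ (RGenOpens.measurableE R)) => _ [_ [a [b ->]] <-].
rewrite setTI; apply: measurable_open.
apply: open_comp; last exact: interval_open.
by move=> x _; exact: coord_continuous.
Qed.

Lemma enorm_lt x r : (0 < r)%R ->
  (enorm x < r)%R = (\sum_(i < n) (x ord0 i) ^+ 2 < r ^+ 2)%R.
Proof.
move=> r0; rewrite /enorm -[X in (_ < X)%R](gtr0_norm r0) -sqrtr_sqr.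
by rewrite ltr_sqrt// exprn_gt0.
Qed.

Lemma enorm_ge0 x : (0 <= enorm x)%R.
Proof. exact: sqrtr_ge0. Qed.

Lemma measurable_eball x r : measurable (eball x r).
Proof.
have [r0|r0] := leP r 0%R.
  rewrite (_ : eball x r = set0)//; apply/seteqP; split => // y.
  by rewrite /eball/= ltNge (le_trans r0 (enorm_ge0 _)).
rewrite (_ : eball x r = setT `&` (fun y : 'rV[R]_n =>
    \sum_(i < n) (y ord0 i - x ord0 i) ^+ 2)%R @^-1` `]-oo, (r ^+ 2)%R[%classic).
  suff : measurable_fun setT (fun y : 'rV[R]_n =>
      \sum_(i < n) (y ord0 i - x ord0 i) ^+ 2)%R.
    by apply => //; exact: measurable_itv.
  apply: measurable_sum => i; apply: measurable_funX.
  by apply: measurable_funB => //; exact: measurable_coord.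
rewrite setTI; apply/seteqP; split => y; rewrite /eball/= in_itv/= enorm_lt//.
  by congr (_ < _)%R; apply: eq_bigr => i _; rewrite !mxE.
by congr (_ < _)%R; apply: eq_bigr => i _; rewrite !mxE.
Qed.

Lemma cballE x r : cball x r =
  \bigcap_(i in [set: 'I_n]) [set y : 'rV[R]_n | (`|y ord0 i - x ord0 i| < r)%R].
Proof. by apply/seteqP; split => y /= h i; [move=> _|]; exact: h. Qed.

Lemma measurable_cball x r : measurable (cball x r).
Proof.
rewrite cballE; apply: fin_bigcap_measurable => [|i _]; first exact: finite_finset.
rewrite (_ : [set y | _] =
  setT `&` (fun y : 'rV[R]_n => `|y ord0 i - x ord0 i|%R) @^-1` `]-oo, r[%classic).
  suff : measurable_fun setT (fun y : 'rV[R]_n => `|y ord0 i - x ord0 i|%R).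
    by apply => //; exact: measurable_itv.
  apply: measurableT_comp => //.
  by apply: measurable_funB => //; exact: measurable_coord.
by rewrite setTI; apply/seteqP; split => y; rewrite /= in_itv.
Qed.

Lemma coord_le_enorm x i : (`|x ord0 i| <= enorm x)%R.
Proof.
rewrite /enorm -sqrtr_sqr ler_sqrt; last by apply: sumr_ge0 => j _; exact: sqr_ge0.
by rewrite (bigD1 i)//= lerDl; apply: sumr_ge0 => j _; exact: sqr_ge0.
Qed.

Lemma enorm_le_sum x : (enorm x <= \sum_(i < n) `|x ord0 i|)%R.
Proof.
have s0 : (0 <= \sum_(i < n) `|x ord0 i|)%R by apply: sumr_ge0.
rewrite /enorm -[leRHS]ger0_norm// -sqrtr_sqr ler_sqrt ?sqr_ge0//.
rewrite expr2 mulr_suml; apply: ler_sum => i _.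
rewrite -real_normK ?num_real// expr2 ler_wpM2l//.
by rewrite (bigD1 i)//= lerDl; apply: sumr_ge0.
Qed.

Lemma eball_cball x r : eball x r `<=` cball x r.
Proof.
move=> y yx i; apply: le_lt_trans yx.
by have := coord_le_enorm (y - x) i; rewrite !mxE.
Qed.

Lemma cball_eball x r : (0 < n)%N -> cball x r `<=` eball x (n%:R * r).
Proof.
move=> n0 y yx; apply: le_lt_trans (enorm_le_sum _) _.
have -> : (n%:R * r = \sum_(i < n) r)%R by rewrite sumr_const card_ord mulr_natl.
apply: ltr_sum; last by move=> i _; rewrite !mxE.
by apply/hasP; exists (Ordinal n0) => //; rewrite mem_index_enum.
Qed.

Lemma cball_le x r r' : (r <= r')%R -> cball x r `<=` cball x r'.
Proof. by move=> rr' y yx i; exact: lt_le_trans (yx i) rr'. Qed.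

Lemma eball_le x r r' : (r <= r')%R -> eball x r `<=` eball x r'.
Proof. by move=> rr' y; rewrite /eball/= => /lt_le_trans; apply. Qed.

Lemma cball_trans x y r r' : cball x r y -> cball y r' `<=` cball x (r + r').
Proof.
move=> yx u uy i; rewrite (_ : u ord0 i - x ord0 i =
  (y ord0 i - x ord0 i) + (u ord0 i - y ord0 i))%R; last by ring.
by apply: le_lt_trans (ler_normD _ _) _; rewrite ltrD.
Qed.

Lemma cball_center x r : (0 < r)%R -> cball x r x.
Proof. by move=> r0 i; rewrite subrr normr0. Qed.

(** The closed box is compact, so finitely many neighbourhoods of finite measure cover it. *)
Lemma locally_finite_cball (mu : {measure set 'rV[R]_n -> \bar R}) :
  locally_finite mu -> forall x r, mu (cball x r) < +oo.
Proof.
move=> lf x r.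
pose KK : set 'rV[R]_n := [set v | forall i, `[(x ord0 i - r)%R, (x ord0 i + r)%R]%classic (v ord0 i)].
have cK : compact KK.
  by apply: (@rV_compact R n (fun i => `[(x ord0 i - r)%R, (x ord0 i + r)%R]%classic)) => i; exact: segment_compact.
have [U HU] := choice lf.
move: cK; rewrite compact_cover => /(_ _ setT U).
case=> [y _|y _|D _ KD]; [by have [] := HU y|by exists y => //; have [] := HU y|].
pose s := finmap.enum_fset D.
have mU y : measurable (U y) by apply: measurable_open; have [] := HU y.
have h1 : mu (cball x r) <= mu (\big[setU/set0]_(y <- s) U y).
  apply: le_measure; rewrite ?inE.
  - exact: measurable_cball.
  - exact: bigsetU_measurable.
  move=> v vx; have : KK v.
    move=> i; rewrite /= in_itv/=; have := ltW (vx i).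
    by rewrite ler_distl.
  by move=> /KD [y /= yD Uy]; rewrite -bigcup_seq; exists y.
apply: (le_lt_trans h1); apply: (@le_lt_trans _ _ (\sum_(y <- s) mu (U y))).
  elim: s {h1} => [|y s IH]; first by rewrite !big_nil measure0.
  rewrite !big_cons; apply: le_trans (measureU2 _ _ _) _ => //.
    exact: bigsetU_measurable.
  by rewrite leeD2l.
by apply: lte_sum_pinfty => y _; have [] := HU y.
Qed.

End Euclidean.

Section Doubling.
Context {R : realType} {n : nat} (n_gt0 : (0 < n)%N).
Variable sigma : {measure set 'rV[R]_n -> \bar R}.
Hypothesis sigma_lf : locally_finite sigma.
Hypothesis sigma_dbl : doubling sigma.
Implicit Types (x y z : 'rV[R]_n) (r : R).

Lemma doubling_pow : exists2 C : R, (0 < C)%R & forall (a : nat) x r, (0 < r)%R ->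
  sigma (eball x (2 ^+ a * r)) <= (C ^+ a)%:E * sigma (eball x r).
Proof.
have [_ [C0 HC]] := sigma_dbl.
pose C := Num.max C0 1%R.
have C1 : (0 < C)%R by rewrite lt_max ltr01 orbT.
exists C => //; elim=> [|a IH] x r r0; first by rewrite !expr0 mul1r mul1e.
rewrite exprS -mulrA; apply: le_trans (HC _ _ _) _; first by rewrite mulr_gt0// exprn_gt0.
rewrite exprS EFinM -muleA; apply: (@le_trans _ _ (C%:E * sigma (eball x (2 ^+ a * r)))).
  by rewrite lee_wpmul2r// lee_fin le_max lexx.
by rewrite lee_wpmul2l ?lee_fin ?(ltW C1)//; exact: IH.
Qed.

Lemma nat_le_exp2 (a : nat) : (a%:R <= 2 ^+ a :> R)%R.
Proof. by rewrite -natrX ler_nat ltnW// ltn_expl. Qed.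

(** All comparisons of [sigma] on cubes, balls and annuli reduce to this form: a set inside a large
    box against a set containing a concentric small one. Passing between boxes and Euclidean balls
    costs a factor n <= 2^n, whence the exponent n + a. *)
Lemma doubling_comp (a : nat) : exists2 C : R, (0 < C)%R &
  forall y r (U V : set 'rV[R]_n), (0 < r)%R -> measurable U -> measurable V ->
  U `<=` cball y (2 ^+ a * r) -> cball y r `<=` V -> sigma U <= C%:E * sigma V.
Proof.
have [C C0 HC] := doubling_pow; exists (C ^+ (n + a))%R; first exact: exprn_gt0.
move=> y r U V r0 mU mV Uy yV.
have mE := @measurable_eball R n.
apply: (@le_trans _ _ (sigma (eball y (2 ^+ (n + a) * r)))).
  apply: le_measure; rewrite ?inE//.
  apply: subset_trans Uy _; apply: subset_trans (cball_eball n_gt0) _.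
  apply: eball_le; rewrite exprD -mulrA ler_wpM2r ?nat_le_exp2//.
  by rewrite mulr_ge0 ?exprn_ge0// ltW.
apply: le_trans (HC _ _ _ r0) _.
rewrite lee_wpmul2l ?lee_fin ?exprn_ge0 ?(ltW C0)//; apply: le_measure; rewrite ?inE//.
exact: subset_trans (@eball_cball _ _ _ _) yV.
Qed.

Lemma sigma_cball_lty x r : sigma (cball x r) < +oo.
Proof. exact: locally_finite_cball. Qed.

(** If one box were null, doubling would make all its dilates null, and these exhaust the space
    although [sigma] is not zero. Positivity on cubes, hence the meaning of averages over them,
    follows. *)
Lemma sigma_cball_gt0 x r : (0 < r)%R -> 0 < sigma (cball x r).
Proof.
move=> r0; rewrite lt0e measure_ge0 andbT; apply/eqP => s0.
have [sT _] := sigma_dbl; move/eqP : sT; apply.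
have s0a (a : nat) : sigma (cball x (2 ^+ a * r)) = 0.
  have [C C0 HC] := doubling_comp a.
  apply/eqP; rewrite eq_le measure_ge0 andbT.
  have := HC x r (cball x (2 ^+ a * r)) (cball x r) r0.
  by rewrite s0 mule0; apply => //; exact: measurable_cball.
rewrite (_ : setT = \bigcup_a cball x (2 ^+ a * r)).
  apply/eqP; rewrite eq_le measure_ge0 andbT.
  apply: le_trans (measure_sigma_subadditive _ _ _ (@subset_refl _ _)) _.
  - by move=> a; exact: measurable_cball.
  - by apply: bigcup_measurable => a _; exact: measurable_cball.
  by rewrite eseries0// => a _ _; rewrite s0a.
apply/seteqP; split => // y _.
pose S := (\sum_(i < n) `|y ord0 i - x ord0 i|)%R.
exists (Num.truncn (S / r)).+1 => // i.
apply: (@le_lt_trans _ _ S); first by rewrite /S (bigD1 i)//= lerDl sumr_ge0.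
rewrite -ltr_pdivrMr//; apply: lt_le_trans (truncnS_gt _) _.
exact: nat_le_exp2.
Qed.

End Doubling.

(** * Dyadic lattices and the one-third trick *)

Section Cubes.
Context {R : realType} {n : nat}.
Implicit Types (x y z : 'rV[R]_n) (r : R) (j N : int).

Lemma two_gt0 j : (0 < 2 ^ j :> R)%R.
Proof. exact: exprz_gt0. Qed.

Lemma twoD j (l : int) : (2 ^ (j + l) = 2 ^ j * 2 ^ l :> R)%R.
Proof. by rewrite expfzDr// pnatr_eq0. Qed.

Definition cube_lab z j x : 'rV[int]_n :=
  \row_i Num.floor ((x ord0 i - z ord0 i) / 2 ^ j)%R.

Lemma cubeP z j (m : 'rV[int]_n) x : cube z (j, m) x <-> cube_lab z j x = m.
Proof.
have j0 := two_gt0 j; split => [h|<- i].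
  apply/rowP => i; rewrite mxE; apply: floor_def.
  have /andP[h1 h2] := h i; rewrite /side/= in h1 h2.
  by rewrite ler_pdivlMr// h1 ltr_pdivrMr.
rewrite mxE /side/=.
have /andP[h1 h2] := floor_itv ((x ord0 i - z ord0 i) / 2 ^ j)%R.
by rewrite -ler_pdivlMr// h1 -ltr_pdivrMr.
Qed.

Definition Qof z j x : set 'rV[R]_n := cube z (j, cube_lab z j x).

Lemma QofP z j x y : Qof z j x y <-> cube_lab z j y = cube_lab z j x.
Proof. exact: cubeP. Qed.

Lemma Qof_refl z j x : Qof z j x x.
Proof. exact/QofP. Qed.

Lemma Qof_eq z j x y : Qof z j x y -> Qof z j y = Qof z j x.
Proof. by move=> /QofP e; rewrite /Qof e. Qed.

Lemma floor_half (u v : R) : Num.floor u = Num.floor v ->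
  Num.floor (u / 2)%R = Num.floor (v / 2)%R.
Proof.
suff h (w : R) : Num.floor (w / 2)%R = (Num.floor w %/ 2)%Z by move=> e; rewrite !h e.
apply: floor_def; have /andP[h1 h2] := floor_itv w.
set f := Num.floor w in h1 h2 *.
have e1 : ((f %/ 2)%Z * 2 <= f)%R by lia.
have e2 : (f + 1 <= ((f %/ 2)%Z + 1) * 2)%R by lia.
rewrite ler_pdivlMr// ltr_pdivrMr//; apply/andP; split.
  by apply: le_trans h1; rewrite (_ : 2 = 2%:~R :> R)%R// -intrM ler_int.
by apply: (lt_le_trans h2); rewrite (_ : 2 = 2%:~R :> R)%R// -intrM ler_int.
Qed.

Lemma cube_lab_coarse z j x y : cube_lab z j x = cube_lab z j y -> cube_lab z (j + 1) x = cube_lab z (j + 1) y.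
Proof.
move=> h; apply/rowP => i; move: h => /rowP/(_ i); rewrite !mxE => /floor_half.
by rewrite twoD expr1z invfM !mulrA.
Qed.

(** Generation i consists of the cubes of side 2^(N-i), where N is an artificial top scale. The
    corner is encoded by [pickle] because the cells of a filtration are labelled by natural
    numbers. *)
Definition gen_lab z N (i : nat) x : nat := pickle (cube_lab z (N - i%:Z) x).

Lemma gen_labP z N (i : nat) x y :
  gen_lab z N i x = gen_lab z N i y <-> cube_lab z (N - i%:Z) x = cube_lab z (N - i%:Z) y.
Proof.
split => [|e]; last by rewrite /gen_lab e.
by move=> /(congr1 (@unpickle 'rV[int]_n)); rewrite !pickleK => -[].
Qed.

Lemma measurable_cube z (Q : dyadic_index (n := n)) : measurable (cube z Q : set 'rV[R]_n).
Proof.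
rewrite (_ : cube z Q = \bigcap_(i in [set: 'I_n]) [set x : 'rV[R]_n |
    ((Q.2 ord0 i)%:~R * side Q <= x ord0 i - z ord0 i
                       < (Q.2 ord0 i + 1)%:~R * side Q)%R]); last first.
  by apply/seteqP; split => y /= h i; [move=> _|]; exact: h.
apply: fin_bigcap_measurable => [|i _]; first exact: finite_finset.
rewrite (_ : [set x | _] = setT `&` (fun y : 'rV[R]_n => y ord0 i - z ord0 i)%R @^-1`
    `[((Q.2 ord0 i)%:~R * side Q)%R, ((Q.2 ord0 i + 1)%:~R * side Q)%R[%classic).
  suff : measurable_fun setT (fun y : 'rV[R]_n => y ord0 i - z ord0 i)%R.
    by apply => //; exact: measurable_itv.
  by apply: measurable_funB => //; exact: measurable_coord.
by rewrite setTI; apply/seteqP; split => y; rewrite /= in_itv.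
Qed.

Lemma measurable_Qof z j x : measurable (Qof z j x).
Proof. exact: measurable_cube. Qed.

Lemma gen_lab_filtration z N : filtration (gen_lab z N).
Proof.
split => [i k|i x y /gen_labP h].
  have [[m mk]|nk] := pselect (exists m : 'rV[int]_n, pickle m = k).
    rewrite (_ : [set x | _] = cube z ((N - i%:Z)%R, m)); first exact: measurable_cube.
    apply/seteqP; split => x /=.
      rewrite -mk => /(congr1 (@unpickle 'rV[int]_n)); rewrite !pickleK => -[].
      by move=> /cubeP.
    by move=> /cubeP e; rewrite /gen_lab e.
  rewrite (_ : [set x | _] = set0)//; apply/seteqP; split => // x /= xk.
  by apply: nk; exists (cube_lab z (N - i%:Z) x).
apply/gen_labP; have -> : (N - i%:Z = (N - i.+1%:Z) + 1)%R by lia.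
exact: cube_lab_coarse.
Qed.

Lemma cell_gen_lab z N (i : nat) x : cell (gen_lab z N) i x = Qof z (N - i%:Z) x.
Proof.
by apply/seteqP; split => y; [move=> /gen_labP/QofP|move=> /QofP e; exact/gen_labP].
Qed.

Lemma Qof_sub_cball z j x : Qof z j x `<=` cball x (2 ^ j).
Proof.
move=> y yx i; have j0 := two_gt0 j.
have /andP[h1 h2] := yx i; have /andP[h3 h4] := Qof_refl z j x i.
rewrite /side/= in h1 h2 h3 h4; rewrite intrD mulrDl mul1r in h2 h4.
rewrite ltr_norml; apply/andP; split; lra.
Qed.

Definition center z j x : 'rV[R]_n :=
  \row_i (z ord0 i + ((cube_lab z j x ord0 i)%:~R + 2^-1) * 2 ^ j)%R.

Lemma center_sub z j x : cball (center z j x) (2 ^ (j - 1)) `<=` Qof z j x.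
Proof.
move=> y yc i; have j0 := two_gt0 j; rewrite /side/=.
have := yc i; rewrite [center z j x ord0 i]mxE.
rewrite twoD (_ : (2 ^ (- 1) = 2^-1 :> R)%R)// ltr_norml => /andP[h1 h2].
rewrite intrD mulrDl mul1r; rewrite mulrDl in h1 h2.
by apply/andP; split; lra.
Qed.

Lemma sub_center z j x : Qof z j x `<=` cball (center z j x) (2 ^ j).
Proof.
move=> y yx i; have j0 := two_gt0 j; rewrite [center z j x ord0 i]mxE.
have /andP[h1 h2] := yx i; rewrite /side/= in h1 h2.
rewrite intrD mulrDl mul1r in h2.
rewrite ltr_norml mulrDl; apply/andP; split; lra.
Qed.

(* The lattices of the one-third trick: since 3 does not divide [2 ^ M], a coordinate
   cannot be within [2 ^ j / 6] of both [2 ^ j Z] and [2 ^ N / 3 + 2 ^ j Z], [j <= N]. *)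
Definition zshift N (t : {ffun 'I_n -> bool}) : 'rV[R]_n :=
  \row_i (if t i then 2 ^ N / 3 else 0)%R.

Lemma near_integer (u v : R) : (`|v - u| < 6^-1)%R -> Num.floor v != Num.floor u ->
  exists a : int, (`|u - a%:~R| < 6^-1)%R.
Proof.
have /andP[h1 h2] := floor_itv u; have /andP[h3 h4] := floor_itv v.
rewrite ltr_norml => /andP[h5 h6]; rewrite neq_lt => /orP[vu|uv].
  exists (Num.floor u); have : (Num.floor v + 1 <= Num.floor u)%R by lia.
  rewrite -(ler_int R) => h; rewrite ltr_norml; apply/andP; split; lra.
exists (Num.floor v); have : (Num.floor u + 1 <= Num.floor v)%R by lia.
rewrite -(ler_int R) => h; rewrite ltr_norml; apply/andP; split; lra.
Qed.

Lemma exp2_third (M : nat) (a : int) : (3 * a)%R != (2 ^+ M)%R.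
Proof.
apply/eqP => h.
have : (3 %| 2 ^ M)%N.
  have := congr1 absz h; rewrite abszM abszX /= => <-.
  exact: dvdn_mulr.
by rewrite Euclid_dvdX// => /andP[].
Qed.

Lemma third_trick N j x : (j <= N)%R ->
  exists t, cball x (2 ^ j / 6) `<=` Qof (zshift N t) j x.
Proof.
move=> jN; have j0 := two_gt0 j; have N0 := two_gt0 N.
pose M := `|(N - j)%R|%N.
have eM : (2 ^ N = 2 ^ j * 2 ^+ M :> R)%R.
  have -> : N = (j + M%:Z)%R by rewrite /M; lia.
  by rewrite twoD.
pose stable (e : R) i := forall v : R, (`|v - x ord0 i| < 2 ^ j / 6)%R ->
  Num.floor ((v - e) / 2 ^ j)%R = Num.floor ((x ord0 i - e) / 2 ^ j)%R.
have unst e i : ~ stable e i ->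
    exists a : int, (`|(x ord0 i - e) / 2 ^ j - a%:~R| < 6^-1)%R.
  move=> /existsNP[v /not_implyP[vx /eqP]]; apply: near_integer.
  rewrite -mulrBl opprB addrA subrK normrM (gtr0_norm (_ : 0 < (2 ^ j)^-1)%R) ?invr_gt0//.
  by rewrite ltr_pdivrMr// mulrC.
have dich i : stable 0%R i \/ stable (2 ^ N / 3)%R i.
  apply: contrapT => /not_orP[/unst[a ha] /unst[b hb]].
  have e1 : ((x ord0 i - 2 ^ N / 3) / 2 ^ j = (x ord0 i - 0) / 2 ^ j - 2 ^+ M / 3)%R.
    by rewrite subr0 mulrBl eM; congr (_ - _)%R; field; rewrite gt_eqF.
  move: ha hb; rewrite e1; set w := ((x ord0 i - 0) / 2 ^ j)%R.
  rewrite !ltr_norml => /andP[a1 a2] /andP[b1 b2].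
  (* If both shifts fail in coordinate i, then w and w - 2^M / 3 are within 1/6 of the integers a
     and b. So 2^M / 3 is within 1/3 of a - b, and the integer W has absolute value below 1. *)
  pose W := (2 ^+ M - 3 * (a - b) : int)%R.
  have WE : (W%:~R = 2 ^+ M - 3 * (a%:~R - b%:~R) :> R)%R.
    by rewrite /W intrB intrM intrB rmorphXn.
  have W1 : (W < 1)%R by rewrite -(ltr_int R) WE; lra.
  have W2 : (- 1 < W)%R by rewrite -(ltr_int R) WE mulrNz; lra.
  have /eqP : (3 * (a - b) = 2 ^+ M :> int)%R.
    by have : W = 0%R by [lia]; rewrite /W => /eqP; rewrite subr_eq0 => /eqP.
  by apply/negP; exact: exp2_third.
exists [ffun i => ~~ `[< stable 0%R i >]] => y yx.
apply/QofP/rowP => i; rewrite !mxE ffunE.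
case: asboolP => [h|h] /=; first by apply: h; exact: yx.
by case: (dich i) => // h'; apply: h'; exact: yx.
Qed.

End Cubes.

Section DoublingCubes.
Context {R : realType} {n : nat} (n_gt0 : (0 < n)%N).
Variable sigma : {measure set 'rV[R]_n -> \bar R}.
Hypothesis sigma_lf : locally_finite sigma.
Hypothesis sigma_dbl : doubling sigma.
Implicit Types (x y z : 'rV[R]_n) (r : R) (j N : int).

Lemma sigma_Qof_gt0 z j x : 0 < sigma (Qof z j x).
Proof.
apply: lt_le_trans (sigma_cball_gt0 n_gt0 sigma_dbl (center z j x) (two_gt0 (j - 1))) _.
apply: le_measure; rewrite ?inE; [exact: measurable_cball|exact: measurable_Qof|].
exact: center_sub.
Qed.

Lemma locally_finite_Qof (mu : {measure set 'rV[R]_n -> \bar R}) z j x :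
  locally_finite mu -> mu (Qof z j x) < +oo.
Proof.
move=> lf; apply: le_lt_trans (locally_finite_cball lf x (2 ^ j)).
apply: le_measure; rewrite ?inE; [exact: measurable_Qof|exact: measurable_cball|].
exact: Qof_sub_cball.
Qed.

Lemma cube_le_ball (a : nat) : exists2 C : R, (0 < C)%R &
  forall z j x r, (2 ^ j <= 2 ^+ a * r)%R ->
  sigma (Qof z j x) <= C%:E * sigma (eball x r).
Proof.
have [C C0 HC] := doubling_comp n_gt0 sigma_dbl (a + n).
exists C => // z j x r jr; have j0 := two_gt0 (R := R) j.
have r0 : (0 < r)%R.
  by rewrite -(@pmulr_rgt0 _ (2 ^+ a)) ?exprn_gt0// (lt_le_trans j0).
have p0 : (0 < 2 ^+ n :> R)%R by exact: exprn_gt0.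
apply: (HC x (r / 2 ^+ n)%R); rewrite ?divr_gt0//.
- exact: measurable_Qof.
- exact: measurable_eball.
- apply: subset_trans (@Qof_sub_cball _ _ _ _ _) _; apply: cball_le.
  by rewrite exprD mulrACA divff ?gt_eqF// mulr1.
- apply: subset_trans (cball_eball n_gt0) _; apply: eball_le.
  rewrite mulrA ler_pdivrMr// mulrC ler_wpM2l ?(ltW r0)//.
  exact: nat_le_exp2.
Qed.

Lemma cball_le_cube (a : nat) : exists2 C : R, (0 < C)%R &
  forall z j x r, (r <= 2 ^+ a * 2 ^ j)%R ->
  sigma (cball x r) <= C%:E * sigma (Qof z j x).
Proof.
have [C C0 HC] := doubling_comp n_gt0 sigma_dbl a.+2.
exists C => // z j x r rj; have j0 := two_gt0 (R := R) j.
apply: (HC (center z j x) (2 ^ (j - 1))%R); rewrite ?two_gt0//.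
- exact: measurable_cball.
- exact: measurable_Qof.
- apply: subset_trans (cball_trans (sub_center (Qof_refl z j x))) _; apply: cball_le.
  have a1 : (1 <= 2 ^+ a :> R)%R by rewrite exprn_ege1// ler1n.
  rewrite twoD (_ : (2 ^ (- 1) = 2^-1 :> R)%R)// !exprS.
  nra.
- exact: center_sub.
Qed.

Lemma ball_le_cube (a : nat) : exists2 C : R, (0 < C)%R &
  forall z j x r, (r <= 2 ^+ a * 2 ^ j)%R ->
  sigma (eball x r) <= C%:E * sigma (Qof z j x).
Proof.
have [C C0 HC] := cball_le_cube a; exists C => // z j x r rj.
apply: le_trans (HC z j x r rj); apply: le_measure; rewrite ?inE.
- exact: measurable_eball.
- exact: measurable_cball.
- exact: eball_cball.
Qed.

(* An annulus contains the sup-ball of radius [r 2^-(n+4)] around [x + 3/4 r e_0]. *)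
Lemma cube_le_annulus (a : nat) : exists2 C : R, (0 < C)%R &
  forall z j x r, (2 ^ j <= 2 ^+ a * r)%R ->
  sigma (Qof z j x) <= C%:E * sigma (eball x r `\` eball x (r / 2)).
Proof.
have [C C0 HC] := doubling_comp n_gt0 sigma_dbl (a + (n + 4)).+1.
exists C => // z j x r jr; have j0 := two_gt0 (R := R) j.
have a0 : (0 < 2 ^+ a :> R)%R by exact: exprn_gt0.
have r0 : (0 < r)%R.
  by rewrite -(@pmulr_rgt0 _ (2 ^+ a))// (lt_le_trans j0).
have p0 : (0 < 2 ^+ (n + 4) :> R)%R by exact: exprn_gt0.
pose i0 := Ordinal n_gt0.
pose y : 'rV[R]_n := \row_i (x ord0 i + (if i == i0 then 3 / 4 * r else 0))%R.
have dd : (2 ^+ (n + 4) = 16 * 2 ^+ n :> R)%R by rewrite exprD mulrC; congr (_ * _)%R; ring.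
have n1 : (1 <= 2 ^+ n :> R)%R by rewrite exprn_ege1// ler1n.
have del : (0 < r / 2 ^+ (n + 4))%R by rewrite divr_gt0.
have del1 : (n%:R * (r / 2 ^+ (n + 4)) <= r / 16)%R.
  have en : (r / 2 ^+ (n + 4) * 2 ^+ n = r / 16)%R by rewrite dd; field; rewrite gt_eqF// (lt_le_trans _ n1).
  by rewrite -en mulrC ler_wpM2l ?(ltW del)// nat_le_exp2.
have del2 : (r / 2 ^+ (n + 4) <= r / 16)%R.
  by apply: le_trans del1; rewrite ler_peMl ?(ltW del)// ler1n.
apply: (HC y (r / 2 ^+ (n + 4))%R) => //.
- exact: measurable_Qof.
- by apply: measurableD; exact: measurable_eball.
- have yx : cball y r x.
    move=> i; rewrite mxE opprD addrA subrr sub0r normrN; case: ifP => _.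
      by rewrite gtr0_norm; lra.
    by rewrite normr0.
  apply: subset_trans (@Qof_sub_cball _ _ _ _ _) _.
  apply: subset_trans (cball_trans yx) _; apply: cball_le.
  rewrite exprS exprD.
  have -> : (2 * (2 ^+ a * 2 ^+ (n + 4)) * (r / 2 ^+ (n + 4)) = 2 ^+ a * r + 2 ^+ a * r)%R.
    by field; rewrite gt_eqF.
  rewrite addrC lerD//.
  by rewrite ler_peMl ?(ltW r0)// exprn_ege1// ler1n.
move=> v vy; split; rewrite /eball /=; last first.
  apply/negP; rewrite -leNgt; apply: le_trans (coord_le_enorm (v - x) i0).
  have := vy i0; rewrite !mxE eqxx ltr_norml => /andP[h _].
  rewrite ger0_norm; lra.
apply: le_lt_trans (enorm_le_sum _) _.
apply: (@le_lt_trans _ _ (\sum_(i < n) (r / 2 ^+ (n + 4) + (if i == i0 then 3 / 4 * r else 0)))%R).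
  apply: ler_sum => i _; rewrite !mxE.
  have := vy i; rewrite mxE => h.
  have -> : (v ord0 i - x ord0 i = (v ord0 i - (x ord0 i + (if i == i0 then 3 / 4 * r else 0)))
    + (if i == i0 then 3 / 4 * r else 0))%R by ring.
  apply: le_trans (ler_normD _ _) _; apply: lerD; first exact: ltW.
  by case: ifP => _; rewrite ?normr0// gtr0_norm//; lra.
rewrite big_split/= sumr_const card_ord -[((r / _) *+ n)%R]mulr_natl -big_mkcond/= big_pred1_eq.
lra.
Qed.

End DoublingCubes.

(** * The continuous and dyadic Wolff potentials *)

Section Step.
Context {R : realType}.
Implicit Types (j N : int) (l : R) (a : int -> \bar R).

Lemma two_le j j' : (2 ^ j <= 2 ^ j' :> R)%R = (j <= j')%R.
Proof. by rewrite ler_eXz2l// ltr1n. Qed.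

Lemma two_lt j j' : (2 ^ j < 2 ^ j' :> R)%R = (j < j')%R.
Proof. by rewrite ltr_eXz2l// ltr1n. Qed.

Definition dyint j : set R := `[(2 ^ (j - 1))%R, (2 ^ j)%R[%classic.

Lemma dyintE j l : dyint j l = ((2 ^ (j - 1) <= l) /\ (l < 2 ^ j))%R :> Prop.
Proof. by rewrite /dyint/= in_itv/=; apply/propext; split => [/andP|[-> ->]]. Qed.

Lemma dyint_uniq j j' l : dyint j l -> dyint j' l -> j = j'.
Proof.
rewrite !dyintE => -[h1 h2] [h3 h4].
have : (j - 1 < j')%R by rewrite -two_lt (le_lt_trans h1).
have : (j' - 1 < j)%R by rewrite -two_lt (le_lt_trans h3).
by lia.
Qed.

Lemma dyint_gt0 j l : dyint j l -> (0 < l)%R.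
Proof. by rewrite dyintE => -[h _]; apply: lt_le_trans h; exact: two_gt0. Qed.

Lemma two_unbounded l : exists m : nat, (l < 2 ^+ m)%R.
Proof.
exists (Num.truncn l).+1; apply: lt_le_trans (truncnS_gt _) _.
exact: nat_le_exp2.
Qed.

Lemma dyint_cover l : (0 < l)%R -> exists j, dyint j l.
Proof.
move=> l0; have [b hb] := two_unbounded l^-1.
have hb' : (2 ^ (- b%:Z) < l :> R)%R.
  have -> : (2 ^ (- b%:Z) = (2 ^+ b)^-1 :> R)%R by rewrite -exprz_inv -exprVn.
  by rewrite -[ltRHS]invrK ltf_pV2// posrE ?invr_gt0// exprn_gt0.
have [m0 hm0] := two_unbounded l.
have ex : exists m : nat, (l < 2 ^ (m%:Z - b%:Z))%R.
  exists (m0 + b)%N; rewrite (_ : _ - _ = m0%:Z)%R//; lia.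
case: (ex_minnP ex) => m lm mmin.
exists (m%:Z - b%:Z)%R; rewrite dyintE; split => //.
have m_gt0 : (0 < m)%N.
  by rewrite lt0n; apply/eqP => m0'; move: lm; rewrite m0' sub0r ltNge (ltW hb').
rewrite leNgt; apply/negP => h; have := mmin m.-1.
rewrite (_ : m.-1%:Z - b%:Z = m%:Z - b%:Z - 1)%R; last by lia.
by move=> /(_ h); lia.
Qed.

Lemma lebesgue_dyint j : lebesgue_measure (dyint j : set R) = (2 ^ (j - 1))%:E.
Proof.
rewrite lebesgue_measure_itv/= lte_fin two_lt (_ : (j - 1 < j)%R); last by lia.
rewrite -EFinB; congr (_%:E).
have -> : (2 ^ j = 2 ^ (j - 1) * 2 :> R)%R.
  by rewrite -[X in (_ * X)%R]expr1z -twoD; congr (_ ^ _)%R; lia.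
by lra.
Qed.

(** Step functions replace integrands in the radius, which are bounded on each dyadic interval by
    monotonicity. Only the step functions are integrated term by term, so only they have to be
    measurable. *)
Definition stepf N a l : \bar R :=
  \sum_(0 <= i <oo) (a (N - i%:Z)%R * (\1_(dyint (N - i%:Z)%R) l)%:E).

Lemma stepfE N a j l : (forall j, 0 <= a j) -> (j <= N)%R -> dyint j l ->
  stepf N a l = a j.
Proof.
move=> a0 jN jl; pose i0 := `|(N - j)%R|%N.
have e : j = (N - i0%:Z)%R by rewrite /i0; lia.
rewrite /stepf (@nneseriesD1 _ _ i0)//; last by move=> i _; rewrite mule_ge0.
rewrite -e indicE mem_set// mule1 eseries0 ?adde0// => i _ /andP[_ ii0].
rewrite indicE memNset ?mule0// => h; have := dyint_uniq jl h.
by move/eqP : ii0; lia.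
Qed.

Lemma stepf_ge0 N a l : (forall j, 0 <= a j) -> 0 <= stepf N a l.
Proof. by move=> a0; apply: nneseries_ge0 => i _ _; rewrite mule_ge0. Qed.

Lemma stepf_out N a l : (l <= 0)%R \/ (2 ^ N <= l)%R -> stepf N a l = 0.
Proof.
move=> out; apply: eseries0 => i _ _; rewrite indicE memNset ?mule0// => h.
case: out => [l0|Nl]; first by have := dyint_gt0 h; rewrite ltNge l0.
move: h; rewrite dyintE => -[_]; rewrite ltNge; apply/negP/negPn.
by apply: le_trans Nl; rewrite two_le; lia.
Qed.

Lemma measurable_stepf N a : (forall j, 0 <= a j) -> measurable_fun setT (stepf N a).
Proof.
move=> a0; apply: ge0_emeasurable_sum => [i l _ _|i _].
  by rewrite mule_ge0.
apply: emeasurable_funM; first exact: measurable_cst.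
by apply/measurable_EFinP; apply: measurable_indic; exact: measurable_itv.
Qed.

Lemma integral_stepf N a : (forall j, 0 <= a j) ->
  \int[lebesgue_measure]_l stepf N a l =
  \sum_(0 <= i <oo) (a (N - i%:Z)%R * (2 ^ (N - i%:Z - 1))%:E).
Proof.
move=> a0; have mi i : measurable (dyint i : set R) by exact: measurable_itv.
have mind i : measurable_fun setT (fun l : R => (\1_(dyint i : set R) l)%:E : \bar R).
  by apply/measurable_EFinP; apply: measurable_indic.
rewrite /stepf integral_nneseries//; first last.
- by move=> i l _; rewrite mule_ge0.
- by move=> i; apply: emeasurable_funM; [exact: measurable_cst|exact: mind].
apply: eq_eseriesr => i _; rewrite ge0_integralTZl//; last exact: mind.
congr (_ * _); rewrite -lebesgue_dyint -[in RHS](setIT (dyint _)).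
by rewrite (@integral_indic _ (measurableTypeR R) R lebesgue_measure setT measurableT (dyint (N - i%:Z)) (mi _)).
Qed.

Lemma integral_ge_step J (D : set R) (f : R -> \bar R) a :
  `]0%R, (2 ^ J)%R[%classic `<=` D -> (forall l, D l -> 0 <= f l) ->
  (forall j, 0 <= a j) -> (forall j l, (j <= J)%R -> dyint j l -> a j <= f l) ->
  \sum_(0 <= i <oo) (a (J - i%:Z)%R * (2 ^ (J - i%:Z - 1))%:E) <=
  \int[lebesgue_measure]_(l in D) f l.
Proof.
move=> JD f0 a0 af; rewrite -integral_stepf// [leRHS]integral_mkcond.
apply: le_integral_ge0 => l _; first exact: stepf_ge0.
have [l0|l0] := leP l 0%R.
  by rewrite stepf_out; [rewrite /patch; case: ifP => // /set_mem; exact: f0|left].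
have [lJ|lJ] := ltP l (2 ^ J)%R; last first.
  by rewrite stepf_out; [rewrite /patch; case: ifP => // /set_mem; exact: f0|right].
have [j jl] := dyint_cover l0.
have jJ : (j <= J)%R.
  have : (j - 1 < J)%R; last by lia.
  by rewrite -two_lt; move: jl; rewrite dyintE => -[h _]; exact: le_lt_trans h lJ.
rewrite (stepfE a0 jJ jl) /patch mem_set; first exact: af.
by apply: JD; rewrite /= in_itv/= l0.
Qed.

Lemma integral_le_step J (f : R -> \bar R) a :
  (forall l, (0 < l)%R -> 0 <= f l) ->
  (forall j, 0 <= a j) -> (forall j l, (j <= J)%R -> dyint j l -> f l <= a j) ->
  \int[lebesgue_measure]_(l in `]0%R, (2 ^ J)%R[) f l <=
  \sum_(0 <= i <oo) (a (J - i%:Z)%R * (2 ^ (J - i%:Z - 1))%:E).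
Proof.
move=> f0 a0 af; rewrite -integral_stepf// integral_mkcond.
apply: le_integral_ge0 => l _; rewrite /patch; case: ifPn => [/set_mem/=|_]; rewrite ?stepf_ge0//.
  by rewrite in_itv/= => /andP[l0 _]; exact: f0.
rewrite in_itv/= => /andP[l0 lJ].
have [j jl] := dyint_cover l0.
have jJ : (j <= J)%R.
  have : (j - 1 < J)%R; last by lia.
  by rewrite -two_lt; move: jl; rewrite dyintE => -[h _]; exact: le_lt_trans h lJ.
by rewrite (stepfE a0 jJ jl); exact: af.
Qed.

Lemma integral_le_steps (f : R -> \bar R) a (B : \bar R) :
  (forall l, (0 < l)%R -> 0 <= f l) ->
  (forall j, 0 <= a j) -> (forall j l, dyint j l -> f l <= a j) ->
  (forall N : nat, \sum_(0 <= i <oo) (a (N%:Z - i%:Z)%R * (2 ^ (N%:Z - i%:Z - 1))%:E) <= B) ->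
  \int[lebesgue_measure]_(l in `]0%R, +oo[) f l <= B.
Proof.
move=> f0 a0 af aB; rewrite integral_mkcond.
apply: (@integral_le_liminf _ (measurableTypeR R) R lebesgue_measure _ (fun N : nat => stepf N%:Z a)).
- by move=> N; exact: measurable_stepf.
- by move=> N l; exact: stepf_ge0.
- move=> l; rewrite /patch; case: ifPn => // /set_mem/=.
  by rewrite in_itv/= andbT; exact: f0.
- by move=> N; rewrite integral_stepf.
move=> l y; rewrite /patch; case: ifPn => [/set_mem/=|_ y0]; last first.
  by exists 0%N => N _; exact: le_trans (ltW y0) (stepf_ge0 _ _ a0).
rewrite in_itv/= andbT => l0 yl; have [j jl] := dyint_cover l0.
exists `|j|%N => N jN; rewrite (stepfE a0 _ jl); last by lia.
exact: le_trans (ltW yl) (af _ _ jl).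
Qed.

End Step.

Lemma lee_inve_scale {R : realType} (C : R) (u v : \bar R) : 0 < u -> u < +oo ->
  0 < v -> v < +oo -> u <= C%:E * v -> v^-1 <= C%:E * u^-1.
Proof.
case: u => [u| |]//; case: v => [v| |]//; rewrite !lte_fin => u0 _ v0 _.
rewrite -EFinM lee_fin !inver !gt_eqF// -EFinM lee_fin => h.
by rewrite ler_pdivlMr// mulrC ler_pdivrMr.
Qed.

(** * Kernel integrals over balls and kernel sums over cubes *)

Section Comparison.
Context {R : realType} {n : nat} (n_gt0 : (0 < n)%N).
Variables (k : R -> R) (sigma : {measure set 'rV[R]_n -> \bar R}).
Hypothesis k_ge0 : forall r : R, (0 < r)%R -> (0 <= k r)%R.
Hypothesis k_noninc : forall r s : R, (0 < r)%R -> (r <= s)%R -> (k s <= k r)%R.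
Hypothesis sigma_lf : locally_finite sigma.
Hypothesis sigma_dbl : doubling sigma.
Implicit Types (x y z : 'rV[R]_n) (r l : R) (j m s N : int).

Definition ball_ker r y : \bar R := \int[lebesgue_measure]_(l in `]0%R, r[)
  ((k l)%:E * sigma (eball y l) * (l^-1)%:E).

(* The offset [m] between the scale of the cubes and the argument of [k] absorbs the
   loss of scale in the comparisons between balls and cubes. *)
Definition cube_ker z m j y : \bar R :=
  \sum_(0 <= i <oo) ((k (2 ^ (j + m - i%:Z)))%:E * sigma (Qof z (j - i%:Z) y)).

Lemma k2_ge0 j : 0 <= (k (2 ^ j))%:E.
Proof. by rewrite lee_fin k_ge0// two_gt0. Qed.

Lemma k2_le j j' : (j <= j')%R -> (k (2 ^ j'))%:E <= (k (2 ^ j))%:E.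
Proof. by move=> jj; rewrite lee_fin k_noninc ?two_gt0// two_le. Qed.

Lemma ball_ker_arg_ge0 y l : (0 < l)%R -> 0 <= (k l)%:E * sigma (eball y l) * (l^-1)%:E.
Proof.
by move=> l0; rewrite !mule_ge0// lee_fin ?k_ge0// invr_ge0 ltW.
Qed.

Lemma ball_ker_ge0 r y : 0 <= ball_ker r y.
Proof. by apply: integral_ge0 => l; rewrite /= in_itv/= => /andP[l0 _]; exact: ball_ker_arg_ge0. Qed.

Lemma ball_ker_le r r' y : (r <= r')%R -> ball_ker r y <= ball_ker r' y.
Proof.
move=> rr'; rewrite /ball_ker integral_mkcond [leRHS]integral_mkcond.
apply: le_integral_ge0 => l _; rewrite /patch; case: ifPn => [/set_mem/=|_]//;
  rewrite ?in_itv/=.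
- by move=> /andP[l0 _]; exact: ball_ker_arg_ge0.
- move=> /andP[l0 lr]; rewrite mem_set//= in_itv/= l0/=; exact: lt_le_trans rr'.
- by case: ifPn => // /set_mem/=; rewrite in_itv/= => /andP[l0 _]; exact: ball_ker_arg_ge0.
Qed.

Lemma cube_ker_ge0 z m j y : 0 <= cube_ker z m j y.
Proof. by apply: nneseries_ge0 => i _ _; rewrite mule_ge0// k2_ge0. Qed.

Lemma eball_mono x r r' : (r <= r')%R -> sigma (eball x r) <= sigma (eball x r').
Proof.
by move=> rr'; apply: le_measure; rewrite ?inE; [exact: measurable_eball|exact: measurable_eball|exact: eball_le].
Qed.

Lemma sigma_eball_gt0 x r : (0 < r)%R -> 0 < sigma (eball x r).
Proof.
move=> r0; have nr : (0 < n%:R :> R)%R by rewrite ltr0n.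
apply: lt_le_trans (sigma_cball_gt0 n_gt0 sigma_dbl x (divr_gt0 r0 nr)) _.
apply: le_measure; rewrite ?inE; [exact: measurable_cball|exact: measurable_eball|].
by have := @cball_eball _ _ x (r / n%:R)%R n_gt0; rewrite mulrCA divff ?mulr1 ?gt_eqF.
Qed.

Lemma sigma_eball_lty x r : sigma (eball x r) < +oo.
Proof.
apply: le_lt_trans (sigma_cball_lty sigma_lf x r).
by apply: le_measure; rewrite ?inE; [exact: measurable_eball|exact: measurable_cball|exact: eball_cball].
Qed.

Lemma sigma_Qof_lty z j x : sigma (Qof z j x) < +oo.
Proof. exact: locally_finite_Qof. Qed.

Lemma two_le_exp (a : nat) j j' : (j <= a%:Z + j')%R -> (2 ^ j <= 2 ^+ a * 2 ^ j' :> R)%R.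
Proof. by move=> h; rewrite [(2 ^+ a)%R](_ : _ = 2 ^ a%:Z)%R// -twoD two_le. Qed.

(** Term i is compared with the integral over the dyadic interval ending at 2^(j+s-i). There k is at
    least its value at the right end, which is at least k(2^(j+m-i)) because s <= m; the change of
    scale in [sigma] is paid for by doubling. *)
Lemma cube_ker_le_ball_ker m s : (s <= m)%R -> exists2 C : R, (0 < C)%R &
  forall z j y, cube_ker z m j y <= C%:E * ball_ker (2 ^ (j + s)) y.
Proof.
move=> sm; have [C C0 HC] := cube_le_ball n_gt0 sigma_dbl `|(1 - s)%R|%N.
exists (C * 2)%R; first by rewrite mulr_gt0.
move=> z j y; pose a j := (k (2 ^ j))%:E * sigma (eball y (2 ^ (j - 1))) * ((2 ^ j)^-1)%:E.
have a0 i : 0 <= a i by rewrite !mule_ge0 ?k2_ge0// lee_fin invr_ge0 ltW// two_gt0.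
apply: (@le_trans _ _ ((C * 2)%:E * \sum_(0 <= i <oo)
   (a (j + s - i%:Z)%R * (2 ^ (j + s - i%:Z - 1))%:E))); last first.
  rewrite lee_wpmul2l//; first by rewrite lee_fin mulr_ge0// ltW.
  apply: integral_ge_step => //.
    by move=> l; rewrite /= in_itv/= => /andP[l0 _]; exact: ball_ker_arg_ge0.
  move=> i l _ il; have l0 := dyint_gt0 il; move: il; rewrite dyintE => -[h1 h2].
  rewrite /a; apply: lee_pmul; rewrite ?mule_ge0 ?k2_ge0//.
  - by rewrite lee_fin invr_ge0 ltW// two_gt0.
  - apply: lee_pmul; rewrite ?k2_ge0//; last exact: eball_mono.
    by rewrite lee_fin k_noninc// ltW.
  - by rewrite lee_fin lef_pV2 ?posrE ?two_gt0// ltW.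
rewrite -nneseriesZl; last by move=> i _; rewrite mule_ge0// lee_fin ltW// two_gt0.
apply: lee_nneseries => [i _ _|i _]; first by rewrite mule_ge0// k2_ge0.
set J := (j + s - i%:Z)%R.
have -> : (C * 2)%:E * (a J * (2 ^ (J - 1))%:E) =
    (k (2 ^ J))%:E * (C%:E * sigma (eball y (2 ^ (J - 1)))).
  rewrite /a; have /ge0_fin_numE : 0 <= sigma (eball y (2 ^ (J - 1))) by [].
  rewrite sigma_eball_lty => /fineK <-; rewrite -!EFinM; congr (_%:E).
  rewrite twoD (_ : (2 ^ (- 1) = 2^-1 :> R)%R)//; field.
  by rewrite gt_eqF// two_gt0.
apply: lee_pmul; rewrite ?k2_ge0//; first by apply: k2_le; rewrite /J; lia.
apply: HC; apply: two_le_exp; rewrite /J; lia.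
Qed.

(** Now k is bounded by its value at the left end of the dyadic interval, one scale lower, whence
    the extra 1 in the condition on s. *)
Lemma ball_ker_le_cube_ker m s : (m + 1 <= s)%R -> exists2 C : R, (0 < C)%R &
  forall z j y, ball_ker (2 ^ (j + s)) y <= C%:E * cube_ker z m j y.
Proof.
move=> ms; have [C C0 HC] := ball_le_cube n_gt0 sigma_dbl `|s|%N.
exists C => // z j y.
pose a j := (k (2 ^ (j - 1)))%:E * sigma (eball y (2 ^ j)) * ((2 ^ (j - 1))^-1)%:E.
have a0 i : 0 <= a i by rewrite !mule_ge0 ?k2_ge0// lee_fin invr_ge0 ltW// two_gt0.
apply: (@le_trans _ _ (\sum_(0 <= i <oo)
   (a (j + s - i%:Z)%R * (2 ^ (j + s - i%:Z - 1))%:E))).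
  apply: integral_le_step => //; first by move=> l; exact: ball_ker_arg_ge0.
  move=> i l _ il; have l0 := dyint_gt0 il; move: il; rewrite dyintE => -[h1 h2].
  rewrite /a; apply: lee_pmul; rewrite ?mule_ge0 ?lee_fin ?k_ge0 ?invr_ge0 ?(ltW l0)//.
  - apply: lee_pmul; rewrite ?lee_fin ?k_ge0//; last by apply: eball_mono; exact: ltW.
    by rewrite k_noninc// two_gt0.
  - by rewrite lef_pV2 ?posrE ?two_gt0.
rewrite -nneseriesZl; last by move=> i _; rewrite mule_ge0// k2_ge0.
apply: lee_nneseries => [i _ _|i _].
  by rewrite mule_ge0// lee_fin ltW// two_gt0.
set J := (j + s - i%:Z)%R.
have -> : a J * (2 ^ (J - 1))%:E = (k (2 ^ (J - 1)))%:E * sigma (eball y (2 ^ J)).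
  by rewrite /a -muleA -EFinM mulVf ?mule1// gt_eqF// two_gt0.
rewrite muleCA; apply: lee_pmul; rewrite ?k2_ge0//; first by apply: k2_le; rewrite /J; lia.
apply: HC; apply: two_le_exp; rewrite /J; lia.
Qed.

Lemma kbarE r x : (0 < r)%R -> ball_ker r x = sigma (eball x r) * kbar k sigma r x.
Proof.
move=> r0; rewrite /kbar muleA divee ?mul1e//.
  by rewrite ge0_fin_numE// sigma_eball_lty.
by rewrite gt_eqF// sigma_eball_gt0.
Qed.

Lemma kbar_ge0 r x : 0 <= kbar k sigma r x.
Proof. by rewrite /kbar mule_ge0 ?inve_ge0//; exact: ball_ker_ge0. Qed.

(** LBO is used here: the kernel sum at x becomes a kernel integral over a ball, LBO moves the
    centre from x to y, and the integral becomes a kernel sum again. The two passages need different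
    radii, which costs nothing since [ball_ker] increases with the radius. *)
Lemma cube_ker_quasi m : LBO k sigma -> exists2 C : R, (0 <= C)%R &
  forall z j x y, Qof z j x y -> cube_ker z m j x <= C%:E * cube_ker z m j y.
Proof.
(* This s is above m, as the return to cubes requires, and at least n + 1, so that the ball of
   radius 2^(j+s) around x contains the cube and hence y. *)
move=> [Cl [Cl0 Hl]]; pose s := (m + (`|m| + n).+1%:Z)%R.
pose a := `|s|%N.
have [C1 C10 H1] := @cube_ker_le_ball_ker m m (lexx _).
have [C2 C20 H2] := @ball_ker_le_cube_ker m s ltac:(rewrite /s; lia).
have [C3 C30 H3] := ball_le_cube n_gt0 sigma_dbl a.
have [C4 C40 H4] := cube_le_ball n_gt0 sigma_dbl 0.
exists (C1 * (C3 * C4 * Cl * C2))%R; first by rewrite !mulr_ge0// ltW.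
move=> z j x y xy; rewrite EFinM -muleA.
apply: le_trans (H1 _ _ _) _; rewrite lee_wpmul2l ?lee_fin ?(ltW C10)//.
apply: (@le_trans _ _ (ball_ker (2 ^ (j + s)) x)).
  by apply: ball_ker_le; rewrite two_le /s; lia.
have r0 : (0 < 2 ^ (j + s) :> R)%R by exact: two_gt0.
have bxy : eball x (2 ^ (j + s)) y.
  have := cball_eball n_gt0 (Qof_sub_cball xy); apply: eball_le.
  rewrite twoD mulrC ler_wpM2l ?(ltW (two_gt0 _))//.
  apply: le_trans (nat_le_exp2 _) _.
  by rewrite [(2 ^+ n)%R](_ : _ = 2 ^ n%:Z)%R// two_le /s; lia.
have [h _] := Hl _ _ _ r0 bxy.
have h' : kbar k sigma (2 ^ (j + s)) x <= Cl%:E * kbar k sigma (2 ^ (j + s)) y.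
  have := lee_wpmul2l (_ : 0 <= Cl%:E) h; rewrite lee_fin ltW// => /(_ isT).
  by rewrite muleA -EFinM divff ?mul1e// gt_eqF.
rewrite kbarE//.
apply: (@le_trans _ _ ((C3 * C4)%:E * sigma (eball y (2 ^ (j + s))) *
    (Cl%:E * kbar k sigma (2 ^ (j + s)) y))).
  apply: lee_pmul; [by []|exact: kbar_ge0| |exact: h'].
  apply: le_trans (H3 z j x _ _) _; first by apply: two_le_exp; rewrite /a; lia.
  rewrite EFinM -muleA lee_wpmul2l ?lee_fin ?(ltW C30)// -(Qof_eq xy).
  apply: H4; rewrite expr0 mul1r two_le /s; lia.
rewrite -muleA [X in _ * X]muleCA -kbarE//.
rewrite muleA -EFinM [X in X * cube_ker _ _ _ _]EFinM -muleA lee_wpmul2l//.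
by rewrite lee_fin !mulr_ge0// ltW.
Qed.

End Comparison.

Lemma le_integral_sub d (X : measurableType d) (R : realType)
    (nu : {measure set X -> \bar R}) (D D' : set X) (f g : X -> \bar R) :
  D `<=` D' -> (forall x, D x -> 0 <= f x) -> (forall x, D' x -> 0 <= g x) ->
  (forall x, D x -> f x <= g x) ->
  \int[nu]_(x in D) f x <= \int[nu]_(x in D') g x.
Proof.
move=> DD f0 g0 fg; rewrite integral_mkcond [leRHS]integral_mkcond.
apply: le_integral_ge0 => x _; rewrite /patch; case: ifPn => [/set_mem Dx|_]//.
- exact: f0.
- by rewrite mem_set; [exact: fg|exact: DD].
- by case: ifPn => // /set_mem; exact: g0.
Qed.

Lemma isum_mono {R : realType} (g : int -> \bar R) (N N' : int) :
  (forall j, 0 <= g j) -> (N <= N')%R ->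
  \sum_(0 <= i <oo) g (N - i%:Z)%R <= \sum_(0 <= i <oo) g (N' - i%:Z)%R.
Proof.
move=> g0 NN'; pose d := `|(N' - N)%R|%N.
rewrite (eq_eseriesr (g := fun i => g (N' - (i + d)%N%:Z)%R)); last first.
  by move=> i _; congr g; rewrite /d; lia.
rewrite (@nneseries_addn _ (fun i => g (N' - i%:Z)%R))//.
rewrite [leRHS](nneseries_split 0 d)// add0n leeDr//.
exact: sume_ge0.
Qed.

(** * Continuous Wolff potential and Wolff sums of lattices *)

Section Wolff.
Context {R : realType} {n : nat} (n_gt0 : (0 < n)%N).
Variables (k : R -> R) (mu sigma : {measure set 'rV[R]_n -> \bar R}).
Hypothesis k_ge0 : forall r : R, (0 < r)%R -> (0 <= k r)%R.
Hypothesis k_noninc : forall r s : R, (0 < r)%R -> (r <= s)%R -> (k s <= k r)%R.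
Hypothesis sigma_lf : locally_finite sigma.
Hypothesis sigma_dbl : doubling sigma.
Variable b : R.
Hypothesis b0 : (0 <= b)%R.
Implicit Types (x y z : 'rV[R]_n) (r l : R) (j m s N : int).

Definition level_ker N m (i : nat) : R := k (2 ^ (N - i%:Z + m)).

Lemma level_ker_ge0 N m i : (0 <= level_ker N m i)%R.
Proof. by rewrite k_ge0// two_gt0. Qed.

Lemma ker_sum_cube_ker z N m i : ker_sum (gen_lab z N) sigma (level_ker N m) i = cube_ker k sigma z m (N - i%:Z).
Proof.
apply/funext => y; rewrite /ker_sum /cube_ker.
rewrite -(@nneseries_addn _ (fun h : nat => (level_ker N m h)%:E * sigma (cell (gen_lab z N) h y))).
  apply: eq_eseriesr => l _; rewrite cell_gen_lab /level_ker; by congr ((k (2 ^ _))%:E * sigma (Qof z _ y)); clear; lia.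
by move=> l; rewrite mule_ge0// lee_fin level_ker_ge0.
Qed.

Definition cube_kbar z m j x : \bar R :=
  \int[mu]_(y in Qof z j x) ((sigma (Qof z j y))^-1 * cube_ker k sigma z m j y).

Definition cube_term z m j x : \bar R :=
  (k (2 ^ (j + m)))%:E * sigma (Qof z j x) * cube_kbar z m j x `^ b.

Lemma wolff_sumE z N m x : wolff_sum (gen_lab z N) mu sigma (level_ker N m) b x =
  \sum_(0 <= i <oo) cube_term z m (N - i%:Z) x.
Proof.
apply: eq_eseriesr => i _; rewrite /wolff_term /cube_term /kbar_int /cint cell_gen_lab ker_sum_cube_ker /cube_kbar.
congr (_ * _ `^ b).
by apply: eq_integral => y _; rewrite cell_gen_lab.
Qed.

Lemma cube_kbar_arg_ge0 z m j y : 0 <= (sigma (Qof z j y))^-1 * cube_ker k sigma z m j y.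
Proof. by rewrite mule_ge0 ?inve_ge0//; exact: cube_ker_ge0. Qed.

Lemma cube_kbar_ge0 z m j x : 0 <= cube_kbar z m j x.
Proof. by apply: integral_ge0 => y _; exact: cube_kbar_arg_ge0. Qed.

Lemma cube_term_ge0 z m j x : 0 <= cube_term z m j x.
Proof. by rewrite !mule_ge0 ?poweR_ge0 ?k2_ge0. Qed.

Lemma measurable_cube_kbar_arg z m j :
  measurable_fun setT (fun y => (sigma (Qof z j y))^-1 * cube_ker k sigma z m j y).
Proof.
have fc := gen_lab_filtration z j.
have := emeasurable_funM (measurable_sigmaV_cell fc sigma 0) (measurable_ker_sum fc sigma (level_ker_ge0 j m) 0).
rewrite ker_sum_cube_ker subr0; apply: eq_measurable_fun => y _ /=.
by rewrite cell_gen_lab subr0.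
Qed.

Lemma cube_kbarZl z m j x (C : R) : (0 <= C)%R ->
  \int[mu]_(y in Qof z j x) (C%:E * ((sigma (Qof z j y))^-1 * cube_ker k sigma z m j y)) =
  C%:E * cube_kbar z m j x.
Proof.
move=> C0; rewrite /cube_kbar ge0_integralZl_EFin//; first exact: measurable_Qof.
  by move=> y _; exact: cube_kbar_arg_ge0.
by apply: measurable_funS (measurable_cube_kbar_arg z m j).
Qed.

Definition wolff_at x r : \bar R :=
  (k r)%:E * sigma (eball x r) *
  (\int[mu]_(y in eball x r) kbar k sigma r y) `^ b * (r^-1)%:E.

Definition wolff_pot x : \bar R := \int[lebesgue_measure]_(r in `]0%R, +oo[) wolff_at x r.

Lemma wolff_at_ge0 x r : (0 < r)%R -> 0 <= wolff_at x r.
Proof.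
by move=> r0; rewrite !mule_ge0 ?poweR_ge0// lee_fin ?k_ge0// invr_ge0 ltW.
Qed.

(** A majorant of [wolff_at x] on the interval from 2^(j-1) to 2^j: increasing quantities are taken
    at the right end, decreasing ones, including the inverse of [sigma] in [kbar], at the left
    end. *)
Definition wolff_up x j : \bar R :=
  (k (2 ^ (j - 1)))%:E * sigma (eball x (2 ^ j)) *
  (\int[mu]_(y in eball x (2 ^ j))
     ((sigma (eball y (2 ^ (j - 1))))^-1 * ball_ker k sigma (2 ^ j) y)) `^ b *
  ((2 ^ (j - 1))^-1)%:E.

Lemma wolff_up_arg_ge0 j y : 0 <= (sigma (eball y (2 ^ (j - 1))))^-1 * ball_ker k sigma (2 ^ j) y.
Proof. by rewrite mule_ge0 ?inve_ge0//; exact: ball_ker_ge0. Qed.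

Lemma wolff_up_ge0 x j : 0 <= wolff_up x j.
Proof.
have := two_gt0 (R := R) (j - 1); rewrite -invr_gt0 => /ltW h.
by rewrite /wolff_up !mule_ge0 ?poweR_ge0 ?(k2_ge0 k_ge0) ?lee_fin.
Qed.

Lemma lee_sigmaV_eball y r r' : (0 < r)%R -> (r <= r')%R ->
  (sigma (eball y r'))^-1 <= (sigma (eball y r))^-1.
Proof.
move=> r0 rr'; rewrite -[leRHS]mul1e; apply: lee_inve_scale.
- exact: (sigma_eball_gt0 n_gt0 sigma_dbl).
- exact: sigma_eball_lty.
- by apply: (sigma_eball_gt0 n_gt0 sigma_dbl); exact: lt_le_trans rr'.
- exact: sigma_eball_lty.
- by rewrite mul1e; exact: eball_mono.
Qed.

Lemma wolff_at_le_wolff_up x j r : dyint j r -> wolff_at x r <= wolff_up x j.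
Proof.
move=> jr; have r0 := dyint_gt0 jr; move: jr; rewrite dyintE => -[h1 h2].
have inte : 0 <= \int[mu]_(y in eball x r) kbar k sigma r y.
  by apply: integral_ge0 => y _; exact: kbar_ge0.
rewrite /wolff_at /wolff_up; apply: lee_pmul.
- by rewrite !mule_ge0 ?poweR_ge0// lee_fin ?k_ge0// invr_ge0 ltW.
- by rewrite lee_fin invr_ge0 ltW.
- apply: lee_pmul; [by rewrite mule_ge0// lee_fin k_ge0|exact: poweR_ge0| |].
    apply: lee_pmul; [by rewrite lee_fin k_ge0|by []| |by apply: eball_mono; exact: ltW].
    by rewrite lee_fin k_noninc// two_gt0.
  apply: lee_poweR; [exact: b0|exact: inte|]; apply: le_integral_sub.
  + by apply: eball_le; exact: ltW.
  + by move=> y _; exact: kbar_ge0.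
  + by move=> y _; exact: wolff_up_arg_ge0.
  move=> y _; apply: lee_pmul; [by rewrite inve_ge0|exact: ball_ker_ge0| |].
    by apply: lee_sigmaV_eball => //; exact: two_gt0.
  by apply: ball_ker_le => //; exact: ltW.
- by rewrite lee_fin lef_pV2 ?posrE ?two_gt0.
Qed.

(* The ball of radius [2 ^ j] sits in a cube of side [2 ^ (j + 3)], while the kernel
   is evaluated at [2 ^ (j - 1)]: this is the shift [- 4]. *)
Lemma wolff_up_le_cube_term : exists2 C : R, (0 < C)%R & forall z j x,
  cball x (2 ^ j) `<=` Qof z (j + 3) x ->
  wolff_up x j * (2 ^ (j - 1))%:E <= C%:E * cube_term z (- 4) (j + 3) x.
Proof.
have [C1 C10 H1] := cube_le_ball n_gt0 sigma_dbl 4.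
have [C2 C20 H2] := ball_ker_le_cube_ker n_gt0 k_ge0 k_noninc sigma_dbl (m := - 4) (s := - 3) isT.
have [C3 C30 H3] := ball_le_cube n_gt0 sigma_dbl 0.
have C12 : (0 <= C1 * C2)%R by rewrite mulr_ge0// ltW.
exists (C3 * (C1 * C2) `^ b)%R; first by rewrite mulr_gt0// powR_gt0// mulr_gt0.
move=> z j x xz; rewrite /wolff_up -muleA -EFinM mulVf ?mule1 ?gt_eqF ?two_gt0//.
rewrite /cube_term (_ : j + 3 + (- 4) = j - 1)%R; last by lia.
have -> : (C3 * (C1 * C2) `^ b)%:E * ((k (2 ^ (j - 1)))%:E * sigma (Qof z (j + 3) x) *
   cube_kbar z (- 4) (j + 3) x `^ b) = ((k (2 ^ (j - 1)))%:E * (C3%:E * sigma (Qof z (j + 3) x))) *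
   ((C1 * C2)%:E * cube_kbar z (- 4) (j + 3) x) `^ b.
  by rewrite poweRM ?lee_fin ?cube_kbar_ge0// poweR_EFin EFinM [LHS]muleACA [X in X * _ = _]muleCA.
apply: lee_pmul; [|exact: poweR_ge0| |].
- by apply: mule_ge0; [exact: k2_ge0|].
- apply: lee_wpmul2l; first exact: k2_ge0.
  by apply: H3; rewrite expr0 mul1r two_le; lia.
apply: lee_poweR => //; first by apply: integral_ge0 => y _; exact: wolff_up_arg_ge0.
rewrite -cube_kbarZl//; apply: le_integral_sub.
- by apply: subset_trans xz; exact: eball_cball.
- by move=> y _; exact: wolff_up_arg_ge0.
- by move=> y _; rewrite mule_ge0 ?lee_fin//; exact: cube_kbar_arg_ge0.
move=> y _; rewrite EFinM -muleA.
have -> : C1%:E * (C2%:E * ((sigma (Qof z (j + 3) y))^-1 * cube_ker k sigma z (- 4) (j + 3) y)) =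
  C1%:E * (sigma (Qof z (j + 3) y))^-1 * (C2%:E * cube_ker k sigma z (- 4) (j + 3) y).
  by rewrite -!muleA; congr (_ * _); rewrite muleCA.
apply: lee_pmul; [by rewrite inve_ge0|exact: ball_ker_ge0| |].
  apply: lee_inve_scale.
  - exact: sigma_Qof_gt0.
  - exact: sigma_Qof_lty.
  - by apply: (sigma_eball_gt0 n_gt0 sigma_dbl); exact: two_gt0.
  - exact: sigma_eball_lty.
  - by apply: H1; apply: two_le_exp; lia.
by have := H2 z (j + 3)%R y; rewrite (_ : j + 3 + -3 = j)%R//; lia.
Qed.

(** At each scale the one-third trick selects a shift depending on x and on the scale; summing over
    all shifts covers every choice. The lattices change with N, so the sums need not be monotone in
    N and the bound is stated in liminf form. *)
Lemma wolff_le_wolff_sum : exists2 C : R, (0 < C)%R & forall x (u : \bar R), u < wolff_pot x ->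
  exists N0 : nat, forall N : nat, (N0 <= N)%N ->
    u <= C%:E * \sum_(t : {ffun 'I_n -> bool})
      wolff_sum (gen_lab (zshift N%:Z t) N%:Z) mu sigma (level_ker N%:Z (- 4)) b x.
Proof.
have [C C0 HC] := wolff_up_le_cube_term; exists C => // x u; rewrite ltNge => /negP uW.
apply: contrapT => /forallNP h; apply: uW.
apply: (@integral_le_steps _ _ (wolff_up x)).
- by move=> r; exact: wolff_at_ge0.
- by move=> j; exact: wolff_up_ge0.
- by move=> j r; exact: wolff_at_le_wolff_up.
(* By contradiction there are arbitrarily large N' for which the sum over shifts, times C, stays
   below u; one of them already bounds the scales up to 2^N. The 3 is the gap between the radius of
   a ball and the side of the cube around it. *)
move=> N; have /existsNP[N' /not_implyP[NN' /negP]] := h (N + 3)%N.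
rewrite -ltNge => /ltW; apply: le_trans.
pose g j := wolff_up x j * (2 ^ (j - 1))%:E.
have g0 j : 0 <= g j by rewrite mule_ge0 ?wolff_up_ge0// lee_fin ltW// two_gt0.
apply: (@le_trans _ _ (\sum_(0 <= i <oo) g (N'%:Z - 3 - i%:Z)%R)).
  by apply: isum_mono => //; lia.
have WW0 t := @wolff_sum_ge0 _ _ _ (gen_lab (zshift N'%:Z t) N'%:Z) mu sigma _ (level_ker_ge0 N'%:Z (- 4)) b x.
have -> : \sum_(t : {ffun 'I_n -> bool})
      wolff_sum (gen_lab (zshift N'%:Z t) N'%:Z) mu sigma (level_ker N'%:Z (- 4)) b x =
  \sum_(0 <= i <oo) \sum_(t : {ffun 'I_n -> bool}) cube_term (zshift N'%:Z t) (- 4) (N'%:Z - i%:Z) x.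
  rewrite nneseries_sum; last by move=> t i _; exact: cube_term_ge0.
  by apply: eq_bigr => t _; rewrite wolff_sumE.
rewrite -nneseriesZl; last by move=> i _; apply: sume_ge0 => t _; exact: cube_term_ge0.
apply: lee_nneseries => [i _ _|i _]; first exact: g0.
have [t Ht] := @third_trick R n N'%:Z (N'%:Z - i%:Z)%R x ltac:(lia).
apply: (@le_trans _ _ (C%:E * cube_term (zshift N'%:Z t) (- 4) (N'%:Z - i%:Z) x)).
  have := HC (zshift N'%:Z t) (N'%:Z - 3 - i%:Z)%R x.
  rewrite (_ : N'%:Z - 3 - i%:Z + 3 = N'%:Z - i%:Z)%R; last by lia.
  apply; apply: subset_trans Ht; apply: cball_le.
  rewrite (_ : N'%:Z - 3 - i%:Z = (N'%:Z - i%:Z) - 3)%R; last by lia.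
  rewrite twoD ler_wpM2l ?(ltW (two_gt0 _))//.
  rewrite (_ : (2 ^ (- 3) = (2 ^+ 3)^-1 :> R)%R)// lef_pV2 ?posrE ?exprn_gt0//.
  by rewrite -natrX ler_nat.
rewrite lee_wpmul2l ?lee_fin ?(ltW C0)// (bigD1 t)//= leeDl//.
by apply: sume_ge0 => t' _; exact: cube_term_ge0.
Qed.

(** A cube of side 2^j lies in the Euclidean ball of radius 2^(j+n) around any of its points. Radii
    between 2^(j+n) and 2^(j+n+1) thus see the whole cube, and k is at least k(2^(j+n+1)) on them:
    this is the offset n + 1. *)
Lemma wolff_sum_le_wolff : exists2 C : R, (0 < C)%R & forall z N x,
  wolff_sum (gen_lab z N) mu sigma (level_ker N n.+1%:Z) b x <= C%:E * wolff_pot x.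
Proof.
have [C1 C10 H1] := cube_le_ball n_gt0 sigma_dbl 0.
have [C2 C20 H2] := cube_ker_le_ball_ker n_gt0 k_ge0 k_noninc sigma_lf sigma_dbl (m := n.+1%:Z) (s := n%:Z) ltac:(lia).
have [C3 C30 H3] := ball_le_cube n_gt0 sigma_dbl n.+1.
have C32 : (0 < C3 * C2)%R by rewrite mulr_gt0.
exists (2 * (C1 * (C3 * C2) `^ b))%R; first by rewrite !mulr_gt0// powR_gt0.
move=> z N x.
pose I j := \int[mu]_(y in eball x (2 ^ (j - 1)))
     ((sigma (eball y (2 ^ j)))^-1 * ball_ker k sigma (2 ^ (j - 1)) y).
have I0 j : 0 <= I j.
  by apply: integral_ge0 => y _; rewrite mule_ge0 ?inve_ge0//; exact: ball_ker_ge0.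
pose a j := (k (2 ^ j))%:E * sigma (eball x (2 ^ (j - 1))) * I j `^ b * ((2 ^ j)^-1)%:E.
have a0 j : 0 <= a j.
  have := two_gt0 (R := R) j; rewrite -invr_gt0 => /ltW h.
  by rewrite /a !mule_ge0 ?poweR_ge0 ?(k2_ge0 k_ge0) ?lee_fin.
apply: (@le_trans _ _ ((2 * (C1 * (C3 * C2) `^ b))%:E * \sum_(0 <= i <oo)
   (a (N + n.+1%:Z - i%:Z)%R * (2 ^ (N + n.+1%:Z - i%:Z - 1))%:E))); last first.
  rewrite lee_wpmul2l//; first by rewrite lee_fin !mulr_ge0 ?powR_ge0// ltW.
  apply: integral_ge_step => //.
  - by move=> r /=; rewrite !in_itv/= andbT => /andP[].
  - by move=> r /=; rewrite in_itv/= andbT; exact: wolff_at_ge0.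
  move=> j r _ jr; have r0 := dyint_gt0 jr; move: jr; rewrite dyintE => -[h1 h2].
  have kr0 : 0 <= (k r)%:E by rewrite lee_fin k_ge0.
  rewrite /a /wolff_at; apply: lee_pmul.
  - by rewrite !mule_ge0 ?poweR_ge0 ?(k2_ge0 k_ge0).
  - by rewrite lee_fin invr_ge0 ltW// two_gt0.
  - apply: lee_pmul; [by apply: mule_ge0; [exact: k2_ge0|]|exact: poweR_ge0| |].
      apply: lee_pmul; [exact: k2_ge0|by []| |exact: eball_mono].
      by rewrite lee_fin k_noninc// ltW.
    apply: lee_poweR; [exact: b0|exact: I0|]; apply: le_integral_sub.
    + exact: eball_le.
    + by move=> y _; rewrite mule_ge0 ?inve_ge0//; exact: ball_ker_ge0.
    + by move=> y _; exact: kbar_ge0.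
    move=> y _; apply: lee_pmul; [by rewrite inve_ge0|exact: ball_ker_ge0| |exact: ball_ker_le].
    by apply: lee_sigmaV_eball => //; exact: ltW.
  - by rewrite lee_fin lef_pV2 ?posrE ?two_gt0// ltW.
rewrite wolff_sumE -nneseriesZl; last first.
  by move=> i _; rewrite mule_ge0// lee_fin ltW// two_gt0.
apply: lee_nneseries => [i _ _|i _]; first exact: cube_term_ge0.
set j := (N - i%:Z)%R.
rewrite (_ : N + n.+1%:Z - i%:Z = j + n.+1%:Z)%R; last by rewrite /j; lia.
have -> : (2 * (C1 * (C3 * C2) `^ b))%:E * (a (j + n.+1%:Z)%R * (2 ^ (j + n.+1%:Z - 1))%:E) =
   (k (2 ^ (j + n.+1%:Z)))%:E * (C1%:E * sigma (eball x (2 ^ (j + n.+1%:Z - 1)))) *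
   ((C3 * C2)%:E * I (j + n.+1%:Z)%R) `^ b.
  rewrite poweRM ?lee_fin ?(ltW C32)// poweR_EFin.
  rewrite /a -muleA -EFinM.
  have -> : ((2 ^ (j + n.+1%:Z))^-1 * 2 ^ (j + n.+1%:Z - 1) = 2^-1 :> R)%R.
    rewrite [in X in (_ * X)%R]twoD mulrA mulVf ?mul1r//.
    by rewrite gt_eqF// two_gt0.
  rewrite [LHS]muleC -[LHS]muleA -EFinM [(2^-1 * _)%R]mulKf//.
  by rewrite [LHS]muleC EFinM [LHS]muleACA [X in X * _ = _]muleCA.
apply: lee_pmul; [|exact: poweR_ge0| |].
- by apply: mule_ge0; [exact: k2_ge0|].
- apply: lee_wpmul2l; first exact: k2_ge0.
  by apply: H1; rewrite expr0 mul1r two_le; lia.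
apply: lee_poweR; [exact: b0|exact: cube_kbar_ge0|].
rewrite -[cube_kbar _ _ _ _]mul1e -(mulfV (lt0r_neq0 C32)) EFinM -muleA.
rewrite lee_wpmul2l ?lee_fin ?(ltW C32)//.
have V0 : (0 <= (C3 * C2)^-1)%R by rewrite invr_ge0 ltW.
rewrite -cube_kbarZl//; apply: le_integral_sub.
- apply: subset_trans (@Qof_sub_cball _ _ _ _ _) _.
  apply: subset_trans (cball_eball n_gt0) _; apply: eball_le.
  rewrite (_ : j + n.+1%:Z - 1 = j + n%:Z)%R; last by lia.
  by rewrite twoD mulrC ler_wpM2l ?(ltW (two_gt0 _))// nat_le_exp2.
- by move=> y _; rewrite mule_ge0 ?lee_fin//; exact: cube_kbar_arg_ge0.
- by move=> y _; rewrite mule_ge0 ?inve_ge0//; exact: ball_ker_ge0.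
move=> y _; set G := leRHS.
have -> : G = ((C3 * C2)^-1)%:E * ((C3 * C2)%:E * G).
  by rewrite muleA -EFinM mulVf ?mul1e ?gt_eqF.
rewrite /G lee_wpmul2l ?lee_fin// [X in _ <= X * _]EFinM muleACA.
apply: lee_pmul; [by rewrite inve_ge0|exact: cube_ker_ge0| |].
  apply: lee_inve_scale.
  - by apply: (sigma_eball_gt0 n_gt0 sigma_dbl); exact: two_gt0.
  - exact: sigma_eball_lty.
  - exact: sigma_Qof_gt0.
  - exact: sigma_Qof_lty.
  - by apply: H3; apply: two_le_exp; lia.
by have := H2 z j y; rewrite (_ : j + n.+1%:Z - 1 = j + n%:Z)%R//; lia.
Qed.

End Wolff.

Lemma esum_int_le {R : realType} (g : int -> \bar R) (N : int) : (forall j, 0 <= g j) ->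
  \esum_(j in [set j | (j <= N)%R]) g j = \sum_(0 <= i <oo) g (N - i%:Z)%R.
Proof.
move=> g0; rewrite nneseries_esumT//.
rewrite (@reindex_esum _ _ _ [set: nat] [set j | (j <= N)%R] (fun i : nat => (N - i%:Z)%R))//.
split => [i _|i j _ _|j] /=.
- by lia.
- by lia.
- by move=> jN; exists `|(N - j)%R|%N => //; lia.
Qed.

Lemma esum_int_lt {R : realType} (g : int -> \bar R) (u : \bar R) : (forall j, 0 <= g j) ->
  u < \esum_(j in [set: int]) g j ->
  exists N0 : nat, forall N : nat, (N0 <= N)%N -> u <= \sum_(0 <= i <oo) g (N%:Z - i%:Z)%R.
Proof.
move=> g0 /ereal_sup_gt[_ [X [finX _] <-] uX].
have [F XF] := finite_fsetP.1 finX.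
exists (\max_(j <- finmap.enum_fset F) `|j|%N)%N => N hN.
rewrite -esum_int_le//; apply: (le_trans (ltW uX)).
apply: esum_ge; exists X => //; split => // j; rewrite XF /= => jF.
have : (`|j|%N <= N)%N by apply: leq_trans hN; apply: (@leq_bigmax_seq _ (finmap.enum_fset F) xpredT (fun j : int => `|j|%N)).
by lia.
Qed.

(** * Sums over all cubes of a lattice as sums over scales *)

Section Dyadic.
Context {R : realType} {n : nat} (n_gt0 : (0 < n)%N).
Implicit Types (x y z : 'rV[R]_n) (j : int).

Definition cube_at z x j : dyadic_index (n := n) := (j, cube_lab z j x).

(** At each scale exactly one cube of the lattice contains x. *)
Lemma esum_cubes z x (D : set dyadic_index) (a : dyadic_index -> \bar R) :
  (forall Q, 0 <= a Q) ->
  \esum_(Q in D) (a Q * (\1_(cube z Q) x)%:E) =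
  \esum_(j in [set j | D (cube_at z x j)]) a (cube_at z x j).
Proof.
move=> a0; rewrite (eq_esum (b := fun Q => if Q \in [set Q | cube z Q x] then a Q else 0)).
  rewrite -esum_mkcondr (@reindex_esum _ _ _ [set j | D (cube_at z x j)] _ (cube_at z x))//.
  split => [j /= Dj|j j' _ _ []//|[j m] /= [Dj /cubeP xm]].
    by split => //; apply/cubeP.
  by exists j; rewrite /cube_at xm.
move=> Q _; rewrite indicE; have [/set_mem h|h] := boolP (x \in cube z Q).
  by rewrite mule1 mem_set.
by rewrite mule0 memNset// => h'; move/negP : h; apply; exact: mem_set.
Qed.

Lemma cube_lab_mono z j j' x y : (j <= j')%R -> cube_lab z j x = cube_lab z j y -> cube_lab z j' x = cube_lab z j' y.
Proof.
move=> jj; have -> : j' = (j + `|(j' - j)%R|%N%:Z)%R by lia.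
elim: `|(j' - j)%R|%N => [|i IH] e; first by rewrite addr0.
have -> : (j + i.+1%:Z = j + i%:Z + 1)%R by lia.
by apply: cube_lab_coarse; exact: IH.
Qed.

Lemma Qof_subP z j j' y : Qof z j y `<=` Qof z j' y <-> (j <= j')%R.
Proof.
split => [h|jj v /QofP e]; last by apply/QofP; exact: cube_lab_mono e.
rewrite leNgt; apply/negP => jj.
(* The points at distance w from the centre on either side, along each axis, still lie in the cube.
   They are 4/3 times 2^(j-1) apart, more than the side of any cube of a finer scale. *)
pose w : R := (2 / 3 * 2 ^ (j - 1))%R; have p0 := two_gt0 (R := R) (j - 1).
pose c := center z j y.
have hc (e : R) : (`|e| <= w)%R -> Qof z j' y (\row_i (c ord0 i + e)%R).
  move=> ew; apply: h; apply: center_sub => i; rewrite mxE -/c addrAC subrr add0r.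
  by apply: le_lt_trans ew _; rewrite /w; lra.
have w0 : (0 <= w)%R by rewrite /w; lra.
have h1 := hc w; rewrite ger0_norm// in h1; have /andP[_ u1] := h1 (lexx _) (Ordinal n_gt0).
have h2 := hc (- w)%R; rewrite normrN ger0_norm// in h2.
have /andP[u2 _] := h2 (lexx _) (Ordinal n_gt0).
rewrite /side [X in (_ <= X - _)%R]mxE /= in u2.
rewrite /side [X in (X - _ < _)%R]mxE /= intrD mulrDl mul1r in u1.
have : (2 ^ j' <= 2 ^ (j - 1) :> R)%R by rewrite two_le; lia.
rewrite /w in u1 u2; lra.
Qed.

Variables (k : R -> R) (mu sigma : {measure set 'rV[R]_n -> \bar R}).
Hypothesis k_ge0 : forall r : R, (0 < r)%R -> (0 <= k r)%R.
Let K := fun Q : dyadic_index (n := n) => k (side Q).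

Let K_ge0 Q : (0 <= K Q)%R.
Proof. by rewrite k_ge0// two_gt0. Qed.

Lemma KbarE z j x y : Qof z j x y ->
  Kbar z K sigma (cube_at z x j) y = (sigma (Qof z j y))^-1 * cube_ker k sigma z 0 j y.
Proof.
move=> xy; rewrite /Kbar esum_cubes; last by move=> Q; rewrite mule_ge0// lee_fin.
rewrite -[cube z (cube_at z x j)]/(Qof z j x) -(Qof_eq xy); congr (_ * _).
rewrite (_ : [set _ | _] = [set j' | (j' <= j)%R]); last first.
  by apply/seteqP; split => j'; [exact: (iffLR (Qof_subP z j' j y))|exact: (iffRL (Qof_subP z j' j y))].
rewrite esum_int_le; last by move=> j'; rewrite mule_ge0// lee_fin.
by apply: eq_eseriesr => i _; rewrite addr0.
Qed.

Lemma dyadic_wolffE z p x : dyadic_wolff z K sigma p mu x =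
  \esum_(j in [set: int]) cube_term k mu sigma (conj_exponent p - 1) z 0 j x.
Proof.
rewrite /dyadic_wolff esum_cubes; last first.
  by move=> Q; rewrite !mule_ge0 ?poweR_ge0// lee_fin.
apply: eq_esum => j _; rewrite /cube_term addr0 /cube_kbar; congr (_ * _ `^ _).
by apply: eq_integral => y /set_mem; exact: KbarE.
Qed.

End Dyadic.

(** * The potential and its dyadic model *)

Lemma bigmax_poweR_le {R : realType} (T : finType) (a : T -> \bar R) (p : R) :
  (0 < p)%R -> (forall t, 0 <= a t) ->
  (\big[maxe/0]_(t : T) a t) `^ p <= \sum_(t : T) a t `^ p.
Proof.
move=> p0 a0; suff [] : (\big[maxe/0]_(t : T) a t) `^ p <= \sum_(t : T) a t `^ p /\
   0 <= \sum_(t : T) a t `^ p by [].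
elim/big_ind2: _ => [|u v u' v' [h1 h2] [h3 h4]|t _].
- by rewrite poweR0r// gt_eqF.
- split; last exact: adde_ge0.
  rewrite /Order.max; case: ifP => _; first by apply: (le_trans h3); rewrite leeDr.
  by apply: (le_trans h1); rewrite leeDl.
- by split => //; exact: poweR_ge0.
Qed.

Section Potential.
Context {R : realType} {n : nat} (n_gt0 : (0 < n)%N).
Variables (k : R -> R) (sigma : {measure set 'rV[R]_n -> \bar R}).
Hypothesis k_ge0 : forall r : R, (0 < r)%R -> (0 <= k r)%R.
Hypothesis k_noninc : forall r s : R, (0 < r)%R -> (r <= s)%R -> (k s <= k r)%R.
Hypothesis sigma_lf : locally_finite sigma.
Hypothesis sigma_dbl : doubling sigma.
Implicit Types (x y z : 'rV[R]_n) (r : R) (j m N : int) (f : 'rV[R]_n -> \bar R).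

Lemma sigma_cell_gt0 z N i x : 0 < sigma (cell (gen_lab z N) i x).
Proof. by rewrite cell_gen_lab; exact: sigma_Qof_gt0. Qed.

Lemma sigma_cell_lty z N i x : sigma (cell (gen_lab z N) i x) < +oo.
Proof. by rewrite cell_gen_lab; exact: sigma_Qof_lty. Qed.

Definition shifted_max N L f x : \bar R :=
  \big[maxe/0]_(t : {ffun 'I_n -> bool}) maxavg (gen_lab (zshift N t) N) sigma L f x.

Lemma shifted_max_ge0 N L f x : (forall y, 0 <= f y) -> 0 <= shifted_max N L f x.
Proof.
move=> f0; rewrite /shifted_max; elim/big_ind: _ => // [u v u0 v0|t _].
  by rewrite le_max u0.
exact: maxavg_ge0.
Qed.

Lemma measurable_shifted_max N L f : measurable_fun setT (shifted_max N L f).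
Proof.
rewrite /shifted_max; elim: (index_enum _) => [|t s IH].
  by apply: eq_measurable_fun (measurable_cst 0) => x _; rewrite big_nil.
apply: (@eq_measurable_fun _ _ _ _ _ (fun x => maxe (maxavg (gen_lab (zshift N t) N) sigma L f x)
   (\big[maxe/0]_(i <- s) maxavg (gen_lab (zshift N i) N) sigma L f x))).
  by move=> x _; rewrite big_cons.
by apply: measurable_maxe => //; apply: measurable_maxavg; exact: gen_lab_filtration.
Qed.

Lemma maxavg_le_shifted_max N L f x t : maxavg (gen_lab (zshift N t) N) sigma L f x <= shifted_max N L f x.
Proof. exact: (le_bigmax _ _ t). Qed.

Lemma shifted_max_strong p : (1 < p)%R -> exists2 C : R, (0 <= C)%R & forall N L f,
  measurable_fun setT f -> (forall x, 0 <= f x) ->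
  \int[sigma]_x (shifted_max N L f x) `^ p <= C%:E * \int[sigma]_x f x `^ p.
Proof.
move=> p1; have [C C0 HC] := @doob R (p - 1)%R ltac:(lra).
have p0 : (0 <= p)%R by lra.
exists (#|{ffun 'I_n -> bool}|%:R * C)%R; first by rewrite mulr_ge0// ltW.
move=> N L f mf f0.
pose M t := maxavg (gen_lab (zshift N t) N) sigma L f.
have M0 t x : 0 <= M t x by exact: maxavg_ge0.
have mM t : measurable_fun setT (M t) by apply: measurable_maxavg; exact: gen_lab_filtration.
apply: (@le_trans _ _ (\int[sigma]_x \sum_(t : {ffun 'I_n -> bool}) M t x `^ p)).
  apply: le_integral_ge0 => x _; first exact: poweR_ge0.
  by apply: bigmax_poweR_le => [|t]; [lra|exact: M0].
rewrite ge0_integral_sum//; first last.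
- by move=> t x _; exact: poweR_ge0.
- by move=> t; apply: measurable_poweRf.
apply: (@le_trans _ _ (\sum_(t : {ffun 'I_n -> bool}) (C%:E * \int[sigma]_x f x `^ p))).
  apply: lee_sum => t _.
  have := HC _ _ _ (gen_lab_filtration (zshift N t) N) sigma (@sigma_cell_gt0 _ _) (@sigma_cell_lty _ _) L f mf f0.
  by rewrite (_ : 1 + (p - 1) = p)%R//; lra.
set X := C%:E * _.
have X0 : 0 <= X by rewrite mule_ge0 ?lee_fin ?(ltW C0)//; apply: integral_ge0 => x _; exact: poweR_ge0.
under eq_bigr do rewrite -(mul1e X).
rewrite -ge0_sume_distrl; last by move=> t _; exact: lee01.
by rewrite sumEFin sumr_const EFinM -muleA.
Qed.

(** Converts an average around x into a lower bound for the maximal function at all nearby points.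
    It can then be integrated over any set near x of comparable measure, whether or not this set
    meets the support of [f]. *)
Lemma shifted_max_ge_avg N L (i : nat) x f : (i < L)%N -> exists t,
  cball x (2 ^ (N - i%:Z - 3)) `<=` Qof (zshift N t) (N - i%:Z) x /\
  forall y, cball x (2 ^ (N - i%:Z - 3)) y ->
   (sigma (Qof (zshift N t) (N - i%:Z) x))^-1 *
     \int[sigma]_(u in Qof (zshift N t) (N - i%:Z) x) f u <= shifted_max N L f y.
Proof.
move=> iL; have [t Ht] := @third_trick R n N (N - i%:Z)%R x ltac:(lia).
have sub : cball x (2 ^ (N - i%:Z - 3)) `<=` Qof (zshift N t) (N - i%:Z) x.
  apply: subset_trans Ht; apply: cball_le.
  rewrite twoD ler_wpM2l ?(ltW (two_gt0 _))//.
  rewrite (_ : (2 ^ (- 3) = (2 ^+ 3)^-1 :> R)%R)// lef_pV2 ?posrE ?exprn_gt0//.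
  by rewrite -natrX ler_nat.
exists t; split => // y yx; apply: le_trans (maxavg_le_shifted_max N L f y t).
apply: le_trans (avg_le_maxavg _ _ _ _ iL).
by rewrite /avg /cint cell_gen_lab (Qof_eq (sub _ yx)).
Qed.

Definition annulus x j : set 'rV[R]_n := [set y | dyint j (enorm (y - x))].

Lemma annulusE x j : annulus x j = eball x (2 ^ j) `\` eball x (2 ^ j / 2).
Proof.
have e : (2 ^ (j - 1) = 2 ^ j / 2 :> R)%R by rewrite twoD.
apply/seteqP; split => y; rewrite /annulus/= dyintE e.
  by move=> [h1 h2]; split => //; apply/negP; rewrite -leNgt.
by move=> [h1 /negP]; rewrite -leNgt.
Qed.

Lemma measurable_annulus x j : measurable (annulus x j).
Proof. by rewrite annulusE; apply: measurableD; exact: measurable_eball. Qed.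

Lemma enormC x y : enorm (x - y) = enorm (y - x).
Proof.
by rewrite /enorm; congr Num.sqrt; apply: eq_bigr => i _; rewrite !mxE -sqrrN opprB.
Qed.

Lemma kernel0_ge0 r : (0 <= r)%R -> 0 <= kernel0 k r.
Proof.
rewrite le_eqVlt /kernel0 => /orP[/eqP <-|r0]; last by rewrite gt_eqF// lee_fin k_ge0.
rewrite eqxx; apply: lime_ge; last first.
  by near=> r'; rewrite lee_fin k_ge0//.
apply: nonincreasing_at_right_is_cvge; near=> r' => u v; rewrite !in_itv/= => /andP[u0 _] _ uv.
by rewrite lee_fin k_noninc.
Unshelve. all: by end_near. Qed.

Lemma sum_annuli_le x (f : 'rV[R]_n -> R) L N y : (forall y, 0 <= f y)%R ->
  \sum_(i < L) ((\1_(annulus x (N - i%:Z)) y)%:E * ((k (2 ^ (N - i%:Z)))%:E * (f y)%:E))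
  <= kernel0 k (enorm (x - y)) * (f y)%:E.
Proof.
move=> f0; have Kf : 0 <= kernel0 k (enorm (x - y)) * (f y)%:E.
  by rewrite mule_ge0 ?lee_fin// kernel0_ge0// enorm_ge0.
have [[i yi]|h] := pselect (exists i : 'I_L, annulus x (N - i%:Z) y); last first.
  rewrite big1// => i _; rewrite indicE memNset ?mul0e// => yi.
  by apply: h; exists i.
rewrite (bigD1 i)//= big1 ?adde0.
  rewrite indicE mem_set// mul1e lee_wpmul2r ?lee_fin//.
  have r0 := dyint_gt0 yi; move: yi; rewrite /annulus /= dyintE => -[_ /ltW h].
  by rewrite /kernel0 enormC gt_eqF// lee_fin k_noninc.
move=> i' ii'; rewrite indicE memNset ?mul0e// => yi'.
move/eqP : ii'; apply; apply: val_inj => /=.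
have := dyint_uniq yi yi'; lia.
Qed.

Lemma measurable_point x : measurable [set x].
Proof.
rewrite (_ : [set x] = \bigcap_(i : nat) cball x (2 ^+ i)^-1).
  by apply: bigcapT_measurable => i; exact: measurable_cball.
apply/seteqP; split => [y -> i _|y h]; first by apply: cball_center; rewrite invr_gt0 exprn_gt0.
apply/rowP => i; apply/eqP; rewrite -subr_eq0 -normr_le0 leNgt; apply/negP => d0.
have [m hm] := two_unbounded `|y ord0 i - x ord0 i|^-1%R.
have := h m I i; rewrite ltNge => /negP; apply.
by rewrite -[leRHS]invrK lef_pV2 ?posrE ?invr_gt0 ?exprn_gt0// ltW.
Qed.

(* A point mass at [x] would charge every annulus around [x] equally. *)
Lemma sigma_point x : sigma [set x] = 0.
Proof.
have [C C0 HC] := cube_le_annulus n_gt0 sigma_dbl 0.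
have step (i : nat) : sigma [set x] + C%:E * sigma (eball x (2 ^ (- i.+1%:Z))) <=
    C%:E * sigma (eball x (2 ^ (- i%:Z))).
  have e : eball x (2 ^ (- i%:Z)) = annulus x (- i%:Z) `|` eball x (2 ^ (- i.+1%:Z)).
    rewrite annulusE (_ : (2 ^ (- i.+1%:Z) = 2 ^ (- i%:Z) / 2 :> R)%R).
      rewrite setUC setDUK//.
      by apply: eball_le; have := two_gt0 (R := R) (- i%:Z); lra.
    by rewrite (_ : - i.+1%:Z = - i%:Z + - 1)%R ?twoD//; lia.
  rewrite [in leRHS]e measureU; first last.
  - apply/seteqP; split => // y []; rewrite /annulus /= dyintE => -[h _] h'.
    move: h'; rewrite /eball /= ltNge (_ : - i.+1%:Z = - i%:Z - 1)%R ?h//; lia.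
  - exact: measurable_eball.
  - exact: measurable_annulus.
  rewrite ge0_muleDr// leeD2r//.
  apply: (@le_trans _ _ (sigma (Qof 0 (- i%:Z) x))).
    apply: le_measure; rewrite ?inE; [exact: measurable_point|exact: measurable_Qof|].
    by move=> y ->; exact: Qof_refl.
  by rewrite annulusE; apply: HC; rewrite expr0 mul1r.
have steps (M : nat) : (M%:R : R)%:E * sigma [set x] + C%:E * sigma (eball x (2 ^ (- M%:Z))) <=
    C%:E * sigma (eball x 1).
  elim: M => [|M IH]; first by rewrite mul0e add0e.
  apply: le_trans IH; rewrite -natr1 EFinD ge0_muleDl ?lee_fin// mul1e -addeA leeD2l//.
have le0 (M : nat) : (M%:R : R)%:E * sigma [set x] <= C%:E * sigma (eball x 1).
  by apply: le_trans (steps M); rewrite leeDl// mule_ge0// lee_fin ltW.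
have boo : C%:E * sigma (eball x 1) < +oo.
  by rewrite lte_mul_pinfty ?lee_fin ?(ltW C0)//; exact: sigma_eball_lty.
have : 0 <= sigma [set x] by [].
have := le0 1%N; rewrite mul1e => /le_lt_trans/(_ boo).
have b0 : 0 <= C%:E * sigma (eball x 1) by rewrite mule_ge0// lee_fin ltW.
move: le0; case: (sigma [set x]) => [v| |]//.
case: (C%:E * _) boo b0 => [b _ b0|//|//] le0 _ v0.
rewrite lee_fin in v0; congr (_%:E); apply/eqP; rewrite eq_le v0 andbT leNgt.
apply/negP => vp; have := le0 (Num.truncn (b / v)).+1.
rewrite -EFinM lee_fin leNgt => /negP; apply.
by rewrite -ltr_pdivrMr// truncnS_gt.
Qed.

(* The part of the operator at the cube of side [2 ^ j] containing [x] is compared with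
   the part of the potential coming from the annulus of radius [2 ^ (j + m)]: the
   maximal function on the annulus dominates the average over the cube. *)
Lemma dyadic_pot_le_Tpot m : (m <= 0)%R -> exists2 C : R, (0 < C)%R &
  forall z N L f (g : 'rV[R]_n -> R) x, measurable_fun setT f -> (forall y, 0 <= f y) ->
  (forall y, shifted_max (N + 3) L f y = (g y)%:E) ->
  dyadic_pot (gen_lab z N) sigma (level_ker k N m) L f x <= C%:E * Tpot k sigma g x.
Proof.
move=> m0; have [C C0 HC] := cube_le_annulus n_gt0 sigma_dbl `|(3 - m)%R|%N.
exists C => //.
move=> z N L f g x mf f0 fg.
have g0 y : (0 <= g y)%R by rewrite -lee_fin -fg; exact: shifted_max_ge0.
have mg : measurable_fun setT (fun y => (g y)%:E).
  by apply: eq_measurable_fun (measurable_shifted_max (N + 3) L f) => y _; rewrite fg.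
have mind j : measurable_fun setT (fun y => (\1_(annulus x j) y)%:E : \bar R).
  by apply/measurable_EFinP; apply: measurable_indic; exact: measurable_annulus.
pose G y := \sum_(i < L) ((\1_(annulus x (N + m - i%:Z)) y)%:E *
   ((k (2 ^ (N + m - i%:Z)))%:E * (g y)%:E)).
apply: (@le_trans _ _ (C%:E * \int[sigma]_y G y)); last first.
  rewrite lee_wpmul2l ?lee_fin ?(ltW C0)//; apply: le_integral_ge0 => y _.
    by apply: sume_ge0 => i _; rewrite !mule_ge0 ?lee_fin// k_ge0// two_gt0.
  exact: sum_annuli_le.
rewrite /G ge0_integral_sum//; first last.
- by move=> i y _; rewrite !mule_ge0 ?lee_fin// k_ge0// two_gt0.
- by move=> i; apply: emeasurable_funM => //; apply: emeasurable_funM.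
rewrite ge0_sume_distrr; last first.
  by move=> i _; apply: integral_ge0 => y _; rewrite !mule_ge0 ?lee_fin// k_ge0// two_gt0.
apply: lee_sum => i _; rewrite /cint cell_gen_lab -integral_indic_mul.
rewrite ge0_integralZl_EFin//; first last.
- by rewrite k_ge0// two_gt0.
- exact: measurable_funS mg.
- by move=> y _; rewrite lee_fin.
- exact: measurable_annulus.
rewrite [leRHS]muleCA /level_ker (_ : N - i%:Z + m = N + m - i%:Z)%R; last by lia.
rewrite lee_wpmul2l ?lee_fin ?k_ge0 ?two_gt0//.
(* Three extra scales make the shifted cube of generation i contain the sup-ball of radius 2^(N-i)
   around x, hence the cube of the given lattice. *)
have [t [sub avgle]] := @shifted_max_ge_avg (N + 3) L i x f (ltn_ord i).
move: sub avgle; set P := Qof _ _ _; rewrite (_ : N + 3 - i%:Z - 3 = N - i%:Z)%R; last by lia.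
move=> sub avgle.
have P0 : 0 < sigma P by exact: sigma_Qof_gt0.
have Poo : sigma P < +oo by exact: sigma_Qof_lty.
pose A := (sigma P)^-1 * \int[sigma]_(u in P) f u.
have A0 : 0 <= A by rewrite mule_ge0 ?inve_ge0//; exact: integral_ge0.
apply: (@le_trans _ _ (sigma P * A)).
  rewrite /A muleA divee ?mul1e ?gt_eqF ?ge0_fin_numE//.
  apply: le_integral_sub => //.
  by apply: subset_trans sub; exact: Qof_sub_cball.
apply: (@le_trans _ _ (C%:E * (sigma (annulus x (N + m - i%:Z)) * A))).
  rewrite [leRHS]muleA lee_wpmul2r// annulusE; apply: HC; apply: two_le_exp; lia.
rewrite lee_wpmul2l ?lee_fin ?(ltW C0)//.
rewrite muleC -integral_cst; last exact: measurable_annulus.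
apply: le_integral_ge0 => // y; rewrite annulusE => -[yx _].
rewrite -fg; apply: avgle; apply: eball_cball.
by apply: eball_le yx; rewrite two_le; lia.
Qed.

(** Upper model of the potential: where the distance to x is between 2^j and 2^(j+1), the kernel is
    at most k(2^j), and this annulus lies in the ball. With N = M and L = 2M + 1 the scales run from
    -M to M. *)
Definition trunc_pot N L f x : \bar R :=
  \sum_(i < L) (k (2 ^ (N - i%:Z)))%:E * \int[sigma]_(y in eball x (2 ^ (N - i%:Z + 1))) f y.

(** The kernel stays at 2^(N-i) while the cube shrinks to side 2^(N-m-i). The ball lies in a shifted
    cube three scales larger than its radius; the average there is at most the maximal function
    throughout the small cube, and doubling compares the two measures. *)
Lemma trunc_pot_le_dyadic_pot m : (0 <= m)%R -> exists2 C : R, (0 < C)%R & forall z N L f x,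
  (forall y, 0 <= f y) ->
  trunc_pot N L f x <= C%:E * dyadic_pot (gen_lab z (N - m)) sigma (level_ker k (N - m) m) L (shifted_max (N + 4) L f) x.
Proof.
move=> m0; have [C C0 HC] := cball_le_cube n_gt0 sigma_dbl `|(m + 4)%R|%N.
exists C => //.
move=> z N L f x f0; rewrite /dyadic_pot ge0_sume_distrr; last first.
  move=> i _; rewrite mule_ge0 ?lee_fin ?level_ker_ge0//; apply: cint_ge0 => y; exact: shifted_max_ge0.
apply: lee_sum => i _; rewrite muleCA /cint cell_gen_lab /level_ker.
rewrite (_ : N - m - i%:Z + m = N - i%:Z)%R; last by lia.
rewrite lee_wpmul2l ?lee_fin ?k_ge0 ?two_gt0//.
have [t [sub avgle]] := @shifted_max_ge_avg (N + 4) L i x f (ltn_ord i).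
move: sub avgle; set P := Qof (zshift _ _) _ _; rewrite (_ : N + 4 - i%:Z - 3 = N - i%:Z + 1)%R; last by lia.
move=> sub avgle.
have P0 : 0 < sigma P by exact: sigma_Qof_gt0.
have Poo : sigma P < +oo by exact: sigma_Qof_lty.
pose A := (sigma P)^-1 * \int[sigma]_(u in P) f u.
have A0 : 0 <= A by rewrite mule_ge0 ?inve_ge0//; exact: integral_ge0.
apply: (@le_trans _ _ (sigma P * A)).
  rewrite /A muleA divee ?mul1e ?gt_eqF ?ge0_fin_numE//.
  apply: le_integral_sub => //.
  by apply: subset_trans sub; exact: eball_cball.
apply: (@le_trans _ _ (C%:E * (sigma (Qof z (N - m - i%:Z) x) * A))).
  rewrite [leRHS]muleA lee_wpmul2r//.
  apply: (@le_trans _ _ (sigma (cball x (2 ^ (N + 4 - i%:Z))))).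
    apply: le_measure; rewrite ?inE; [exact: measurable_Qof|exact: measurable_cball|].
    exact: Qof_sub_cball.
  by apply: HC; apply: two_le_exp; lia.
rewrite lee_wpmul2l ?lee_fin ?(ltW C0)//.
rewrite muleC -integral_cst; last exact: measurable_Qof.
apply: le_integral_ge0 => // y yx; apply: avgle.
apply: cball_le (Qof_sub_cball yx); rewrite two_le; lia.
Qed.

Lemma trunc_pot_mono (M M' : nat) f x : (forall y, 0 <= f y) -> (M <= M')%N ->
  trunc_pot M%:Z M.*2.+1 f x <= trunc_pot M'%:Z M'.*2.+1 f x.
Proof.
move=> f0 /subnK <-; elim: (_ - _)%N => [|d IH]; first by rewrite add0n.
apply: (le_trans IH); rewrite addSn; set D := (d + M)%N.
rewrite /trunc_pot doubleS [leRHS]big_ord_recl [X in _ <= _ + X]big_ord_recr/=.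
set X := _ * _; set Y := _ * _.
have term0 (j : int) : 0 <= (k (2 ^ j))%:E * \int[sigma]_(y in eball x (2 ^ (j + 1))) f y.
  by rewrite mule_ge0 ?lee_fin ?k_ge0 ?two_gt0//; exact: integral_ge0.
have X0 : 0 <= X by exact: term0.
have Y0 : 0 <= Y by exact: term0.
apply: le_trans (leeDr _ X0); apply: le_trans (leeDl _ Y0).
apply: lee_sum => i _; rewrite (_ : D.+1%:Z - (bump 0 i)%:Z = D%:Z - i%:Z)%R//; rewrite /bump; lia.
Qed.

(* The value of the kernel at 0 may be infinite; it is harmless because [sigma] has no
   point masses. *)
Lemma Tpot_le_trunc_pot (f : 'rV[R]_n -> R) x (B : \bar R) : measurable_fun setT f ->
  (forall y, 0 <= f y)%R ->
  (forall M : nat, trunc_pot M%:Z M.*2.+1 (EFin \o f) x <= B) -> Tpot k sigma f x <= B.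
Proof.
move=> mf f0 HB.
have mE : measurable_fun setT (fun y => (f y)%:E) by exact/measurable_EFinP.
have mind j : measurable_fun setT (fun y => (\1_(annulus x j) y)%:E : \bar R).
  by apply/measurable_EFinP; apply: measurable_indic; exact: measurable_annulus.
have mpt : measurable_fun setT (fun y => (\1_[set x] y)%:E : \bar R).
  by apply/measurable_EFinP; apply: measurable_indic; exact: measurable_point.
pose S (M : nat) y := \sum_(i < M.*2.+1) ((\1_(annulus x (M%:Z - i%:Z + 1)) y)%:E *
   ((k (2 ^ (M%:Z - i%:Z)))%:E * (f y)%:E)).
have term0 (j j' : int) y : 0 <= (\1_(annulus x j) y)%:E * ((k (2 ^ j'))%:E * (f y)%:E).
  by rewrite !mule_ge0 ?lee_fin// k_ge0// two_gt0.
have S0 M y : 0 <= S M y by apply: sume_ge0 => i _; exact: term0.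
have mterm (j j' : int) : measurable_fun setT (fun y => (\1_(annulus x j) y)%:E * ((k (2 ^ j'))%:E * (f y)%:E)).
  by apply: emeasurable_funM => //; apply: emeasurable_funM.
have mS M : measurable_fun setT (S M) by apply: emeasurable_sum => i; exact: mterm.
have pt0 y : 0 <= +oo * (\1_[set x] y)%:E :> \bar R by rewrite mule_ge0// lee_fin.
apply: (@integral_le_liminf _ _ _ _ _ (fun M y => S M y + +oo * (\1_[set x] y)%:E)).
- by move=> M; apply: emeasurable_funD => //; apply: emeasurable_funM.
- by move=> M y; rewrite adde_ge0.
- by move=> y; rewrite mule_ge0 ?lee_fin//; exact: (kernel0_ge0 (enorm_ge0 _)).
- move=> M; rewrite ge0_integralTD//; last by apply: emeasurable_funM.
  rewrite ge0_integralTZl//.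
  rewrite integral_indic//; last exact: measurable_point.
  rewrite setIT sigma_point mule0 adde0; apply: le_trans (HB M).
  rewrite ge0_integral_sum//.
  apply: lee_sum => i _; rewrite -integral_indic_mul.
  rewrite ge0_integralZl_EFin//; first last.
  + by rewrite k_ge0// two_gt0.
  + exact: measurable_funS mE.
  + by move=> y _; rewrite lee_fin.
  + exact: measurable_annulus.
  rewrite lee_wpmul2l ?lee_fin ?k_ge0 ?two_gt0//.
  apply: le_integral_sub => [y|y _|y _|y _]; rewrite /= ?lee_fin//.
  by rewrite annulusE => -[].
move=> y u uy; have [->|yx] := eqVneq y x.
  exists 0%N => M _; rewrite indicE mem_set//= mule1 addeC addye ?leey//.
  by rewrite -ltNye (lt_le_trans _ (S0 _ _)).
have r0 : (0 < enorm (y - x))%R.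
  rewrite lt_neqAle enorm_ge0 andbT eq_sym; apply/eqP => e0.
  move/eqP : yx; apply; apply/rowP => i; apply/eqP; rewrite -subr_eq0 -normr_le0.
  by rewrite -e0; have := coord_le_enorm (y - x) i; rewrite !mxE.
have [j jr] := dyint_cover r0.
exists `|(j - 1)%R|%N => M jM.
rewrite (le_trans (ltW uy))// (le_trans _ (leeDl _ (pt0 y)))//.
pose i := inord (`|(M%:Z - (j - 1))%R|%N) : 'I_M.*2.+1.
have iE : (i : nat)%:Z = (M%:Z - (j - 1))%R by rewrite /i inordK; lia.
rewrite /S (bigD1 i)//= iE (_ : M%:Z - (M%:Z - (j - 1)) = j - 1)%R; last by lia.
rewrite subrK indicE mem_set// mul1e.
apply: (@le_trans _ _ ((k (2 ^ (j - 1)))%:E * (f y)%:E)); last first.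
  by rewrite leeDl//; apply: sume_ge0 => i' _; exact: term0.
rewrite lee_wpmul2r ?lee_fin// enormC /kernel0 gt_eqF// lee_fin k_noninc ?two_gt0//.
by move: jr; rewrite dyintE => -[].
Qed.

End Potential.

(** * Equivalence *)

Lemma conj_exponentE {R : realType} (p : R) : (1 < p)%R ->
  (conj_exponent p - 1 = (p - 1)^-1)%R.
Proof. by move=> p1; rewrite /conj_exponent; field; lra. Qed.

Lemma sum_poweR_le {R : realType} (T : finType) (a : T -> \bar R) (s : R) :
  (0 < s)%R -> (forall t, 0 <= a t) ->
  (\sum_(t : T) a t) `^ s <= (#|T|%:R `^ s)%:E * \sum_(t : T) a t `^ s.
Proof.
move=> s0 a0; pose M := \big[maxe/0]_(t : T) a t.
have aM t : a t <= M by exact: (le_bigmax _ _ t).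
have M0 : 0 <= M.
  by rewrite /M; elim/big_ind: _ => // u v u0 v0; rewrite le_max u0.
apply: (@le_trans _ _ ((#|T|%:R%:E * M) `^ s)).
  apply: lee_poweR; [exact: ltW|exact: sume_ge0|].
  apply: (@le_trans _ _ (\sum_(t : T) 1 * M)).
    by apply: lee_sum => t _; rewrite mul1e.
  by rewrite -ge0_sume_distrl// sumEFin sumr_const.
rewrite poweRM// poweR_EFin lee_wpmul2l ?lee_fin ?powR_ge0//.
exact: bigmax_poweR_le.
Qed.

Section Limits.
Context d (X : measurableType d) (R : realType) (nu : {measure set X -> \bar R}).
Implicit Types (f g : X -> \bar R) (s : R).

Lemma integral_poweR_le_liminf f (g : nat -> X -> \bar R) s (B : \bar R) : (0 < s)%R ->
  (forall N, measurable_fun setT (g N)) -> (forall N x, 0 <= g N x) ->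
  (forall x, 0 <= f x) -> (forall N, \int[nu]_x g N x `^ s <= B) ->
  (forall x u, u < f x -> exists N0 : nat, forall N : nat, (N0 <= N)%N -> u <= g N x) ->
  \int[nu]_x f x `^ s <= B.
Proof.
move=> s0 mg g0 f0 gB fg.
apply: (@integral_le_liminf _ _ _ _ _ (fun N x => g N x `^ s)) => //.
- by move=> N; exact: measurable_poweRf.
- by move=> N x; exact: poweR_ge0.
- by move=> x; exact: poweR_ge0.
move=> x u uf; have [u0|/ltW u0] := leP 0 u; last first.
  by exists 0%N => N _; exact: le_trans u0 (poweR_ge0 _ _).
have [N0 H] := fg _ _ (lte_poweRVl s0 (f0 x) u0 uf).
exists N0 => N NN; rewrite -(poweRK s0 u0).
by apply: lee_poweR; [exact: ltW|exact: poweR_ge0|exact: H].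
Qed.

(** Since [f] may be non-measurable, the constant is taken out of the integral of [g], rescaled by
    the inverse of [C], and not out of the integral of [f]. *)
Lemma integral_poweR_scale f g s (C : R) : (0 <= s)%R -> (0 < C)%R ->
  measurable_fun setT g -> (forall x, 0 <= g x) ->
  (forall x, g x <= C%:E * f x) ->
  \int[nu]_x g x `^ s <= (C `^ s)%:E * \int[nu]_x f x `^ s.
Proof.
move=> s0 C0 mg g0 gf; have V0 : (0 <= C^-1)%R by rewrite invr_ge0 ltW.
have -> : \int[nu]_x g x `^ s = (C `^ s)%:E * \int[nu]_x ((C^-1)%:E * g x) `^ s.
  rewrite -ge0_integralTZl; first last.
  - by move=> x; exact: poweR_ge0.
  - by rewrite lee_fin powR_ge0.
  - by apply: measurable_poweRf; apply: emeasurable_funM.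
  apply: eq_integral => x _.
  rewrite poweRM ?lee_fin// poweR_EFin muleA -EFinM -powRM//; last exact: ltW.
  by rewrite divff ?gt_eqF// powR1 mul1e.
rewrite lee_wpmul2l ?lee_fin ?powR_ge0//; apply: le_integral_ge0 => x _.
  exact: poweR_ge0.
apply: lee_poweR => //; first by rewrite mule_ge0// lee_fin.
rewrite -[leRHS]mul1e -[X in _ <= X%:E * _](mulVf (lt0r_neq0 C0)) EFinM -muleA.
by rewrite lee_wpmul2l ?lee_fin.
Qed.

Lemma LnormE (f : X -> R) (p : R) : (forall x, 0 <= f x)%R ->
  'N[nu]_p%:E[EFin \o f] = (\int[nu]_x (f x)%:E `^ p) `^ p^-1.
Proof.
move=> f0; rewrite unlock; congr (_ `^ _); apply: eq_integral => x _.
by rewrite /= ger0_norm.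
Qed.

Lemma mem_Lfun (f : X -> R) (p : R) : (forall x, 0 <= f x)%R ->
  measurable_fun setT f -> \int[nu]_x (f x)%:E `^ p < +oo -> f \in Lfun nu p%:E.
Proof.
move=> f0 mf fp; apply/andP; split; rewrite inE//= /finite_norm LnormE//.
exact: poweR_lty.
Qed.

Lemma Lfun_mem (f : X -> R) (p : R) : (0 < p)%R -> (forall x, 0 <= f x)%R ->
  f \in Lfun nu p%:E -> measurable_fun setT f /\ \int[nu]_x (f x)%:E `^ p < +oo.
Proof.
move=> p0 f0 /andP[]; rewrite !inE/= => mf; rewrite /finite_norm LnormE// => h.
split => //; have I0 : 0 <= \int[nu]_x (f x)%:E `^ p.
  by apply: integral_ge0 => x _; exact: poweR_ge0.
by rewrite -(poweRK p0 I0); exact: poweR_lty.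
Qed.

End Limits.

Section Equivalence.
Context {R : realType} {n : nat} (n_gt0 : (0 < n)%N).
Variables (k : R -> R) (mu sigma : {measure set 'rV[R]_n -> \bar R}) (p q : R).
Hypothesis k_ge0 : forall r : R, (0 < r)%R -> (0 <= k r)%R.
Hypothesis k_noninc : forall r s : R, (0 < r)%R -> (r <= s)%R -> (k s <= k r)%R.
Hypothesis q_ge1 : (1 <= q)%R.
Hypothesis qp : (q < p)%R.
Hypothesis mu_lf : locally_finite mu.
Hypothesis sigma_lf : locally_finite sigma.
Hypothesis sigma_dbl : doubling sigma.
Implicit Types (x y z : 'rV[R]_n) (m N : int).

Let p1 : (1 < p)%R. Proof. exact: le_lt_trans qp. Qed.
Let p0 : (0 < p)%R. Proof. exact: lt_trans p1. Qed.
Let q0 : (0 < q)%R. Proof. exact: lt_le_trans q_ge1. Qed.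
Let b0 : (0 <= (p - 1)^-1)%R. Proof. by rewrite invr_ge0 subr_ge0 ltW. Qed.
Let s := (q * (p - 1) / (p - q))%R.
Let s_gt0 : (0 < s)%R.
Proof. by rewrite divr_gt0 ?mulr_gt0 ?subr_gt0. Qed.

Definition trace := exists C : R, (0 < C)%R /\
  forall f : 'rV[R]_n -> R, f \in Lfun sigma p%:E -> (forall x, (0 <= f x)%R) ->
    (\int[mu]_x (Tpot k sigma f x) `^ q) `^ q^-1 <= C%:E * 'N[sigma]_p%:E[EFin \o f].

Definition wolff_int z N m : \bar R :=
  \int[mu]_x (wolff_sum (gen_lab z N) mu sigma (level_ker k N m) (p - 1)^-1 x) `^ s.

Lemma Kk0 N m i : (0 <= level_ker k N m i)%R.
Proof. exact: level_ker_ge0. Qed.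

Lemma WW0 z N m x : 0 <= wolff_sum (gen_lab z N) mu sigma (level_ker k N m) (p - 1)^-1 x.
Proof. exact: wolff_sum_ge0 (Kk0 N m) _ _. Qed.

Lemma mWW z N m : measurable_fun setT (wolff_sum (gen_lab z N) mu sigma (level_ker k N m) (p - 1)^-1).
Proof. by apply: measurable_wolff_sum; [exact: gen_lab_filtration|exact: Kk0]. Qed.

Let sg0 z N := sigma_cell_gt0 n_gt0 sigma_dbl z N.
Let sgoo z N := sigma_cell_lty sigma_lf z N.

Lemma muoo z N i x : mu (cell (gen_lab z N) i x) < +oo.
Proof. by rewrite cell_gen_lab; exact: locally_finite_Qof. Qed.

(** On a cell f <= 1 + f^p. Finite averages make the maximal function of [f] real valued, hence
    admissible in the trace inequality. *)
Lemma avg_lty z N i (f : 'rV[R]_n -> R) x : measurable_fun setT f ->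
  (forall y, 0 <= f y)%R -> \int[sigma]_y (f y)%:E `^ p < +oo ->
  avg (gen_lab z N) sigma i (EFin \o f) x < +oo.
Proof.
move=> mf f0 fp; have mE : measurable_fun setT (fun y => (f y)%:E) by exact/measurable_EFinP.
rewrite /avg lte_mul_pinfty ?inve_ge0//.
  by rewrite fin_numV ?gt_eqF ?sg0// (lt_trans _ (sg0 _ _ _ _)).
rewrite /cint integral_indic_mul.
apply: (@le_lt_trans _ _ (\int[sigma]_y ((\1_(cell (gen_lab z N) i x) y)%:E + (f y)%:E `^ p))).
  apply: le_integral_ge0 => y _; first by rewrite mule_ge0 ?lee_fin.
  rewrite indicE; case: (_ \in _); rewrite /= ?mul0e ?add0e ?lee_fin ?powR_ge0//.
  rewrite mul1r; have [f1|f1] := leP (f y) 1%R.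
    by rewrite (le_trans f1)// lerDl powR_ge0.
  rewrite (le_trans (_ : _ <= f y `^ p)%R)// ?lerDr//.
  by rewrite -[leLHS]powRr1// ler_powR ?(ltW f1)// ltW.
have mc : measurable (cell (gen_lab z N) i x) by rewrite cell_gen_lab; exact: measurable_Qof.
rewrite ge0_integralTD//; first last.
- by move=> y; exact: poweR_ge0.
- exact: measurable_poweRf.
- by apply/measurable_EFinP; exact: measurable_indic.
by rewrite integral_indic// setIT lte_add_pinfty// sgoo.
Qed.

Lemma shifted_max_lty N L (f : 'rV[R]_n -> R) x : measurable_fun setT f ->
  (forall y, 0 <= f y)%R -> \int[sigma]_y (f y)%:E `^ p < +oo ->
  shifted_max sigma N L (EFin \o f) x < +oo.
Proof.
move=> mf f0 fp; rewrite /shifted_max; elim/big_ind: _ => // [u v u0 v0|t _].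
  by rewrite gt_max u0.
by elim: L => //= L IH; rewrite gt_max IH avg_lty.
Qed.

(** The trace inequality is applied to the maximal function of [f], which is bounded in L^p and
    whose potential dominates the dyadic potential of [f]. *)
Lemma trace_dyadic_pot m : (m <= 0)%R -> trace -> exists2 C : R, (0 <= C)%R &
  forall z N L (f : 'rV[R]_n -> R), measurable_fun setT f -> (forall x, 0 <= f x)%R ->
  \int[sigma]_x (f x)%:E `^ p < +oo ->
  \int[mu]_x (dyadic_pot (gen_lab z N) sigma (level_ker k N m) L (EFin \o f) x) `^ q <=
  C%:E * (\int[sigma]_x (f x)%:E `^ p) `^ (q / p).
Proof.
move=> m0 [C [C0 HC]].
have [C1 C10 H1] := dyadic_pot_le_Tpot n_gt0 k_ge0 k_noninc sigma_lf sigma_dbl m0.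
have [C2 C20 H2] := shifted_max_strong n_gt0 sigma_lf sigma_dbl p1.
exists (C1 `^ q * (C `^ q * C2 `^ (q / p)))%R; first by rewrite !mulr_ge0// powR_ge0.
move=> z N L f mf f0 fp.
have mE : measurable_fun setT (EFin \o f) by exact/measurable_EFinP.
have E0 y : 0 <= (EFin \o f) y by rewrite lee_fin.
pose g y := fine (shifted_max sigma (N + 3) L (EFin \o f) y).
have fg y : shifted_max sigma (N + 3) L (EFin \o f) y = (g y)%:E.
  by rewrite /g fineK// ge0_fin_numE ?shifted_max_lty//; exact: shifted_max_ge0.
have g0 y : (0 <= g y)%R by rewrite -lee_fin -fg; exact: shifted_max_ge0.
have mg : measurable_fun setT g.
  by apply: measurableT_comp; [exact: fine_measurable|exact: measurable_shifted_max].
have gp : \int[sigma]_x (g x)%:E `^ p <= C2%:E * \int[sigma]_x (f x)%:E `^ p.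
  by under eq_integral do rewrite -fg; exact: H2.
have gpoo : \int[sigma]_x (g x)%:E `^ p < +oo.
  by apply: (le_lt_trans gp); rewrite lte_mul_pinfty// lee_fin.
have Ig0 : 0 <= \int[sigma]_x (g x)%:E `^ p by apply: integral_ge0 => x _; exact: poweR_ge0.
have If0 : 0 <= \int[sigma]_x (f x)%:E `^ p by apply: integral_ge0 => x _; exact: poweR_ge0.
apply: (@le_trans _ _ ((C1 `^ q)%:E * \int[mu]_x (Tpot k sigma g x) `^ q)).
  apply: integral_poweR_scale => //; first exact: ltW.
  - exact: measurable_dyadic_pot (gen_lab_filtration z N) _ _ _ _.
  - move=> x; apply: sume_ge0 => i _; rewrite mule_ge0 ?lee_fin ?Kk0//.
    exact: cint_ge0.
  - by move=> x; apply: H1.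
rewrite EFinM -muleA lee_wpmul2l ?lee_fin ?powR_ge0//.
have := HC g (mem_Lfun g0 mg gpoo) g0; rewrite LnormE//.
have IT0 : 0 <= \int[mu]_x Tpot k sigma g x `^ q.
  by apply: integral_ge0 => x _; exact: poweR_ge0.
move=> /(lee_poweR (ltW q0) (poweR_ge0 _ _)); rewrite poweRK// => /le_trans; apply.
rewrite poweRM ?lee_fin ?(ltW C0) ?poweR_ge0// poweR_EFin EFinM -muleA.
rewrite lee_wpmul2l ?lee_fin ?powR_ge0// -poweRrM mulrC.
apply: (le_trans (lee_poweR _ Ig0 gp)); first by rewrite divr_ge0// ltW.
by rewrite poweRM ?lee_fin// poweR_EFin.
Qed.

(** The constants of the previous steps depend neither on the lattice nor on its top scale, whence
    the uniformity in [z] and [N]. *)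
Lemma trace_wolff_int m : (m <= 0)%R -> trace ->
  exists2 B : R, (0 <= B)%R & forall z N, wolff_int z N m <= B%:E.
Proof.
move=> m0 tr; have [C C0 HC] := trace_dyadic_pot m0 tr.
have [B B0 HB] := trace_wolff q_ge1 qp C0; exists B => // z N.
apply: (HB _ _ _ (gen_lab_filtration z N) mu sigma (sg0 z N) (sgoo z N) (muoo z N) _ (Kk0 N m)).
exact: HC.
Qed.

Lemma wolff_int_trace m (B : R) : LBO k sigma -> (0 <= m)%R -> (0 <= B)%R ->
  (forall N, wolff_int 0 N m <= B%:E) -> trace.
Proof.
move=> lbo m0 B0 HB.
have [C0 C00 H0] := cube_ker_quasi n_gt0 k_ge0 k_noninc sigma_lf sigma_dbl m lbo.
have [C1 C10 H1] := trunc_pot_le_dyadic_pot n_gt0 k_ge0 sigma_lf sigma_dbl m0.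
have [C2 C20 H2] := shifted_max_strong n_gt0 sigma_lf sigma_dbl p1.
have [C3 C30 H3] := wolff_trace q_ge1 qp C00 B0.
pose D := (C1 `^ q * (C3 * C2 `^ (q / p)))%R.
have D0 : (0 <= D)%R by rewrite /D !mulr_ge0// powR_ge0.
exists (D `^ q^-1 + 1)%R; split; first by rewrite ltr_pwDr// powR_ge0.
move=> f fL f0; have [mf fp] := Lfun_mem p0 f0 fL; rewrite LnormE//.
have mE : measurable_fun setT (EFin \o f) by exact/measurable_EFinP.
have E0 y : 0 <= (EFin \o f) y by rewrite lee_fin.
have If0 : 0 <= \int[sigma]_x (f x)%:E `^ p by apply: integral_ge0 => x _; exact: poweR_ge0.
have MM0 N L y : 0 <= shifted_max sigma N L (EFin \o f) y by exact: shifted_max_ge0.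
have IM0 N L : 0 <= \int[sigma]_x shifted_max sigma N L (EFin \o f) x `^ p.
  by apply: integral_ge0 => x _; exact: poweR_ge0.
pose G (M : nat) x := C1%:E * dyadic_pot (gen_lab 0 (M%:Z - m)) sigma (level_ker k (M%:Z - m) m) M.*2.+1
   (shifted_max sigma (M%:Z + 4) M.*2.+1 (EFin \o f)) x.
have TT0 (M : nat) x : 0 <= dyadic_pot (gen_lab 0 (M%:Z - m)) sigma (level_ker k (M%:Z - m) m) M.*2.+1
   (shifted_max sigma (M%:Z + 4) M.*2.+1 (EFin \o f)) x.
  by apply: sume_ge0 => i _; rewrite mule_ge0 ?lee_fin ?Kk0//; exact: cint_ge0.
have mTT (M : nat) : measurable_fun setT (dyadic_pot (gen_lab 0 (M%:Z - m)) sigma (level_ker k (M%:Z - m) m) M.*2.+1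
   (shifted_max sigma (M%:Z + 4) M.*2.+1 (EFin \o f))).
  exact: measurable_dyadic_pot (gen_lab_filtration _ _) _ _ _ _.
have T0 x : 0 <= Tpot k sigma f x.
  by apply: integral_ge0 => y _; rewrite mule_ge0 ?lee_fin// kernel0_ge0// enorm_ge0.
suff main : \int[mu]_x Tpot k sigma f x `^ q <=
    D%:E * (\int[sigma]_x (f x)%:E `^ p) `^ (q / p).
  apply: (@le_trans _ _ ((D%:E * (\int[sigma]_x (f x)%:E `^ p) `^ (q / p)) `^ q^-1)).
    by apply: lee_poweR main; [rewrite invr_ge0 ltW|apply: integral_ge0 => x _; exact: poweR_ge0].
  rewrite poweRM ?lee_fin ?poweR_ge0// poweR_EFin -poweRrM.
  have -> : (q / p * q^-1 = p^-1)%R by field; rewrite !gt_eqF.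
  by rewrite lee_wpmul2r ?poweR_ge0// lee_fin lerDl.
apply: (integral_poweR_le_liminf q0 (g := G)) => //.
- by move=> M; apply: emeasurable_funM.
- by move=> M x; rewrite mule_ge0// lee_fin ltW.
- move=> M; apply: le_trans (integral_poweR_scale _ _ C10 _ _ (f := dyadic_pot (gen_lab 0 (M%:Z - m)) sigma
    (level_ker k (M%:Z - m) m) M.*2.+1 (shifted_max sigma (M%:Z + 4) M.*2.+1 (EFin \o f))) _) _ => //.
  + exact: ltW.
  + by apply: emeasurable_funM.
  + by move=> x; rewrite mule_ge0// lee_fin ltW.
  rewrite /D EFinM -muleA lee_wpmul2l ?lee_fin ?powR_ge0//.
  have IMle := H2 (M%:Z + 4)%R M.*2.+1 _ mE E0.
  apply: (le_trans (H3 _ _ _ (gen_lab_filtration 0 (M%:Z - m)) mu sigma (sg0 _ _) (sgoo _ _)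
    (muoo _ _) _ (Kk0 _ _) _ (HB _) _ _ _ _ _)) => //.
  + by move=> i x y /esym/gen_labP xy; rewrite !ker_sum_cube_ker//; apply: H0; apply/QofP.
  + exact: measurable_shifted_max.
  + by apply: (le_lt_trans IMle); rewrite lte_mul_pinfty// lee_fin.
  rewrite EFinM -muleA lee_wpmul2l ?lee_fin//.
  apply: (le_trans (lee_poweR _ (IM0 _ _) IMle)); first by rewrite divr_ge0// ltW.
  by rewrite poweRM ?lee_fin// poweR_EFin.
(* [G M] need not be monotone, as its shifted lattices move with M, but [trunc_pot] is. If [G M']
   stayed below u for arbitrarily large M', these M' would bound every truncation, hence the
   potential itself. *)
move=> x u; rewrite ltNge => /negP uT; apply: contrapT => /forallNP h; apply: uT.
apply: (Tpot_le_trunc_pot n_gt0 k_ge0 k_noninc sigma_lf sigma_dbl) => // M.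
have /existsNP[M' /not_implyP[MM' /negP]] := h M; rewrite -ltNge => /ltW.
apply: le_trans; apply: (@le_trans _ _ (trunc_pot k sigma M'%:Z M'.*2.+1 (EFin \o f) x)).
  exact: trunc_pot_mono.
exact: H1.
Qed.

Lemma dyadic_ge0 z x : 0 <= dyadic_wolff z (fun Q => k (side Q)) sigma p mu x.
Proof. by rewrite dyadic_wolffE//; apply: esum_ge0 => j _; exact: cube_term_ge0. Qed.

Lemma wolff_sum_le_dyadic z N x : wolff_sum (gen_lab z N) mu sigma (level_ker k N 0) (p - 1)^-1 x <=
  dyadic_wolff z (fun Q => k (side Q)) sigma p mu x.
Proof.
rewrite dyadic_wolffE// conj_exponentE// wolff_sumE//.
rewrite -(@esum_int_le _ (fun j => cube_term k mu sigma (p - 1)^-1 z 0 j x)); last by move=> j; exact: cube_term_ge0.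
rewrite esum_mkcond; apply: le_esum => j _; case: ifP => // _; exact: cube_term_ge0.
Qed.

Lemma trace_dyadic : trace -> ereal_sup (range (fun z : 'rV[R]_n =>
  \int[mu]_x (dyadic_wolff z (fun Q => k (side Q)) sigma p mu x) `^ s)) < +oo.
Proof.
move=> tr; have [B B0 HB] := @trace_wolff_int 0%R (lexx _) tr.
apply: (@le_lt_trans _ _ B%:E); last exact: ltry.
apply: ge_ereal_sup => _ [z _ <-].
apply: (integral_poweR_le_liminf s_gt0 (g := fun (N : nat) =>
  wolff_sum (gen_lab z N%:Z) mu sigma (level_ker k N%:Z 0) (p - 1)^-1)).
- by move=> N; exact: mWW.
- by move=> N x; exact: WW0.
- by move=> x; exact: dyadic_ge0.
- by move=> N; exact: HB.
move=> x u; rewrite dyadic_wolffE// conj_exponentE// => /esum_int_lt.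
case=> [j|N0 H]; first exact: cube_term_ge0.
by exists N0 => N NN; rewrite wolff_sumE//; exact: H.
Qed.

Lemma dyadic_trace : LBO k sigma -> ereal_sup (range (fun z : 'rV[R]_n =>
  \int[mu]_x (dyadic_wolff z (fun Q => k (side Q)) sigma p mu x) `^ s)) < +oo -> trace.
Proof.
move=> lbo dy; pose I := \int[mu]_x (dyadic_wolff 0 (fun Q => k (side Q)) sigma p mu x) `^ s.
have I0 : 0 <= I by apply: integral_ge0 => x _; exact: poweR_ge0.
have Ioo : I < +oo.
  by apply: le_lt_trans dy; apply: ereal_sup_ubound; exists 0%R.
apply: (@wolff_int_trace 0 (fine I)) => // [|N]; first exact: fine_ge0.
rewrite fineK ?ge0_fin_numE//; apply: le_integral_ge0 => x _; first exact: poweR_ge0.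
by apply: lee_poweR; [exact: ltW|exact: WW0|exact: wolff_sum_le_dyadic].
Qed.

Lemma wolffE x : wolff k sigma p mu x = wolff_pot k mu sigma (p - 1)^-1 x.
Proof. by rewrite /wolff /wolff_pot /wolff_at conj_exponentE. Qed.

Lemma trace_continuous : trace -> \int[mu]_x (wolff k sigma p mu x) `^ s < +oo.
Proof.
(* The offset -4 is the one of [wolff_up_le_cube_term]; the bound is needed for all lattices
   [zshift N t] at once. *)
move=> tr; have [B B0 HB] := @trace_wolff_int (- 4) isT tr.
have [C C0 HC] := wolff_le_wolff_sum n_gt0 mu k_ge0 k_noninc sigma_lf sigma_dbl b0.
pose S (N : nat) x := \sum_(t : {ffun 'I_n -> bool})
  wolff_sum (gen_lab (zshift N%:Z t) N%:Z) mu sigma (level_ker k N%:Z (- 4)) (p - 1)^-1 x.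
have S0 (N : nat) x : 0 <= S N x by apply: sume_ge0 => t _; exact: WW0.
have mS (N : nat) : measurable_fun setT (S N) by apply: emeasurable_sum => t; exact: mWW.
pose T : finType := {ffun 'I_n -> bool}.
pose D := (C `^ s * (#|T|%:R `^ s * (#|T|%:R * B)))%R.
apply: (@le_lt_trans _ _ D%:E); last exact: ltry.
under eq_integral do rewrite wolffE.
apply: (integral_poweR_le_liminf s_gt0 (g := fun (N : nat) x => C%:E * S N x)).
- by move=> N; apply: emeasurable_funM.
- by move=> N x; rewrite mule_ge0// lee_fin ltW.
- by move=> x; apply: integral_ge0 => r; rewrite /= in_itv/= andbT; exact: wolff_at_ge0.
- move=> N; apply: le_trans (integral_poweR_scale _ _ C0 _ _ (f := S N) _) _ => //.
  + exact: ltW.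
  + by apply: emeasurable_funM.
  + by move=> x; rewrite mule_ge0// lee_fin ltW.
  rewrite /D EFinM lee_wpmul2l ?lee_fin ?powR_ge0//.
  pose W t x := (wolff_sum (gen_lab (zshift N%:Z t) N%:Z) mu sigma (level_ker k N%:Z (- 4)) (p - 1)^-1 x) `^ s.
  have W0 t x : 0 <= W t x by exact: poweR_ge0.
  have mW t : measurable_fun setT (W t) by apply: measurable_poweRf; exact: mWW.
  apply: (@le_trans _ _ (\int[mu]_x ((#|T|%:R `^ s)%:E * \sum_(t : T) W t x))).
    apply: le_integral_ge0 => x _; first exact: poweR_ge0.
    by apply: sum_poweR_le => // t; exact: WW0.
  rewrite ge0_integralTZl ?lee_fin ?powR_ge0//; first last.
  + by move=> x; apply: sume_ge0.
  + by apply: emeasurable_sum.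
  rewrite EFinM lee_wpmul2l ?lee_fin ?powR_ge0// ge0_integral_sum//.
  apply: (@le_trans _ _ (\sum_(t : T) B%:E)).
    by apply: lee_sum => t _; exact: HB.
  by rewrite sumEFin sumr_const mulr_natl.
by move=> x u /HC[N0 H]; exists N0 => N; exact: H.
Qed.

Lemma continuous_trace : LBO k sigma ->
  \int[mu]_x (wolff k sigma p mu x) `^ s < +oo -> trace.
Proof.
move=> lbo ct; set I := (X in X < _) in ct.
have I0 : 0 <= I by apply: integral_ge0 => x _; exact: poweR_ge0.
have [C C0 HC] := wolff_sum_le_wolff n_gt0 mu k_ge0 k_noninc sigma_lf sigma_dbl b0.
have B0 : (0 <= C `^ s * fine I)%R by rewrite mulr_ge0 ?powR_ge0 ?fine_ge0.
(* The offset n + 1 of [wolff_sum_le_wolff] has the sign required for recovering the trace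
   inequality. *)
apply: (@wolff_int_trace n.+1%:Z _ lbo _ B0) => // N.
rewrite EFinM fineK ?ge0_fin_numE//.
apply: integral_poweR_scale => //.
- exact: ltW.
- exact: mWW.
- by move=> x; exact: WW0.
- by move=> x; rewrite wolffE.
Qed.

End Equivalence.

Theorem theorem3p11 (R : realType) (n : nat) (n_gt0 : (0 < n)%N)
    (k : R -> R)
    (k_ge0 : forall r : R, (0 < r)%R -> (0 <= k r)%R)
    (k_noninc : forall r s : R, (0 < r)%R -> (r <= s)%R -> (k s <= k r)%R)
    (k_lsc : lower_semicontinuous
               (EFin \o k : subspace (`]0%R, +oo[ : set R) -> \bar R))
    (p q : R) (q_ge1 : (1 <= q)%R) (qp : (q < p)%R)
    (mu sigma : {measure set 'rV[R]_n -> \bar R})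
    (mu_lf : locally_finite mu) (sigma_lf : locally_finite sigma)
    (sigma_dbl : doubling sigma) (lbo : LBO k sigma) :
  let trace_ineq :=
    exists C : R, (0 < C)%R /\
      forall f : 'rV[R]_n -> R, f \in Lfun sigma p%:E ->
        (forall x, (0 <= f x)%R) ->
        (\int[mu]_x (Tpot k sigma f x) `^ q) `^ q^-1
          <= C%:E * 'N[sigma]_p%:E[EFin \o f] in
  let dyadic_cond :=
    ereal_sup (range (fun z : 'rV[R]_n =>
      \int[mu]_x (dyadic_wolff z (fun Q => k (side Q)) sigma p mu x)
                   `^ (q * (p - 1) / (p - q)))) < +oo in
  let continuous_cond :=
    \int[mu]_x (wolff k sigma p mu x) `^ (q * (p - 1) / (p - q)) < +oo in
  (trace_ineq <-> dyadic_cond) /\ (dyadic_cond <-> continuous_cond).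
Proof.
have td := trace_dyadic n_gt0 k_ge0 k_noninc q_ge1 qp mu_lf sigma_lf sigma_dbl.
have dt := dyadic_trace n_gt0 k_ge0 k_noninc q_ge1 qp mu_lf sigma_lf sigma_dbl lbo.
have tc := trace_continuous n_gt0 k_ge0 k_noninc q_ge1 qp mu_lf sigma_lf sigma_dbl.
have ct := continuous_trace n_gt0 k_ge0 k_noninc q_ge1 qp mu_lf sigma_lf sigma_dbl lbo.
by split; split => // h; [apply: tc; exact: dt|apply: td; exact: ct].
Qed.
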